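(* Consider Problem P2, with O1 using a policy given by thresholds $(\alpha^1_t,\beta^1_t,\delta^1_t,\theta^1_t)$ at times $t=1,\dots,T^1-1$ and a threshold $\alpha^1_{T^1}$ at time $T^1$, and O2 using thresholds $(\alpha^2_t,\beta^2_t)$, $t=1,\dots,T^1-1$, as long as O1 has not sent a final message and the Wald thresholds once the final message has been received. For $t=1,2,\dots,T^1-1$, there exist functions $\mathcal{F}_t(\psi_t,\alpha^1_t,\beta^1_t,\delta^1_t,\theta^1_t)$ and $\mathcal{F}^*_t(\psi_t)$, and $\mathcal{G}_t(\phi_t[b],\alpha^2_t,\beta^2_t)$ and $\mathcal{G}^*_t(\phi_t[b])$, where $$\mathcal{F}^*_t(\psi_t)=\inf_{\alpha^1_t,\beta^1_t,\delta^1_t,\theta^1_t}\mathcal{F}_t(\psi_t,\alpha^1_t,\beta^1_t,\delta^1_t,\theta^1_t),\qquad \mathcal{G}^*_t(\phi_t[b])=\inf_{\alpha^2_t,\beta^2_t}\mathcal{G}_t(\phi_t[b],\alpha^2_t,\beta^2_t),$$ and for $t=T^1$ there exist functions $\mathcal{F}_{T^1}(\psi_{T^1},\alpha^1_{T^1})$ and $\mathcal{F}^*_{T^1}(\psi_{T^1})$ where $$\mathcal{F}^*_{T^1}(\psi_{T^1})=\inf_{\alpha^1_{T^1}}\mathcal{F}_{T^1}(\psi_{T^1},\alpha^1_{T^1}),$$ such that the optimal thresholds can be evaluated from these functions as follows: 1. $\psi_1$ is fixed a priori and does not depend on any design choice. The optimal thresholds at $t=1$ for O1 are given by the optimizing parameters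 in the definition of $\mathcal{F}^*_1(\psi_1)$. 2. Once O1's thresholds are fixed, $\phi_1[b]$ is fixed. The optimizing thresholds to be used by O2 if a blank message was received are given by the optimizing parameters in the definition of $\mathcal{G}^*_1(\phi_1[b])$. In case a $0$ or $1$ was received from O1, the optimal thresholds for O2 from this time onwards are the Wald thresholds for a finite horizon $T^2-1$. 3. Continuing sequentially, $\psi_t$ is fixed by the choice of past thresholds and the optimal thresholds for O1 at time $t$ are given by the optimizing parameters in the definition of $\mathcal{F}^*_t(\psi_t)$. Once O1's thresholds are fixed, $\phi_t[b]$ is fixed. The optimizing thresholds to be used by O2 if a blank message was received are given by the optimizing parameters in the definition of $\mathcal{G}^*_t(\phi_t[b])$. In case a $0$ or $1$ was received from O1, the optimal thresholds for O2 from this time onwards are the Wald thresholds for a finite horizon $T^2-t$.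
   Context: **Model.** $H\in\{0,1\}$ is random with known prior $P(H=0)=p_0$, $P(H=1)=1-p_0$. There are two observers O1, O2. $Y^i_t\in\mathcal{Y}^i$ is the observation of O$i$ at time $t$; given $H$, it has either a discrete distribution $P^i_t(\cdot|H)$ or a density $f^i_t(\cdot|H)$. Given $H$, the observations of each observer at different times are independent, and the two observation sequences are independent. $X_{1:t}$ denotes $X_1,\dots,X_t$; $b$ is a blank message and $b_{1:t}$ a sequence of $t$ blanks. **O1.** As long as it has not sent a final message, at time $t$ O1 chooses $Z^1_t=\gamma^1_t(Y^1_{1:t})\in\{0,1,b\}$; $\tau^1=\min\{t: Z^1_t\in\{0,1\}\}\le T^1<\infty$ (at time $T^1$ it must send $0$ or $1$ if it has not done so before). It sends only this single final message and gets no feedback from O2. O1's belief is $\pi^1_t=P(H=0|Y^1_{1:t})$. **Problem P2.** O2 takes measurements from time $t=1$; at each time $t$, after O1's action at time $t$, O2 (if not stopped) chooses $U^2_t=\gamma^2_t(Y^2_{1:t},Z^1_{1:t})\in\{0,1,N\}$ ($N$ = continue), where for $t>\tau^1$ the sequence $Z^1_{1:t}$ means $Z^1_{1:\tau^1}$. $\tau^2=\min\{t:U^2_t\in\{0,1\}\}\le T^2$, $T^1\le T^2<\infty$. O2 may stop before O1 does. The objective is to minimize $\mathbb{E}^{\Gamma^1,\Gamma^2}\{c^1\tau^1+c^2\tau^2+J(U^2_{\tau^2},H)\}$ over $\Gamma^1=(\gamma^1_1,\dots,\gamma^1_{T^1})$, $\Gamma^2=(\gamma^2_1,\dots,\gamma^2_{T^2})$,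 where $c^1,c^2$ are finite positive numbers, $0\le J\le L<\infty$, $J(0,1)>J(1,1)$, $J(1,0)>J(0,0)$. **O2's belief.** $\pi^2_t=P^{\Gamma^1}(H=0|Y^2_{1:t},Z^1_{1:t})$, $\pi^2_0=p_0$; once O2 has announced its final decision its belief no longer changes. **Threshold policies.** O1, for $t\le T^1-1$ (with $0\le\alpha^1_t\le\beta^1_t\le\delta^1_t\le\theta^1_t\le1$): $Z^1_t=1$ if $\alpha^1_t\le\pi^1_t\le\beta^1_t$; $Z^1_t=0$ if $\delta^1_t\le\pi^1_t\le\theta^1_t$; $Z^1_t=b$ otherwise. At $T^1$ (with $0\le\alpha^1_{T^1}\le1$): $Z^1_{T^1}=1$ if $\pi^1_{T^1}\le\alpha^1_{T^1}$ and $0$ otherwise. O2, at time $t\le T^1-1$ if $Z^1_{1:t}=b_{1:t}$ (with $0\le\alpha^2_t\le\beta^2_t\le1$): $U^2_t=1$ if $\pi^2_t\le\alpha^2_t$; $U^2_t=N$ if $\alpha^2_t<\pi^2_t<\beta^2_t$; $U^2_t=0$ if $\pi^2_t\ge\beta^2_t$. **Wald thresholds.** Once O1's final message arrives at time $t$, O2 (if not stopped) faces the classical centralized sequential detection (Wald) problem with initial belief $\pi^2_t$, at most $T^2-t$ further measurements, cost $c^2$ per measurement and terminal cost $J$. Its optimal policy is of two-threshold form in O2's current belief; these are the Wald thresholds for horizon $T^2-t$. **Information states.** $D_t:=\mathbf{1}_{\{\tau^2\ge t\}}$. Given the decision functions $\Gamma^1_{t-1},\Gamma^2_{t-1}$ of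 O1 and O2 up to time $t-1$, $\psi_t:=P^{\Gamma^1_{t-1},\Gamma^2_{t-1}}(H,\pi^1_t,\pi^2_{t-1},D_t\,|\,Z^1_{1:t-1}=b_{1:t-1})$ (conditional joint law). Given those of O1 up to time $t$ and of O2 up to time $t-1$, $\phi_t[z]:=P^{\Gamma^1_t,\Gamma^2_{t-1}}(H,\pi^1_t,\pi^2_t,D_t\,|\,Z^1_{1:t-1}=b_{1:t-1},Z^1_t=z)$, $z\in\{0,1,b\}$. $\phi_t[z]$ is determined by $\psi_t$, O1's thresholds at $t$, and $z$; $\psi_{t+1}$ is determined by $\phi_t[b]$ and O2's thresholds at $t$. ''Optimizing parameters'' are parameters attaining the infimum. *)

(* Defs.v *)
From HB Require Import structures.
From mathcomp Require Import all_boot all_order all_algebra.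
From mathcomp Require Import all_classical all_reals all_analysis.

Set Implicit Arguments.
Unset Strict Implicit.
Unset Printing Implicit Defensive.

Import Order.TTheory GRing.Theory Num.Theory.

Local Open Scope classical_set_scope.
Local Open Scope ring_scope.

(* The binary alphabet {0, 1} is bool with 0 = false and 1 = true.  [None] is
   the blank message b when [action] is used for O1, and N (continue) when it
   is used for O2. *)
Definition action : Type := option bool.

HB.instance Definition _ := Pointed.on action.
HB.instance Definition _ := @isMeasurable.Build default_measure_display action
  discrete_measurable discrete_measurable0 discrete_measurableC
  discrete_measurableU.

(* Times are 1-based.  With T = horizon, the value is T.+1 when no action is
   taken at any of the times 1, ..., T. *)
Definition stop_time (T : nat) (a : nat -> action) : nat :=
  (find (fun t => a t != None) (iota 1 T)).+1.

Definition history (Omega T : Type) (X : nat -> Omega -> T) (t : nat)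
  (w : Omega) : t.-tuple T := [tuple X i.+1 w | i < t].

(* The observations of one observer.  "A discrete distribution or a density"
   is a density with respect to a sigma-finite reference measure, such as a
   counting measure or Lebesgue measure.  [law t h] is the conditional
   distribution of the time-t observation given H = h. *)
Record sensor (R : realType) (d : measure_display) (Y : measurableType d) :=
  Sensor {
    ref : nat -> {sigma_finite_measure set Y -> \bar R};
    dens : nat -> bool -> Y -> R;
    law : nat -> bool -> probability Y R;
    dens_ge0 : forall t h y, 0 <= dens t h y;
    dens_measurable : forall t h, measurable_fun setT (dens t h);
    law_dens : forall t h (A : set Y), measurable A ->
      law t h A = (\int[ref t]_(y in A) (dens t h y)%:E)%E
  }.

(* [obs_law] says that, given H, all the observations of the two observers are
   mutually independent and the time-t observation of O1 (resp. O2) is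
   distributed as [law O1 t H] (resp. [law O2 t H]).  [loss u h] is J(u, h)
   and [lossB] is its bound L. *)
Record problem (R : realType) (d d1 d2 : measure_display)
    (Omega : measurableType d) (Y1 : measurableType d1)
    (Y2 : measurableType d2) := Problem {
  Pr : probability Omega R;
  hyp : Omega -> bool;
  p0 : R;
  O1 : sensor R Y1;
  O2 : sensor R Y2;
  obs1 : nat -> Omega -> Y1;
  obs2 : nat -> Omega -> Y2;
  T1 : nat;
  T2 : nat;
  c1 : R;
  c2 : R;
  loss : bool -> bool -> R;
  lossB : R;
  T1_gt0 : (0 < T1)%N;
  T1_le_T2 : (T1 <= T2)%N;
  c1_gt0 : 0 < c1;
  c2_gt0 : 0 < c2;
  loss_bounds : forall u h, 0 <= loss u h <= lossB;
  loss_err1 : loss true true < loss false true;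
  loss_err0 : loss false false < loss true false;
  hyp_measurable : measurable_fun setT hyp;
  obs1_measurable : forall t, measurable_fun setT (obs1 t);
  obs2_measurable : forall t, measurable_fun setT (obs2 t);
  prior : Pr [set w | hyp w = false] = p0%:E;
  obs_law : forall (h : bool) (A : nat -> set Y1) (B : nat -> set Y2),
    (forall t, measurable (A t)) -> (forall t, measurable (B t)) ->
    (Pr [set w | [/\ hyp w = h,
                    forall t, (1 <= t <= T1)%N -> A t (obs1 t w) &
                    forall t, (1 <= t <= T2)%N -> B t (obs2 t w)]] =
     Pr [set w | hyp w = h] *
       (\prod_(1 <= t < T1.+1) fine (law O1 t h (A t)))%:E *
       (\prod_(1 <= t < T2.+1) fine (law O2 t h (B t)))%:E)%E
}.

Record thr4 (R : realType) :=
  Thr4 { alpha4 : R; beta4 : R; delta4 : R; theta4 : R }.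

Definition adm_thr4 (R : realType) (a : thr4 R) : Prop :=
  [/\ 0 <= alpha4 a, alpha4 a <= beta4 a, beta4 a <= delta4 a,
      delta4 a <= theta4 a & theta4 a <= 1].

Record thr2 (R : realType) := Thr2 { alpha2 : R; beta2 : R }.

Definition adm_thr2 (R : realType) (a : thr2 R) : Prop :=
  [/\ 0 <= alpha2 a, alpha2 a <= beta2 a & beta2 a <= 1].

Definition adm_thr1 (R : realType) (a : R) : Prop := 0 <= a <= 1.

(* Where two clauses of a rule overlap (beta = delta for [rule4],
   alpha = beta for [rule2]) the value 1 is chosen. *)
Definition rule4 (R : realType) (a : thr4 R) (x : R) : action :=
  if alpha4 a <= x <= beta4 a then Some true
  else if delta4 a <= x <= theta4 a then Some false else None.

Definition rule2 (R : realType) (a : thr2 R) (x : R) : action :=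
  if x <= alpha2 a then Some true else if x < beta2 a then None
  else Some false.

Definition rule1 (R : realType) (a x : R) : action := Some (x <= a).

(* [thr_O1 t] and [thr_O2 t] are the thresholds of O1 and O2 at time
   t = 1, ..., T1 - 1; [thr_final] is the threshold of O1 at time T1. *)
Record design (R : realType) := Design {
  thr_O1 : nat -> thr4 R;
  thr_final : R;
  thr_O2 : nat -> thr2 R
}.

(* Conditional joint laws of (H, pi1, pi2, D). *)
Definition info_state (R : realType) : Type := set (bool * R * R * bool) -> R.

Section Model.
Context (R : realType) (d d1 d2 : measure_display)
  (Omega : measurableType d) (Y1 : measurableType d1)
  (Y2 : measurableType d2) (M : problem R Omega Y1 Y2).

Local Notation T1 := (T1 M).
Local Notation T2 := (T2 M).

(* [is_cond_H0 X g] says that g(x) is a version of P(H = 0 | X = x).  For X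
   measurable, versions exist by the Radon-Nikodym theorem; [cond_H0 X] picks
   one. *)
Definition is_cond_H0 (dS : measure_display) (S : measurableType dS)
    (X : Omega -> S) (g : S -> R) : Prop :=
  [/\ measurable_fun setT g, forall x, 0 <= g x <= 1 &
      forall A, measurable A ->
        Pr M ([set w | hyp M w = false] `&` X @^-1` A) =
        (\int[Pr M]_(w in X @^-1` A) (g (X w))%:E)%E].

Definition cond_H0 (dS : measure_display) (S : measurableType dS)
    (X : Omega -> S) : S -> R := xget (fun=> 0) [set g | is_cond_H0 X g].

(* Conditional law of X given the event B.  The value outside the
   sigma-algebra, where a law is not defined, is set to 0. *)
Definition cond_law (dS : measure_display) (S : measurableType dS)
    (X : Omega -> S) (B : set Omega) : set S -> R :=
  fun A => if `[< measurable A >]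
           then fine (Pr M (X @^-1` A `&` B)) / fine (Pr M B) else 0.

Definition strategy1 : Type := forall t : nat, t.-tuple Y1 -> action.

(* The second component of O2's information is Z1_{1:t}.  It has length t:
   after O1's final message it is padded with None, which carries the same
   information as Z1_{1:tau1}. *)
Definition strategy2 : Type :=
  forall t : nat, t.-tuple Y2 * t.-tuple action -> action.

Definition act1 (g1 : strategy1) (t : nat) (w : Omega) : action :=
  g1 t (history (obs1 M) t w).

Definition tau1 (g1 : strategy1) (w : Omega) : nat :=
  stop_time T1 (fun t => act1 g1 t w).

Definition Z1 (g1 : strategy1) (t : nat) (w : Omega) : action :=
  if (t <= tau1 g1 w)%N then act1 g1 t w else None.

Definition info2 (g1 : strategy1) (t : nat) (w : Omega) :
    t.-tuple Y2 * t.-tuple action :=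
  (history (obs2 M) t w, history (Z1 g1) t w).

Definition act2 (g1 : strategy1) (g2 : strategy2) (t : nat) (w : Omega) :
  action := g2 t (info2 g1 t w).

Definition tau2 (g1 : strategy1) (g2 : strategy2) (w : Omega) : nat :=
  stop_time T2 (fun t => act2 g1 g2 t w).

Definition decision (g1 : strategy1) (g2 : strategy2) (w : Omega) : bool :=
  odflt false (act2 g1 g2 (tau2 g1 g2 w) w).

Definition cost (g1 : strategy1) (g2 : strategy2) : \bar R :=
  'E_(Pr M)[(fun w => c1 M * (tau1 g1 w)%:R + c2 M * (tau2 g1 g2 w)%:R
                     + loss M (decision g1 g2 w) (hyp M w))%R]%E.

Definition admissible2 (g1 : strategy1) (g2 : strategy2) : Prop :=
  (forall t, measurable_fun setT (g2 t)) /\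
  (forall w, (tau2 g1 g2 w <= T2)%N).

Definition belief1 (t : nat) : t.-tuple Y1 -> R :=
  cond_H0 (history (obs1 M) t).

Definition belief2 (g1 : strategy1) (t : nat) :
  t.-tuple Y2 * t.-tuple action -> R := cond_H0 (info2 g1 t).

Definition pi1 (t : nat) (w : Omega) : R :=
  belief1 (history (obs1 M) t w).

(* The belief of O2 is frozen from time tau2 on. *)
Definition pi2 (g1 : strategy1) (g2 : strategy2) (t : nat) (w : Omega) : R :=
  let s := minn t (tau2 g1 g2 w) in
  if s == 0%N then p0 M else belief2 g1 (info2 g1 s w).

(* The event Z1_{1:t} = b_{1:t}. *)
Definition silent (g1 : strategy1) (t : nat) : set Omega :=
  [set w | forall s, (1 <= s <= t)%N -> Z1 g1 s w = None].

Definition psi (g1 : strategy1) (g2 : strategy2) (t : nat) : info_state R :=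
  cond_law
    (fun w => (hyp M w, pi1 t w, pi2 g1 g2 t.-1 w, (t <= tau2 g1 g2 w)%N))
    (silent g1 t.-1).

Definition phi (g1 : strategy1) (g2 : strategy2) (t : nat) (z : action) :
    info_state R :=
  cond_law (fun w => (hyp M w, pi1 t w, pi2 g1 g2 t w, (t <= tau2 g1 g2 w)%N))
    (silent g1 t.-1 `&` [set w | Z1 g1 t w = z]).

(* The centralized sequential detection problem of O2 started at time t: up to
   T2 - t further measurements, taken at times t + 1, ..., T2.  A policy maps
   the k further measurements taken so far to an action. *)
Definition wald_policy : Type := forall k : nat, k.-tuple Y2 -> action.

Definition adm_wald_policy (t : nat) (r : wald_policy) : Prop :=
  (forall k, measurable_fun setT (r k)) /\ (forall y, r (T2 - t)%N y <> None).

(* Expected remaining cost given H = h and the k measurements y, with at most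
   n more; the value +oo is not reached by an admissible policy. *)
Fixpoint wald_cost_from (t : nat) (r : wald_policy) (h : bool) (n k : nat)
    (y : k.-tuple Y2) : \bar R :=
  match r k y, n with
  | Some u, _ => (loss M u h)%:E
  | None, 0%N => +oo%E
  | None, n'.+1 =>
    ((c2 M)%:E + \int[law (O2 M) (t + k.+1)%N h]_x
        wald_cost_from t r h n' [tuple of rcons y x])%E
  end.

Definition wald_cost (t : nat) (r : wald_policy) (x : R) : \bar R :=
  (x%:E * wald_cost_from t r false (T2 - t) [tuple] +
   (1 - x)%:E * wald_cost_from t r true (T2 - t) [tuple])%E.

(* Bayes' rule: the belief after the further measurements y, from the initial
   belief x at time t. *)
Definition wald_belief (t : nat) (x : R) (k : nat) (y : k.-tuple Y2) : R :=
  let l h := \prod_(i < k) dens (O2 M) (t + i.+1)%N h (tnth y i) in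
  x * l false / (x * l false + (1 - x) * l true).

Definition wald_rule (a : nat -> thr2 R) (t : nat) (x : R) : action :=
  if (t < T2)%N then rule2 (a t) x else rule1 (alpha2 (a t)) x.

(* [a t], ..., [a T2] are Wald thresholds for horizon T2 - t: whatever the
   initial belief x, the two-threshold policy is optimal. *)
Definition wald_thresholds (t : nat) (a : nat -> thr2 R) : Prop :=
  (forall s, (t <= s <= T2)%N -> adm_thr2 (a s)) /\
  (forall x, 0 <= x <= 1 -> forall r, adm_wald_policy t r ->
    (wald_cost t (fun k y => wald_rule a (t + k) (wald_belief t x y)) x
     <= wald_cost t r x)%E).

Definition adm_design (p : design R) : Prop :=
  [/\ forall t, (1 <= t < T1)%N -> adm_thr4 (thr_O1 p t), adm_thr1 (thr_final p) &
      forall t, (1 <= t < T1)%N -> adm_thr2 (thr_O2 p t)].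

Definition gamma1 (p : design R) : strategy1 := fun t y =>
  if (t < T1)%N then rule4 (thr_O1 p t) (belief1 y)
  else rule1 (thr_final p) (belief1 y).

Definition received (t : nat) (z : t.-tuple action) : bool :=
  has (fun m => m != None) z.

Definition arrival (t : nat) (z : t.-tuple action) : nat :=
  (find (fun m => m != None) z).+1.

(* [W r] are the Wald thresholds used when the message of O1 arrives at
   time r. *)
Definition gamma2 (W : nat -> nat -> thr2 R) (p : design R) : strategy2 :=
  fun t i =>
  if received i.2 then wald_rule (W (arrival i.2)) t (belief2 (gamma1 p) i)
  else rule2 (thr_O2 p t) (belief2 (gamma1 p) i).

Definition design_cost (W : nat -> nat -> thr2 R) (p : design R) : \bar R :=
  cost (gamma1 p) (gamma2 W p).

Definition design_psi (W : nat -> nat -> thr2 R) (p : design R) (t : nat) :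
  info_state R := psi (gamma1 p) (gamma2 W p) t.

Definition design_phi (W : nat -> nat -> thr2 R) (p : design R) (t : nat)
  (z : action) : info_state R := phi (gamma1 p) (gamma2 W p) t z.

Definition same_past (t : nat) (p q : design R) : Prop :=
  forall s, (1 <= s < t)%N -> thr_O1 p s = thr_O1 q s /\ thr_O2 p s = thr_O2 q s.

(* The least cost of the admissible designs satisfying C. *)
Definition best_cost (W : nat -> nat -> thr2 R) (C : design R -> Prop) :
    \bar R :=
  ereal_inf [set design_cost W q | q in [set q | adm_design q /\ C q]].

(* Optimality of a single choice of p, the choices made before it (O1 acts
   before O2 at each time) being fixed: the choice does not increase the least
   cost achievable by the choices still to be made. *)
Definition O1_optimal (W : nat -> nat -> thr2 R) (p : design R) (t : nat) :
    Prop :=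
  best_cost W (fun q => same_past t p q /\ thr_O1 q t = thr_O1 p t) =
  best_cost W (same_past t p).

Definition O2_optimal (W : nat -> nat -> thr2 R) (p : design R) (t : nat) :
    Prop :=
  best_cost W (fun q => [/\ same_past t p q, thr_O1 q t = thr_O1 p t &
                            thr_O2 q t = thr_O2 p t]) =
  best_cost W (fun q => same_past t p q /\ thr_O1 q t = thr_O1 p t).

Definition final_optimal (W : nat -> nat -> thr2 R) (p : design R) : Prop :=
  best_cost W (fun q => same_past T1 p q /\ thr_final q = thr_final p) =
  best_cost W (same_past T1 p).

Definition design_optimal (W : nat -> nat -> thr2 R) (p : design R) : Prop :=
  forall q, adm_design q -> (design_cost W p <= design_cost W q)%E.

(* O1 may still be silent after time t. *)
Definition reaches (p : design R) (t : nat) : Prop :=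
  Pr M (silent (gamma1 p) t) != 0%E.

End Model.

(* Main.v *)
(* By Bayes' rule the state (H, pi1_t, pi2_(t-1), D_t), and likewise its version
   after O1's message, evolves by a fixed map from the current state and a fresh
   observation which, given H, is independent of the past.  The rules applied at
   each step read the state only.  Hence, if two designs have the same
   information state at some step and play the same thresholds from then on, the
   costs they still have to pay are in the ratio of their probabilities of
   reaching this step, and the total cost of one is an increasing affine function
   of the total cost of the other.  So minimizing the total cost over the
   continuations of a given past depends on the information state only: F_t(s, a)
   is taken to be the least cost of the designs that choose a at time t after the
   past of an arbitrary design with information state s.  After the message of
   O1, the belief of O2 evolves by the likelihoods of its own observations, and
   the expected cost given O2's information is that of the Wald problem started
   at its current belief. *)

From HB Require Import structures.
Require Import Defs.
From mathcomp Require Import all_boot all_order all_algebra.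
From mathcomp Require Import all_classical all_reals all_analysis.
From mathcomp Require Import measurable_realfun ring lra.

Set Implicit Arguments.
Unset Strict Implicit.
Unset Printing Implicit Defensive.

Import Order.TTheory GRing.Theory Num.Theory.

Local Open Scope classical_set_scope.
Local Open Scope ring_scope.


(** * Densities and image measures *)

(** The obstacle is that beliefs are arbitrarily picked versions of conditional probabilities, and
    other versions for another policy of O1, so the evolution of the state is known only almost
    everywhere. Everything is therefore stated without conditioning: laws on events are compared by
    integrating nonnegative functions, and Bayes' rule comes from the uniqueness of densities. The
    step at O1's message has a parameter besides the state and the observation: a message, even a
    blank one, enters the belief of O2 through its probability under each hypothesis, and this
    depends on the law of the state. Designs with proportional laws share it. For the cost to be a
    sum of integrals of functions of the state, each observer's cost is booked at one time: that of
    O1 at its message, that of O2 when it stops or, if still active, at the message. Optimality of a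
    choice is an equality of infima, as no minimizer need exist; increasing affine maps of the
    extended reals preserve and reflect it. Histories of probability zero have no meaningful
    information state; there the cost does not depend on the continuation. *)

Section Integration.
Local Open Scope ereal_scope.
Context (R : realType).

Section Change.
Context d (T : measurableType d) (m0 m : {measure set T -> \bar R}).
Variable g : T -> R.
Hypotheses (mg : measurable_fun setT g) (g_ge0 : forall x, (0 <= g x)%R).
Hypothesis m0g :
  forall A, measurable A -> m0 A = \int[m]_(x in A) (g x)%:E.

Let mEg : measurable_fun setT (EFin \o g).
Proof. exact/measurable_EFinP. Qed.

Import HBNNSimple.

Let ge0_integral_density_nnsfun (h : {nnsfun T >-> R}) :
  \int[m0]_x (h x)%:E = \int[m]_x ((h x)%:E * (g x)%:E).
Proof.
rewrite integral_nnsfun// sintegralE patch_setT.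
under [in RHS]eq_integral => x _.
  rewrite fimfunE -fsumEFin// ge0_mule_fsuml; last first.
    by move=> y; exact: nnfun_muleindic_ge0.
  over.
rewrite ge0_integral_fsum//; last 2 first.
  - move=> y; apply: emeasurable_funM => //; apply/measurable_EFinP.
    exact: measurable_funM.
  - by move=> y x _; rewrite mule_ge0 ?lee_fin// -lee_fin EFinM nnfun_muleindic_ge0.
apply: eq_fsbigr => y; rewrite inE => -[t _ yE].
have y0 : (0 <= y)%R by rewrite -yE.
rewrite m0g//; under [in RHS]eq_integral do rewrite EFinM -muleA.
rewrite ge0_integralZl//; last 2 first.
  - by apply: emeasurable_funM => //; apply/measurable_EFinP.
  - by move=> x _; rewrite mule_ge0// lee_fin.
congr (_ * _); rewrite [LHS]integral_mkcond; apply: eq_integral => x _.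
by rewrite epatch_indic muleC.
Qed.

(** Linearity gives the formula for simple functions, and monotone convergence along [nnsfun_approx]
    gives it in general, since multiplying by [g] preserves increasing limits. *)
Lemma ge0_integral_density (k : T -> \bar R) :
  measurable_fun setT k -> (forall x, 0 <= k x) ->
  \int[m0]_x k x = \int[m]_x (k x * (g x)%:E).
Proof.
move=> mk k0; pose h := nnsfun_approx measurableT mk.
have kE x : k x = lim ((EFin \o h^~ x) n @[n --> \oo]).
  by apply/esym/cvg_lim => //; exact: cvg_nnsfun_approx.
transitivity (lim (\int[m0]_x (h n x)%:E @[n --> \oo])).
  rewrite -monotone_convergence//.
  - by apply: eq_integral => x _; exact: kE.
  - by move=> n; apply/measurable_EFinP.
  - by move=> n x _; rewrite lee_fin.
  - by move=> x _ a b ab; rewrite lee_fin; exact/lefP/nd_nnsfun_approx.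
transitivity (lim (\int[m]_x ((h n x)%:E * (g x)%:E) @[n --> \oo])).
  by under eq_fun do rewrite ge0_integral_density_nnsfun.
rewrite -monotone_convergence//.
- apply: eq_integral => x _; apply/cvg_lim => //.
  by apply: cvgeZr => //; exact: cvg_nnsfun_approx.
- by move=> n; apply: emeasurable_funM => //; apply/measurable_EFinP.
- by move=> n x _; rewrite mule_ge0// lee_fin.
- move=> x _ a b ab; rewrite lee_wpmul2r ?lee_fin//.
  exact/lefP/nd_nnsfun_approx.
Qed.

End Change.
End Integration.

Section ImageMeasure.
Local Open Scope ereal_scope.
Context (R : realType) d (T : measurableType d) d' (S : measurableType d').
Variables (P : {finite_measure set T -> \bar R}) (X : T -> S).
Hypothesis mX : measurable_fun setT X.

(** The proof of measurability is an argument so that the measure structure declared below can be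
    attached to the term itself. *)
Definition image_measure (_ : measurable_fun setT X) : set S -> \bar R :=
  fun A => P (X @^-1` A).

Local Notation image := (image_measure mX).

Lemma measurable_preimageT (A : set S) : measurable A -> measurable (X @^-1` A).
Proof. by move=> mA; rewrite -[_ @^-1` _]setTI; exact: mX. Qed.

Let image0 : image set0 = 0.
Proof. by rewrite /image_measure preimage_set0 measure0. Qed.

Let image_ge0 A : 0 <= image A.
Proof. exact: measure_ge0. Qed.

Let image_sigma_additive : semi_sigma_additive image.
Proof.
move=> F mF tF mUF; rewrite /image_measure preimage_bigcup.
apply: measure_semi_sigma_additive.
- by move=> n; exact: measurable_preimageT.
- apply/trivIsetP => i j _ _ ij; rewrite -preimage_setI.
  by move/trivIsetP : tF => /(_ _ _ _ _ ij) -> //; rewrite preimage_set0.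
- by rewrite -preimage_bigcup; exact: measurable_preimageT.
Qed.

HB.instance Definition _ := isMeasure.Build _ _ _ image
  image0 image_ge0 image_sigma_additive.

Let image_fin : fin_num_fun image.
Proof. by move=> A mA; apply/fin_num_measure/measurable_preimageT. Qed.

HB.instance Definition _ := Measure_isFinite.Build _ _ _ image image_fin.

Lemma ge0_integral_image (f : S -> \bar R) :
  measurable_fun setT f -> (forall x, 0 <= f x) ->
  \int[image]_y f y = \int[P]_x f (X x).
Proof.
move=> mf f0; rewrite -[RHS](@ge0_integral_pushforward _ _ _ _ R X mX P setT f)//.
Qed.

End ImageMeasure.

Section Joint.
Local Open Scope ereal_scope.
Context (R : realType) d (T : measurableType d).
Variable P : {finite_measure set T -> \bar R}.

Lemma ge0_integral_mrestr (E : set T) (mE : measurable E) (f : T -> \bar R) :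
  measurable_fun setT f -> (forall x, 0 <= f x) ->
  \int[mrestr P mE]_x f x = \int[P]_(x in E) f x.
Proof.
move=> mf f0; rewrite (@ge0_integral_density _ _ _ _ P (\1_E))//.
- rewrite [RHS]integral_mkcond; apply: eq_integral => x _.
  by rewrite epatch_indic.
- by move=> A mA; rewrite integral_indic// setIC.
Qed.

Context d' (S : measurableType d') d'' (Y : measurableType d'').
Variables (X : T -> S) (Z : T -> Y) (L : probability Y R).
Hypotheses (mX : measurable_fun setT X) (mZ : measurable_fun setT Z).

(** The hypothesis on rectangles says that the joint law of [(X, Z)] on [E] is the product of [L]
    with [lam] times the law of [X] on [F]. Uniqueness of the product measure extends this to all
    sets, and Tonelli's theorem integrates [Z] out. [E] may differ from [F]: passing to a smaller
    event, such as one fixing a further message, costs the factor [lam]. *)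
Lemma ge0_integral_joint (E F : set T) (lam : R) (k : S * Y -> \bar R) :
  measurable E -> measurable F -> (0 <= lam)%R ->
  (forall A B, measurable A -> measurable B ->
    P (E `&` X @^-1` A `&` Z @^-1` B) = lam%:E * P (F `&` X @^-1` A) * L B) ->
  measurable_fun setT k -> (forall x, 0 <= k x) ->
  \int[P]_(x in E) k (X x, Z x) =
  lam%:E * \int[P]_(x in F) \int[L]_y k (X x, y).
Proof.
move=> mE mF lam0 PE mk k0.
have mXZ : measurable_fun setT (fun x => (X x, Z x)).
  exact: measurable_fun_pair.
pose m1 := mscale (NngNum lam0) (image_measure (mrestr P mF) mX).
pose m2 := image_measure (mrestr P mE) mXZ.
have m12 C : measurable C -> (m1 \x L) C = m2 C.
  apply: product_measure_unique => A B mA mB.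
  rewrite /m2 /m1 /mscale/= /image_measure /mrestr/=.
  rewrite [X in _ = _ * X * _](_ : _ = P (F `&` X @^-1` A)); last by rewrite setIC.
  rewrite -PE//; congr (P _); apply/seteqP; split => x /=; tauto.
rewrite -(@ge0_integral_mrestr E mE (fun x => k (X x, Z x)))//; last first.
  exact: measurableT_comp.
rewrite -(@ge0_integral_image _ _ _ _ _ (mrestr P mE) _ mXZ k)//.
rewrite -(@eq_measure_integral _ _ _ _ (m2) (m1 \x L)%E k); last first.
  by move=> A mA _; exact: m12.
have mF' : measurable_fun setT (fun s => \int[L]_y k (s, y)).
  exact: (@measurable_fun_fubini_tonelli_F _ _ _ _ _ L k).
have F0 s : 0 <= \int[L]_y k (s, y) by exact: integral_ge0.
rewrite fubini_tonelli1// /fubini_F ge0_integral_mscale//; congr (_ * _).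
rewrite ge0_integral_image// (@ge0_integral_mrestr F mF (fun x => \int[L]_y k (X x, y)))//.
exact: (measurableT_comp mF').
Qed.

End Joint.

Section Scaled.
Local Open Scope ereal_scope.
Context (R : realType) d (T : measurableType d) d' (S : measurableType d').
Variable P : {finite_measure set T -> \bar R}.

Lemma ge0_integral_scaled (E F : set T) (X Y : T -> S) (r : R) (f : S -> \bar R) :
  measurable E -> measurable F -> measurable_fun setT X ->
  measurable_fun setT Y -> (0 <= r)%R ->
  (forall A, measurable A ->
    P (E `&` X @^-1` A) = r%:E * P (F `&` Y @^-1` A)) ->
  measurable_fun setT f -> (forall x, 0 <= f x) ->
  \int[P]_(x in E) f (X x) = r%:E * \int[P]_(x in F) f (Y x).
Proof.
move=> mE mF mX mY r0 PEF mf f0.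
have mfX : measurable_fun setT (fun x => f (X x)) by exact: measurableT_comp.
have mfY : measurable_fun setT (fun x => f (Y x)) by exact: measurableT_comp.
rewrite -(@ge0_integral_mrestr _ _ _ P E mE)//.
rewrite -(@ge0_integral_mrestr _ _ _ P F mF)//.
rewrite -(@ge0_integral_image _ _ _ _ _ (mrestr P mE) _ mX)//.
rewrite -(@ge0_integral_image _ _ _ _ _ (mrestr P mF) _ mY)//.
rewrite -(@ge0_integral_mscale _ _ _ _ _ _ (NngNum r0))//.
apply: eq_measure_integral => A mA _.
change (P (X @^-1` A `&` E) = r%:E * P (Y @^-1` A `&` F)).
by rewrite setIC PEF// setIC.
Qed.

End Scaled.

(** * Posterior probabilities and Bayes' rule *)

Section Posterior.
Local Open Scope ereal_scope.
Context (R : realType) (d d1 d2 : measure_display)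
  (Omega : measurableType d) (Y1 : measurableType d1)
  (Y2 : measurableType d2) (M : problem R Omega Y1 Y2).

Local Notation P := (Pr M).

Definition hyp_set (h : bool) : set Omega := [set w | hyp M w = h].

Lemma measurable_hyp_set h : measurable (hyp_set h).
Proof.
rewrite (_ : hyp_set h = hyp M @^-1` [set h])// -[X in measurable X]setTI.
by apply: (hyp_measurable M).
Qed.

Lemma integral_hyp_split (E : set Omega) (f : Omega -> \bar R) :
  measurable E -> measurable_fun setT f -> (forall w, 0 <= f w) ->
  \int[P]_(w in E) f w = \int[P]_(w in hyp_set false `&` E) f w +
                         \int[P]_(w in hyp_set true `&` E) f w.
Proof.
move=> mE mf f0; have mH h := measurable_hyp_set h.
rewrite -ge0_integral_setU//.
- congr (integral _ _ _); rewrite -setIUl [X in X `&` _](_ : _ = setT) ?setTI//.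
  apply/seteqP; split => // w _; rewrite /hyp_set /=.
  by case: (hyp M w); [right|left].
- exact: measurableI.
- exact: measurableI.
- exact: measurable_funTS.
- by apply/disj_setPS => w [[+ _] [+ _]]; rewrite /hyp_set /= => ->.
Qed.

Lemma measure_hyp_split (E : set Omega) : measurable E ->
  P E = P (hyp_set false `&` E) + P (hyp_set true `&` E).
Proof.
move=> mE; have := @integral_hyp_split E (cst 1) mE.
by rewrite !integral_cst ?mul1e//; [apply|exact: measurableI (measurable_hyp_set _) _..].
Qed.

Definition posterior dS (S : measurableType dS) (g : S -> R) (h : bool) (x : S)
  : R := (if h then 1 - g x else g x)%R.

Section Version.
Context dS (S : measurableType dS) (X : Omega -> S).
Hypothesis mX : measurable_fun setT X.

Lemma cond_H0P : is_cond_H0 M X (cond_H0 M X).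
Proof.
suff [g Hg] : [set g | is_cond_H0 M X g] !=set0 by apply: xgetPex; exists g.
have mH := measurable_hyp_set false.
pose nu := image_measure (mrestr P mH) mX; pose mu := image_measure P mX.
have numuA A : measurable A -> nu A <= mu A.
  move=> mA; apply: le_measure; rewrite ?inE//.
  - by apply: measurableI => //; exact: measurable_preimageT.
  - exact: measurable_preimageT.
have numu : nu `<< mu.
  apply/null_content_dominatesP => A mA muA0; apply/eqP.
  by rewrite eq_le measure_ge0 andbT -muA0 numuA.
pose f := Radon_Nikodym_SigmaFinite.f nu mu.
have f0 : forall x, 0 <= f x by exact: Radon_Nikodym_SigmaFinite.f_ge0.
have ff : forall x, f x \is a fin_num by exact: Radon_Nikodym_SigmaFinite.f_fin_num.
have intf : mu.-integrable setT f by exact: Radon_Nikodym_SigmaFinite.f_integrable.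
have nuE A : measurable A -> nu A = \int[mu]_(x in A) f x.
  by move=> mA; exact: Radon_Nikodym_SigmaFinite.f_integral.
have mf : measurable_fun setT f by exact: measurable_int intf.
(* [is_cond_H0] asks for values in [0, 1] at every point, whereas the Radon-Nikodym derivative is at
   most 1 only almost everywhere; hence the truncation. *)
pose g x := Num.min 1%R (fine (f x)).
have mfine : measurable_fun setT (fine \o f) by exact: measurableT_comp.
have mg : measurable_fun setT g.
  by apply: measurable_minr => //; exact: measurable_cst.
pose A := [set x | 1 < f x].
have mA : measurable A.
  rewrite /A -[X in measurable X]setTI.
  by apply: emeasurable_fun_o_infty.
(* On a part [B] of [{1 < f}], the integral of [f] is [nu B], at most [mu B], which is the integral
   of 1 and so at most that of [f]. Hence [f] is 1 almost everywhere where it exceeds 1, and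
   truncation changes it on a null set only. *)
have fA : ae_eq mu A f (cst 1).
  apply: integral_ae_eq => //; first exact: integrableS intf.
  move=> B BA mB; apply/eqP; rewrite eq_le; apply/andP; split.
    by rewrite -nuE// integral_cst// mul1e numuA.
  apply: ge0_le_integral => //.
  - exact: measurable_funTS.
  - by move=> x /BA /ltW.
have fg : ae_eq mu setT f (EFin \o g).
  case: fA => N [mN muN AN]; exists N; split => // x /= /not_implyP[_ fgx].
  apply: AN => /= fx1; apply: fgx; rewrite /g.
  have [|fx] := leP 1%R (fine (f x)).
    rewrite le_eqVlt => /predU1P[fx|fx].
      by rewrite -(fineK (ff x)) -fx.
    by rewrite fx1// /A /= -(fineK (ff x)) lte_fin.
  by rewrite /= fineK.
exists g; split => //.
  by move=> x; rewrite /g le_min ler01 fine_ge0//= ge_min lexx.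
move=> B mB; transitivity (nu B); first by rewrite /nu /image_measure /mrestr/= setIC.
rewrite nuE// (ae_eq_integral (EFin \o g))//.
- rewrite -(@ge0_integral_pushforward _ _ _ _ R X mX P B (EFin \o g))//.
  + exact/measurable_funTS/measurable_EFinP.
  + move=> x _; rewrite /= lee_fin /g le_min ler01 fine_ge0//.
- exact: measurable_funTS.
- exact/measurable_funTS/measurable_EFinP.
- by apply: ae_eq_subset fg.
Qed.

Variable g : S -> R.
Hypothesis gP : is_cond_H0 M X g.

Lemma measurable_posterior h : measurable_fun setT (posterior g h).
Proof.
by case: gP => mg _ _; case: h => //; apply: measurable_funB => //; exact: measurable_cst.
Qed.

Lemma posterior_ge0 h x : (0 <= posterior g h x)%R.
Proof. by case: gP => _ /(_ x) /andP[? ?] _; case: h => //=; rewrite subr_ge0. Qed.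

Lemma integral_posterior h (k : S -> \bar R) :
  measurable_fun setT k -> (forall x, 0 <= k x) ->
  \int[P]_(w in hyp_set h) k (X w) = \int[P]_w (k (X w) * (posterior g h (X w))%:E).
Proof.
move=> mk k0; have mH := measurable_hyp_set h.
have mp := measurable_posterior.
have mEp b : measurable_fun setT (fun x => (posterior g b x)%:E).
  exact/measurable_EFinP.
have mkX : measurable_fun setT (fun w => k (X w)) by exact: measurableT_comp.
rewrite -(@ge0_integral_mrestr _ _ _ _ (hyp_set h) mH)//.
rewrite -(@ge0_integral_image _ _ _ _ _ (mrestr P mH) _ mX)//.
rewrite (@ge0_integral_density _ _ _ _ (image_measure P mX) (posterior g h))//.
- rewrite ge0_integral_image//; first exact: emeasurable_funM.
  by move=> x; rewrite mule_ge0// lee_fin posterior_ge0.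
- exact: posterior_ge0.
move=> A mA; have mXA := measurable_preimageT mX mA.
transitivity (\int[P]_(w in X @^-1` A) (posterior g h (X w))%:E); last first.
  rewrite -(@ge0_integral_pushforward _ _ _ _ R X mX P A (fun x => (posterior g h x)%:E))//.
  - exact: measurable_funTS.
  - by move=> x _; rewrite lee_fin posterior_ge0.
case: (gP) => mg g01 gE.
transitivity (P (hyp_set h `&` X @^-1` A)).
  by rewrite /image_measure /mrestr/= setIC.
(* The defining property of a version covers H = 0. The case H = 1 follows by subtraction from the
   whole event, the subtracted integral being finite. *)
case: h mH => mH; last exact: gE.
have := @measure_hyp_split _ mXA; rewrite gE//.
have mgX b : measurable_fun (X @^-1` A) (fun w => (posterior g b (X w))%:E).
  apply/measurable_funTS/measurable_EFinP; exact: measurableT_comp.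
have <- : \int[P]_(w in X @^-1` A) (g (X w))%:E +
   \int[P]_(w in X @^-1` A) (1 - g (X w))%:E = P (X @^-1` A).
  rewrite -ge0_integralD//.
  - under eq_integral do rewrite -EFinD addrC subrK.
    by rewrite integral_cst// mul1e.
  - by move=> w _; rewrite lee_fin (posterior_ge0 false).
  - exact: (mgX false).
  - by move=> w _; rewrite lee_fin (posterior_ge0 true).
  - exact: (mgX true).
have fin : \int[P]_(w in X @^-1` A) (g (X w))%:E \is a fin_num.
  rewrite -gE//; apply: fin_num_measure; apply: measurableI => //.
  exact: measurable_hyp_set.
set I := \int[P]_(w in _) (g _)%:E in fin *.
rewrite (addeC I) (addeC I) => /(congr1 (fun z => z - I)).
by rewrite !addeK// => <-.
Qed.

End Version.
End Posterior.

(** Inversion is continuous off the closed set [{0}], and every function is measurable on a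
    singleton. *)
Lemma measurable_funV (R : realType) d (T : measurableType d) (f : T -> R) :
  measurable_fun setT f -> measurable_fun setT (fun x => (f x)^-1).
Proof.
move=> mf; apply: (@measurableT_comp _ _ _ _ _ _ (@GRing.inv R)) => //.
rewrite -(setUv [set 0 : R]); apply/measurable_funU => //; first exact: measurableC.
split; first exact: measurable_fun_set1.
apply: open_continuous_measurable_fun.
  by apply: closed_openC; exact: closed_eq.
by apply/in_setP => x /= /eqP x0; exact: inv_continuous.
Qed.

(* X is the old information, Z the new observation, and X' the new information,
   which on the event E is the function Theta of X and Z.  [lam h] is the
   conditional probability of E given F and H = h. *)
Section Bayes.
Local Open Scope ereal_scope.
Context (R : realType) (d d1 d2 : measure_display)
  (Omega : measurableType d) (Y1 : measurableType d1)
  (Y2 : measurableType d2) (M : problem R Omega Y1 Y2).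
Context dS (S : measurableType dS) dY (Y : measurableType dY)
  dS' (S' : measurableType dS').

Local Notation P := (Pr M).

Variables (X : Omega -> S) (Z : Omega -> Y) (X' : Omega -> S').
Hypotheses (mX : measurable_fun setT X) (mZ : measurable_fun setT Z)
  (mX' : measurable_fun setT X').
Variables (Theta : S * Y -> S') (rho : S' -> S) (sigma : S' -> Y).
Hypotheses (mTheta : measurable_fun setT Theta)
  (mrho : measurable_fun setT rho) (msigma : measurable_fun setT sigma).
Variables (F : set S) (E : set S').
Hypotheses (mF : measurable F) (mE : measurable E).
Hypothesis X'_Theta : forall w, E (X' w) -> X' w = Theta (X w, Z w).
Hypotheses (rhoX : forall w, rho (X' w) = X w)
  (sigmaZ : forall w, sigma (X' w) = Z w).
Variables (g : S -> R) (g' : S' -> R).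
Hypotheses (gP : is_cond_H0 M X g) (g'P : is_cond_H0 M X' g').
Variables (nu : {sigma_finite_measure set Y -> \bar R})
  (L : bool -> probability Y R) (f : bool -> Y -> R) (lam : bool -> R).
Hypotheses (f_ge0 : forall h y, (0 <= f h y)%R)
  (mf : forall h, measurable_fun setT (f h))
  (Lf : forall h A, measurable A -> L h A = \int[nu]_(y in A) (f h y)%:E)
  (lam_ge0 : forall h, (0 <= lam h)%R).
Hypothesis XZ_indep : forall h A B, measurable A -> measurable B ->
  P (hyp_set M h `&` X' @^-1` E `&` X @^-1` A `&` Z @^-1` B) =
  (lam h)%:E * P (hyp_set M h `&` X @^-1` F `&` X @^-1` A) * L h B.

(** The unnormalized posterior weight of [h]: as [integral_v] shows, it is the density of the law of
    [(X, Z)] on [E] and H = h with respect to the law of [X] on [F] times [nu]. *)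
Let v (h : bool) (x : S * Y) : R := (lam h * posterior g h x.1 * f h x.2)%R.

Let v_ge0 h x : (0 <= v h x)%R.
Proof. by rewrite /v !mulr_ge0//; exact: posterior_ge0 gP _ _. Qed.

Let mv h : measurable_fun setT (v h).
Proof.
apply: measurable_funM; last exact: measurableT_comp.
apply: measurable_funM => //; apply: measurableT_comp => //.
exact: measurable_posterior gP _.
Qed.

Let mEX' : measurable (X' @^-1` E).
Proof. exact: measurable_preimageT. Qed.

Let mFX : measurable (X @^-1` F).
Proof. exact: measurable_preimageT. Qed.

(** Three changes of measure: independence replaces [Z] by an integral against [L h], [f h] is the
    density of [L h], and conditioning on [X] replaces the event H = h by the posterior given
    [X]. *)
Let integral_v h (k : S * Y -> \bar R) :
  measurable_fun setT k -> (forall x, 0 <= k x) ->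
  \int[P]_(w in hyp_set M h `&` X' @^-1` E) k (X w, Z w) =
  \int[P]_(w in X @^-1` F) \int[nu]_y (k (X w, y) * (v h (X w, y))%:E).
Proof.
move=> mk k0; have mH := measurable_hyp_set M h.
have mp := measurable_posterior gP.
rewrite (@ge0_integral_joint _ _ _ P _ _ _ _ X Z (L h) mX mZ _
  (hyp_set M h `&` X @^-1` F) (lam h))//; last 3 first.
- exact: measurableI.
- exact: measurableI.
- by move=> A B mA mB; exact: XZ_indep.
pose G s := \int[L h]_y k (s, y).
have mG : measurable_fun setT G.
  exact: (@measurable_fun_fubini_tonelli_F _ _ _ _ _ (L h) k).
have G0 s : 0 <= G s by exact: integral_ge0.
have mk1 s : measurable_fun setT (fun y => k (s, y)) by exact: measurableT_comp.
have GE s : G s = \int[nu]_y (k (s, y) * (f h y)%:E).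
  by rewrite /G (@ge0_integral_density _ _ _ _ nu (f h))// => A mA; exact: Lf.
have mGF : measurable_fun setT (G \_ F).
  by apply/(measurable_restrict _ _ _) => //; exact: measurable_funTS.
have GF0 s : 0 <= (G \_ F) s by rewrite patchE; case: ifP.
transitivity ((lam h)%:E * \int[P]_(w in hyp_set M h) (G \_ F) (X w)).
  congr (_ * _); rewrite setIC integral_mkcondl; apply: eq_integral => w _.
  by rewrite !patchE.
rewrite (integral_posterior mX gP)//.
rewrite -ge0_integralZl//; last 3 first.
- apply: emeasurable_funM; first exact: measurableT_comp.
  by apply/measurable_EFinP; exact: measurableT_comp.
- by move=> w _; rewrite mule_ge0// lee_fin (posterior_ge0 gP).
- by rewrite lee_fin.
rewrite [RHS]integral_mkcond; apply: eq_integral => w _.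
rewrite !patchE; case: ifPn => wF; last first.
  by rewrite ifF ?mul0e ?mule0//; apply/negP => /set_mem h0; move/negP: wF; apply; exact: mem_set.
rewrite ifT; last by apply/mem_set; move/set_mem : wF.
rewrite muleCA -EFinM GE muleC -ge0_integralZl//; last 3 first.
- by apply: emeasurable_funM => //; apply/measurable_EFinP.
- by move=> y _; rewrite mule_ge0// lee_fin.
- by rewrite lee_fin mulr_ge0// (posterior_ge0 gP).
by apply: eq_integral => y _; rewrite /v/= muleCA.
Qed.

(** The left side of [integral_v], now evaluated through the posterior given [X']. The maps [rho]
    and [sigma] recover [(X, Z)] from [X'], so that the integrand is a function of [X']. *)
Let XZE h (k : S * Y -> \bar R) :
  measurable_fun setT k -> (forall x, 0 <= k x) ->
  \int[P]_(w in hyp_set M h `&` X' @^-1` E) k (X w, Z w) =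
  \int[P]_(w in X' @^-1` E) (k (X w, Z w) * (posterior g' h (X' w))%:E).
Proof.
move=> mk k0.
pose k' s := k (rho s, sigma s).
have mk' : measurable_fun setT k'.
  by apply: measurableT_comp => //; exact: measurable_fun_pair.
have mkE : measurable_fun setT (k' \_ E).
  by apply/(measurable_restrict _ _ _) => //; exact: measurable_funTS.
transitivity (\int[P]_(w in hyp_set M h) (k' \_ E) (X' w)).
  rewrite setIC integral_mkcondl; apply: eq_integral => w _.
  by rewrite !patchE /k' rhoX sigmaZ.
rewrite (integral_posterior mX' g'P)//; last by move=> x; rewrite patchE; case: ifP => // _; exact: k0.
rewrite [RHS]integral_mkcond; apply: eq_integral => w _.
rewrite !patchE /k' rhoX sigmaZ; case: ifPn => wE.
  by rewrite ifT//; apply/mem_set; move/set_mem : wE.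
by rewrite ifF ?mul0e//; apply/negP => /set_mem h0; move/negP: wE; apply; exact: mem_set.
Qed.

(* The summand 1 keeps the test functions v / den bounded, hence integrable. *)
Let den x : R := (1 + v false x + v true x)%R.

Let den_gt0 x : (0 < den x)%R.
Proof. by rewrite /den -addrA ltr_pwDl// addr_ge0. Qed.

Let mden : measurable_fun setT (fun x => (den x)^-1%R).
Proof.
apply: measurable_funV; apply: measurable_funD => //.
exact: measurable_funD.
Qed.

Let mpG h : measurable_fun setT (fun x => posterior g' h (Theta x)).
Proof. by apply: measurableT_comp => //; exact: measurable_posterior g'P _. Qed.

Let XZ w := (X w, Z w).

Let mXZ : measurable_fun setT XZ.
Proof. exact: measurable_fun_pair. Qed.

(** The test function [a h] weighs the new posterior of [h] by the weight of the other hypothesis.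
    Evaluated by [XZE] and [integral_v], its integral over any set involves the product of the two
    weights, which is symmetric in the hypotheses. So [a false] and [a true] have the same integrals
    and agree almost everywhere; multiplying by [den] gives the balance. *)
Let bayes_balance : {ae P, forall w, E (X' w) ->
  (v true (XZ w) * g' (X' w) = v false (XZ w) * (1 - g' (X' w)))%R}.
Proof.
pose m := image_measure (mrestr P mEX') mXZ.
pose a h x : R := (v (~~ h) x / den x * posterior g' h (Theta x))%R.
have ma h : measurable_fun setT (a h).
  by apply: measurable_funM => //; apply: measurable_funM.
have a01 h x : (0 <= a h x <= 1)%R.
  have d0 := den_gt0 x.
  have p0 := posterior_ge0 g'P h (Theta x).
  have p1 : (posterior g' h (Theta x) <= 1)%R.
    by case: g'P => _ /(_ (Theta x)) /andP[? ?] _; rewrite /posterior; case: h {p0 ma} => //; lra.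
  have q0 : (0 <= v (~~ h) x / den x)%R by rewrite divr_ge0 ?v_ge0// ltW.
  have q1 : (v (~~ h) x / den x <= 1)%R.
    rewrite ler_pdivrMr// mul1r /den; have := v_ge0 false x; have := v_ge0 true x.
    by case: h {p0 p1 q0 ma} => /=; lra.
  by rewrite /a mulr_ge0//= mulr_ile1.
have mEa h : measurable_fun setT (EFin \o a h) by exact/measurable_EFinP.
have inta h : m.-integrable setT (EFin \o a h).
  apply: measurable_bounded_integrable => //.
    by rewrite -ge0_fin_numE ?measure_ge0// fin_num_measure.
  exists 1%R; split => // y y1 x _ /=; have /andP[a0 a1] := a01 h x.
  by rewrite ger0_norm// (le_trans a1)// ltW.
have aC h C : measurable C -> \int[m]_(x in C) (a h x)%:E =
    \int[P]_(w in X @^-1` F) \int[nu]_y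
     ((((\1_C (X w, y) / den (X w, y)) * v true (X w, y)) * v false (X w, y))%:E).
  move=> mC.
  have mEaC : measurable_fun setT ((fun x => (a h x)%:E) \_ C).
    apply/(measurable_restrict _ _ _) => //.
    by apply: measurable_funTS; exact: (mEa h).
  rewrite integral_mkcond (@ge0_integral_image _ _ _ _ _ (mrestr P mEX') _ mXZ) //; last first.
  - by move=> x; rewrite patchE; case: ifP => // _; rewrite lee_fin; case/andP: (a01 h x).
  rewrite ge0_integral_mrestr; last 2 first.
  - exact: (measurableT_comp mEaC).
  - by move=> x; rewrite patchE; case: ifP => // _; rewrite lee_fin; case/andP: (a01 h (XZ x)).
  pose k x : \bar R := ((\1_C x / den x) * v (~~ h) x)%:E.
  have mk : measurable_fun setT k.
    apply/measurable_EFinP; apply: measurable_funM => //.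
    by apply: measurable_funM.
  have k0 x : 0 <= k x.
    by rewrite lee_fin mulr_ge0// divr_ge0 ?indic_ge0// ?ltW.
  transitivity (\int[P]_(w in hyp_set M h `&` X' @^-1` E) k (X w, Z w)).
    rewrite XZE//; apply: eq_integral => w /set_mem wE.
    rewrite patchE /a /k -EFinM /XZ (X'_Theta wE) indicE.
    by case: ifPn => _; rewrite ?mul0r ?mul0e// mul1r; congr (_%:E); rewrite [(_^-1 * _)%R]mulrC.
  rewrite (@integral_v h k mk k0).
  apply: eq_integral => w _; apply: eq_integral => y _.
  by rewrite /k -EFinM; congr (_%:E); case: (h) => //=; rewrite mulrAC.
have ae1 : ae_eq m setT (EFin \o a false) (EFin \o a true).
  apply: (integral_ae_eq measurableT (inta false) (mEa true)) => C _ mC.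
  by rewrite (aC false)// (aC true).
case: ae1 => N [mN muN NE]; exists (X' @^-1` E `&` XZ @^-1` N); split.
- by apply: measurableI => //; exact: measurable_preimageT.
- by rewrite setIC; exact: muN.
move=> w /= /not_implyP[wE ne]; split => //; apply: NE => /= /(_ I) [aw].
apply: ne; have d0 := den_gt0 (XZ w); move: aw; rewrite /a /posterior /=.
rewrite -(X'_Theta wE) [in LHS]mulrAC [in RHS]mulrAC => /(congr1 ( *%R^~ (den (XZ w)))).
by rewrite !divfK// gt_eqF.
Qed.

(** The set where both weights vanish has probability zero under each hypothesis, because this
    probability is an integral of [v h] over that set. *)
Let bayes_den_neq0 : {ae P, forall w, E (X' w) ->
  (v false (XZ w) + v true (XZ w) != 0)%R}.
Proof.
pose C := [set x | (v false x + v true x)%R = 0%R].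
have mC : measurable C.
  have mvv : measurable_fun setT (fun x => v false x + v true x)%R by exact: measurable_funD.
  by rewrite (_ : C = (fun x => v false x + v true x)%R @^-1` [set 0%R])//; exact: measurable_preimageT.
have mEC : measurable (X' @^-1` E `&` XZ @^-1` C).
  by apply: measurableI => //; exact: measurable_preimageT.
exists (X' @^-1` E `&` XZ @^-1` C); split => //; last first.
  by move=> w /= /not_implyP[wE /negP/negPn/eqP ?].
have H0 h : P (hyp_set M h `&` (X' @^-1` E `&` XZ @^-1` C)) = 0.
  have mH := measurable_hyp_set M h.
  have m1 : measurable_fun setT (fun x => (\1_C x)%:E : \bar R) by exact/measurable_EFinP.
  transitivity (\int[P]_(w in hyp_set M h `&` X' @^-1` E) (\1_C (X w, Z w))%:E).
    rewrite setIA setIC -integral_indic//; first exact: measurableI.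
    exact: measurable_preimageT.
  rewrite (@integral_v h (fun x => (\1_C x)%:E))//.
  apply: integral0_eq => w _; apply: integral0_eq => y _; rewrite indicE.
  case: (boolP (_ \in _)) => [/set_mem|] xC; last by rewrite mul0e.
  have v0 : v h (X w, y) = 0%R.
    move/eqP: xC; rewrite paddr_eq0// => /andP[/eqP ? /eqP ?].
    by case: (h).
  by rewrite v0 mule0.
by rewrite (measure_hyp_split M mEC) !H0 adde0.
Qed.

(** The balance equation is linear in [g'] and is solved by dividing by the total weight. That this
    weight is nonzero is part of the conclusion because composing successive updates cancels it. *)
Lemma bayes_rule : {ae P, forall w, E (X' w) ->
  let u h := (lam h * posterior g h (X w) * f h (Z w))%R in
  (u false + u true != 0)%R /\ g' (X' w) = (u false / (u false + u true))%R}.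
Proof.
have := bayes_balance; have := bayes_den_neq0.
apply: filterS2 => w Hd Hb wE; move: (Hd wE) (Hb wE); rewrite /v /XZ/=.
set a := (_ * f false _)%R; set b := (_ * f true _)%R => d0 bal; split => //.
apply: (mulIf d0); rewrite divfK//; lra.
Qed.

End Bayes.

(** * Measurability of the strategies and beliefs *)

Section Measurability.

Lemma measurable_from_discrete d (U : measurableType d) (f : action -> U) :
  measurable_fun setT f.
Proof. by move=> _ B _; exact: I. Qed.

Lemma measurable_from_bool d (U : measurableType d) (f : bool -> U) :
  measurable_fun setT f.
Proof. by move=> _ B _; exact: I. Qed.

Lemma measurable_fun_case d (T : measurableType d) d' (U : measurableType d')
    (I : countType) (N : T -> I) (f : I -> T -> U) :
  (forall i, measurable (N @^-1` [set i])) ->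
  (forall i, measurable_fun setT (f i)) ->
  measurable_fun setT (fun x => f (N x) x).
Proof.
move=> mN mf _ B mB; rewrite setTI.
rewrite (_ : _ @^-1` B = \bigcup_i (N @^-1` [set i] `&` f i @^-1` B)).
  apply: countable_bigcupT_measurable => // i.
  by apply: measurableI => //; exact: measurable_preimageT.
by apply/seteqP; split => [x Bx|x [i _ [/= -> //]]]; exists (N x).
Qed.

Lemma measurable_tuple_set1 t (z : t.-tuple action) : measurable [set z].
Proof.
rewrite (_ : [set z] = \bigcap_(i in [set: 'I_t])
    (fun y : t.-tuple action => tnth y i) @^-1` [set tnth z i]).
  apply: fin_bigcap_measurable => // i _.
  by apply: measurable_preimageT => //; exact: measurable_tnth.
apply/seteqP; split => [x -> i //|x xz]; apply: eq_from_tnth => i.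
exact: xz.
Qed.

Lemma measurable_fun_tuple_case d (T : measurableType d)
    d' (U : measurableType d') t (f : T * t.-tuple action -> U) :
  (forall z, measurable_fun setT (fun x => f (x, z))) -> measurable_fun setT f.
Proof.
move=> mf.
have -> : f = fun x => (fun (z : t.-tuple (option bool)) y => f (y.1, z)) x.2 x.
  by apply/funext => -[].
apply: (@measurable_fun_case _ _ _ _ _
  (fun x : T * t.-tuple action => x.2 : t.-tuple (option bool))
  (fun z y => f (y.1, z))).
  move=> z; apply: measurable_preimageT; first exact: measurable_snd.
  exact: measurable_tuple_set1.
by move=> z; apply: (measurableT_comp (mf z)).
Qed.

Lemma measurable_all (I : eqType) d (T : measurableType d) (s : seq I)
    (f : I -> T -> bool) :
  (forall i, i \in s -> measurable_fun setT (f i)) ->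
  measurable_fun setT (fun x => all (fun i => f i x) s).
Proof.
elim: s => [|i s IH] mf //=.
apply: measurable_and; first by apply: mf; rewrite mem_head.
by apply: IH => j sj; apply: mf; rewrite in_cons sj orbT.
Qed.

Lemma measurable_holds d (T : measurableType d) (f : T -> bool) :
  measurable_fun setT f -> measurable [set x | f x].
Proof. by move=> mf; exact: (measurable_preimageT mf (A := [set true])). Qed.

Lemma measurable_nat_level d (T : measurableType d) (N : T -> nat) :
  (forall i, measurable_fun setT (fun x => (i <= N x)%N)) ->
  forall i, measurable (N @^-1` [set i]).
Proof.
move=> mN i; rewrite (_ : _ @^-1` _ =
  [set x | (i <= N x)%N] `\` [set x | (i.+1 <= N x)%N]); last first.
  apply/seteqP; split => w /=; first by move=> ->; rewrite leqnn ltnn.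
  by move=> [il /negP]; rewrite -leqNgt => li; apply/eqP; rewrite eqn_leq il li.
by apply: measurableD; exact: measurable_holds.
Qed.

Context (R : realType).

Lemma measurable_rule4 (a : thr4 R) : measurable_fun setT (rule4 a).
Proof.
apply: measurable_fun_ifT => //.
  by apply: measurable_and; exact: measurable_fun_ler.
apply: measurable_fun_ifT => //.
by apply: measurable_and; exact: measurable_fun_ler.
Qed.

Lemma measurable_rule1 (a : R) : measurable_fun setT (rule1 a).
Proof.
rewrite (_ : rule1 a = (@Some bool : bool -> action) \o (fun x => x <= a))//.
apply: measurableT_comp; first exact: measurable_from_bool.
exact: measurable_fun_ler.
Qed.

Lemma measurable_rule2 (a : thr2 R) : measurable_fun setT (rule2 a).
Proof.
apply: measurable_fun_ifT => //; first exact: measurable_fun_ler.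
by apply: measurable_fun_ifT => //; exact: measurable_fun_ltr.
Qed.

End Measurability.

(** Reduces [t <= stop_time] to the actions strictly before [t], so that this event is known before
    the action at [t]. The bound [T.+1] is the value taken when no action occurs. *)
Lemma leq_stop_time T a t : (t <= T.+1)%N ->
  (t <= stop_time T a)%N = all (fun s => a s == None) (iota 1 t.-1).
Proof.
case: t => // t; rewrite ltnS /stop_time ltnS /= => tT.
rewrite leqNgt -has_take_leq ?size_iota// take_iota (minn_idPl tT) -all_predC.
by apply: eq_all => s /=; rewrite negbK.
Qed.

Section ModelMeasurability.
Context (R : realType) (d d1 d2 : measure_display)
  (Omega : measurableType d) (Y1 : measurableType d1)
  (Y2 : measurableType d2) (M : problem R Omega Y1 Y2).

Local Notation T1 := (T1 M).
Local Notation T2 := (T2 M).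

Definition quiet1 (g1 : strategy1 Y1) t w :=
  all (fun s => act1 M g1 s w == None) (iota 1 t).

Definition quiet2 (g1 : strategy1 Y1) (g2 : strategy2 Y2) t w :=
  all (fun s => act2 M g1 g2 s w == None) (iota 1 t).

Lemma quiet1S g1 t w :
  quiet1 g1 t.+1 w = quiet1 g1 t w && (act1 M g1 t.+1 w == None).
Proof. by rewrite /quiet1 -(addn1 t) iotaD all_cat /= andbT [(1 + t)%N]addnC. Qed.

Lemma quiet2S g1 g2 t w :
  quiet2 g1 g2 t.+1 w = quiet2 g1 g2 t w && (act2 M g1 g2 t.+1 w == None).
Proof. by rewrite /quiet2 -(addn1 t) iotaD all_cat /= andbT [(1 + t)%N]addnC. Qed.

Lemma leq_tau1 g1 t w : (t <= T1.+1)%N -> (t <= tau1 M g1 w)%N = quiet1 g1 t.-1 w.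
Proof. exact: leq_stop_time. Qed.

Lemma leq_tau2 g1 g2 t w : (t <= T2.+1)%N ->
  (t <= tau2 M g1 g2 w)%N = quiet2 g1 g2 t.-1 w.
Proof. exact: leq_stop_time. Qed.

Lemma Z1E g1 t w : (t <= T1)%N ->
  Z1 M g1 t w = if quiet1 g1 t.-1 w then act1 M g1 t w else None.
Proof. by move=> tT; rewrite /Z1 leq_tau1// (leq_trans tT). Qed.

Lemma silentE g1 t : (t <= T1)%N -> silent M g1 t = [set w | quiet1 g1 t w].
Proof.
move=> tT; apply/seteqP; split => w /=; last first.
  move=> /allP q s /andP[s1 st]; rewrite /Z1; case: ifP => // _.
  by apply/eqP/q; rewrite mem_iota s1/= add1n ltnS.
elim: t tT => // t IH tT q; rewrite quiet1S.
have qt : quiet1 g1 t w.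
  apply: IH; first exact: ltnW.
  by move=> s /andP[s1 st]; apply: q; rewrite s1 leqW.
rewrite qt /=.
by have := q t.+1; rewrite Z1E// qt /= leqnn => /(_ isT) ->.
Qed.

(* The map e is the identity of Omega, its domain carrying either the
   sigma-algebra of Omega or that of the observations made so far. *)
Section Embedding.
Context dO (Om : measurableType dO) (e : Om -> Omega) (m n : nat).
Hypotheses
  (me1 : forall s, (1 <= s <= m)%N -> measurable_fun setT (obs1 M s \o e))
  (me2 : forall s, (1 <= s <= n)%N -> measurable_fun setT (obs2 M s \o e)).

Lemma measurable_history1 t : (t <= m)%N ->
  measurable_fun setT (history (obs1 M) t \o e).
Proof.
move=> tm; apply/measurable_fun_tnthP => i.
rewrite (_ : _ \o _ = obs1 M i.+1 \o e); last first.
  by apply/funext => w; rewrite /= tnth_mktuple.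
by apply: me1; rewrite (leq_trans (ltn_ord i)).
Qed.

Lemma measurable_history2 t : (t <= n)%N ->
  measurable_fun setT (history (obs2 M) t \o e).
Proof.
move=> tm; apply/measurable_fun_tnthP => i.
rewrite (_ : _ \o _ = obs2 M i.+1 \o e); last first.
  by apply/funext => w; rewrite /= tnth_mktuple.
by apply: me2; rewrite (leq_trans (ltn_ord i)).
Qed.

Variables (g1 : strategy1 Y1).
Hypotheses (mg1 : forall t, measurable_fun setT (@g1 t))
  (g1_stop : forall w, act1 M g1 T1 w != None).

Lemma tau1_le w : (tau1 M g1 w <= T1)%N.
Proof.
rewrite leqNgt leq_tau1//; apply/negP => /allP /(_ T1).
by rewrite mem_iota T1_gt0 add1n ltnS leqnn (negbTE (g1_stop w)) => /(_ isT).
Qed.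

Lemma measurable_act1 t : (t <= m)%N -> measurable_fun setT (act1 M g1 t \o e).
Proof.
move=> tm; rewrite (_ : _ \o e = @g1 t \o (history (obs1 M) t \o e))//.
exact: (measurableT_comp (@mg1 t) (measurable_history1 tm)).
Qed.

Lemma measurable_quiet1 t : (t <= m)%N ->
  measurable_fun setT (fun w => quiet1 g1 t (e w)).
Proof.
move=> tm; apply: measurable_all => s; rewrite mem_iota add1n ltnS => /andP[_ st].
apply: (@measurableT_comp _ _ _ _ _ _ (fun a : action => a == None)).
  exact: measurable_from_discrete.
by apply: measurable_act1; exact: leq_trans tm.
Qed.

(** Beyond [T1] the padded message is always blank, so the observations of O1 up to the minimum of
    [t] and [T1] determine it. *)
Lemma measurable_Z1 t : (minn t T1 <= m)%N ->
  measurable_fun setT (Z1 M g1 t \o e).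
Proof.
have [tT tm|Tt Tm] := leqP t T1; last first.
  rewrite (_ : _ \o _ = cst None)//; apply/funext => w; rewrite /= /Z1.
  by rewrite leqNgt (leq_ltn_trans (tau1_le _) Tt).
rewrite (_ : _ \o _ = fun w => if quiet1 g1 t.-1 (e w)
    then act1 M g1 t (e w) else None); last by apply/funext => w /=; exact: Z1E.
apply: measurable_fun_ifT => //; last exact: measurable_act1.
by apply: measurable_quiet1; exact: leq_trans (leq_pred _) tm.
Qed.

Lemma measurable_info2 t : (minn t T1 <= m)%N -> (t <= n)%N ->
  measurable_fun setT (info2 M g1 t \o e).
Proof.
move=> tm tn; apply: measurable_fun_pair; first exact: measurable_history2.
apply/measurable_fun_tnthP => i.
rewrite (_ : _ \o _ = Z1 M g1 i.+1 \o e); last first.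
  by apply/funext => w; rewrite /= tnth_mktuple.
apply: measurable_Z1; apply: leq_trans tm; rewrite leq_min geq_minr andbT.
exact: leq_trans (geq_minl _ _) (ltn_ord i).
Qed.

Variable g2 : strategy2 Y2.
Hypothesis mg2 : forall t, measurable_fun setT (@g2 t).

Lemma measurable_act2 t : (minn t T1 <= m)%N -> (t <= n)%N ->
  measurable_fun setT (act2 M g1 g2 t \o e).
Proof.
move=> tm tn; rewrite (_ : _ \o e = @g2 t \o (info2 M g1 t \o e))//.
exact: (measurableT_comp (@mg2 t) (measurable_info2 tm tn)).
Qed.

Lemma measurable_quiet2 t : (minn t T1 <= m)%N -> (t <= n)%N ->
  measurable_fun setT (fun w => quiet2 g1 g2 t (e w)).
Proof.
move=> tm tn; apply: measurable_all => s; rewrite mem_iota add1n ltnS => /andP[_ st].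
apply: (@measurableT_comp _ _ _ _ _ _ (fun a : action => a == None)).
  exact: measurable_from_discrete.
apply: measurable_act2; last exact: leq_trans tn.
by apply: leq_trans tm; rewrite leq_min geq_minr andbT (leq_trans (geq_minl _ _)).
Qed.

End Embedding.

Lemma measurable_belief1 t : measurable_fun setT (belief1 M (t:=t)).
Proof.
have mh : measurable_fun setT (history (obs1 M) t).
  by apply: (@measurable_history1 _ _ (@id Omega) t) => // s _; exact: obs1_measurable.
by have [] := cond_H0P M mh.
Qed.

Lemma measurable_gamma1 p t : measurable_fun setT (gamma1 M p (t:=t)).
Proof.
rewrite /gamma1; case: (t < T1)%N; apply: measurableT_comp (@measurable_belief1 t).
  exact: measurable_rule4.
exact: measurable_rule1.
Qed.

Lemma gamma1_stop p w : act1 M (gamma1 M p) T1 w != None.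
Proof. by rewrite /act1 /gamma1 ltnn. Qed.

Lemma info2_measurable p t : measurable_fun setT (info2 M (gamma1 M p) t).
Proof.
apply: (@measurable_info2 _ _ (@id Omega) t t) => //.
- by move=> s _; exact: obs1_measurable.
- by move=> s _; exact: obs2_measurable.
- exact: measurable_gamma1.
- exact: gamma1_stop.
- exact: geq_minl.
Qed.

Lemma belief2P p t : is_cond_H0 M (info2 M (gamma1 M p) t) (belief2 M (gamma1 M p) (t:=t)).
Proof. exact/cond_H0P/info2_measurable. Qed.

Lemma belief1P t : is_cond_H0 M (history (obs1 M) t) (belief1 M (t:=t)).
Proof.
apply: cond_H0P.
by apply: (@measurable_history1 _ _ (@id Omega) t) => // s _; exact: obs1_measurable.
Qed.

Lemma measurable_belief2 p t : measurable_fun setT (belief2 M (gamma1 M p) (t:=t)).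
Proof. by have [] := belief2P p t. Qed.

Lemma measurable_wald_rule (a : nat -> thr2 R) t : measurable_fun setT (wald_rule M a t).
Proof.
rewrite /wald_rule; case: (t < T2)%N; [exact: measurable_rule2|exact: measurable_rule1].
Qed.

Lemma measurable_gamma2 W p t : measurable_fun setT (gamma2 M W p (t:=t)).
Proof.
apply: measurable_fun_tuple_case => z; rewrite /gamma2 /=.
have mb : measurable_fun setT (fun x => belief2 M (gamma1 M p) (x, z)).
  apply: measurableT_comp; first exact: measurable_belief2.
  exact: measurable_fun_pair.
case: (received z); apply: measurableT_comp mb.
  exact: measurable_wald_rule.
exact: measurable_rule2.
Qed.

Section EmbeddingBeliefs.
Context dO (Om : measurableType dO) (e : Om -> Omega) (m n : nat).
Hypotheses
  (me1 : forall s, (1 <= s <= m)%N -> measurable_fun setT (obs1 M s \o e))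
  (me2 : forall s, (1 <= s <= n)%N -> measurable_fun setT (obs2 M s \o e)).

Lemma measurable_pi1 t : (t <= m)%N -> measurable_fun setT (pi1 M t \o e).
Proof.
move=> tm; rewrite (_ : _ \o e = @belief1 _ _ _ _ _ _ _ M t \o (history (obs1 M) t \o e))//.
apply: measurableT_comp; first exact: measurable_belief1.
exact: (measurable_history1 me1).
Qed.

Lemma pi20 g1 g2 w : pi2 M g1 g2 0 w = p0 M.
Proof. by rewrite /pi2 min0n. Qed.

Lemma pi2S g1 g2 t w : pi2 M g1 g2 t.+1 w =
  if (t.+1 <= tau2 M g1 g2 w)%N then belief2 M g1 (info2 M g1 t.+1 w)
  else pi2 M g1 g2 t w.
Proof.
rewrite /pi2; case: (leqP t.+1 (tau2 M g1 g2 w)) => //.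
by rewrite ltnS => h; rewrite (minn_idPr h).
Qed.

Lemma measurable_leq_tau2 p (g2 : strategy2 Y2) t : (forall t, measurable_fun setT (@g2 t)) ->
  (t <= T2.+1)%N -> (minn t.-1 T1 <= m)%N -> (t.-1 <= n)%N ->
  measurable_fun setT (fun w => (t <= tau2 M (gamma1 M p) g2 (e w))%N).
Proof.
move=> mg2 tT tm tn; under eq_fun do rewrite leq_tau2//.
apply: (measurable_quiet2 me1 me2) => //; first exact: measurable_gamma1.
exact: gamma1_stop.
Qed.

Lemma measurable_pi2 p (g2 : strategy2 Y2) t : (forall t, measurable_fun setT (@g2 t)) ->
  (t <= T2)%N -> (minn t T1 <= m)%N -> (t <= n)%N ->
  measurable_fun setT (pi2 M (gamma1 M p) g2 t \o e).
Proof.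
move=> mg2; elim: t => [tT tm tn|t IH tT tm tn].
  by rewrite (_ : _ \o _ = cst (p0 M))//; apply/funext => w /=; rewrite pi20.
have tm' : (minn t T1 <= m)%N.
  by apply: leq_trans tm; rewrite leq_min geq_minr andbT (leq_trans (geq_minl _ _)).
rewrite (_ : _ \o _ = fun w => if (t.+1 <= tau2 M (gamma1 M p) g2 (e w))%N
   then belief2 M (gamma1 M p) (info2 M (gamma1 M p) t.+1 (e w))
   else pi2 M (gamma1 M p) g2 t (e w)); last by apply/funext => w /=; exact: pi2S.
apply: measurable_fun_ifT.
- by apply: measurable_leq_tau2 => //; rewrite ?(leqW tT)// ltnW.
- apply: measurableT_comp; first exact: measurable_belief2.
  apply: (measurable_info2 me1 me2) => //; first exact: measurable_gamma1.
  exact: gamma1_stop.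
- by apply: IH => //; exact: ltnW.
Qed.

End EmbeddingBeliefs.
End ModelMeasurability.

(** * Independence of the observations *)

Section Independence.
Context (R : realType) (d d1 d2 : measure_display)
  (Omega : measurableType d) (Y1 : measurableType d1)
  (Y2 : measurableType d2) (M : problem R Omega Y1 Y2).

Local Notation P := (Pr M).
Local Notation T1 := (T1 M).
Local Notation T2 := (T2 M).

Definition cylinder (m n : nat) (A : nat -> set Y1) (B : nat -> set Y2) :
    set Omega :=
  [set w | (forall t, (1 <= t <= m)%N -> A t (obs1 M t w)) /\
           (forall t, (1 <= t <= n)%N -> B t (obs2 M t w))].

Definition cylinders (m n : nat) : set (set Omega) :=
  [set E | exists A B, [/\ forall t, measurable (A t),
    forall t, measurable (B t) & E = cylinder m n A B]].

(* Omega with the sigma-algebra generated by the observations of O1 up to time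
   m and those of O2 up to time n. *)
Definition past (m n : nat) := g_sigma_algebraType (cylinders m n).

Lemma measurable_cylinder m n A B : (forall t, measurable (A t)) ->
  (forall t, measurable (B t)) -> measurable (cylinder m n A B).
Proof.
move=> mA mB; rewrite (_ : cylinder m n A B =
  (\bigcap_(t in [set t | (1 <= t <= m)%N]) obs1 M t @^-1` A t) `&`
  (\bigcap_(t in [set t | (1 <= t <= n)%N]) obs2 M t @^-1` B t)); last first.
  by apply/seteqP; split.
by apply: measurableI; apply: bigcap_measurableType => t _;
  apply: measurable_preimageT => //; [exact: obs1_measurable|exact: obs2_measurable].
Qed.

Lemma cylinders_measurable m n : cylinders m n `<=` measurable.
Proof. by move=> E [A [B [mA mB ->]]]; exact: measurable_cylinder. Qed.

Lemma measurable_past m n (E : set Omega) :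
  measurable (E : set (past m n)) -> measurable E.
Proof.
by apply: smallest_sub; [exact: sigma_algebra_measurable|exact: cylinders_measurable].
Qed.

Lemma measurable_fun_past m n d' (U : measurableType d') (f : Omega -> U) :
  measurable_fun setT (f : past m n -> U) -> measurable_fun setT f.
Proof.
move=> mf _ B mB; rewrite setTI; apply: (@measurable_past m n).
by have := mf measurableT B mB; rewrite setTI.
Qed.

Lemma past_obs1 m n s : (1 <= s <= m)%N ->
  measurable_fun setT (obs1 M s : past m n -> Y1).
Proof.
move=> sm _ B mB; rewrite setTI; apply: sub_sigma_algebra.
exists (fun t => if t == s then B else setT), (fun=> setT); split => //.
  by move=> t; case: ifP.
apply/seteqP; split => w /=.
  by move=> Bw; split => // t tm; case: eqP => // ->.
by move=> [/(_ s sm)]; rewrite eqxx.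
Qed.

Lemma past_obs2 m n s : (1 <= s <= n)%N ->
  measurable_fun setT (obs2 M s : past m n -> Y2).
Proof.
move=> sm _ B mB; rewrite setTI; apply: sub_sigma_algebra.
exists (fun=> setT), (fun t => if t == s then B else setT); split => //.
  by move=> t; case: ifP.
apply/seteqP; split => w /=.
  by move=> Bw; split => // t tm; case: eqP => // ->.
by move=> [_ /(_ s sm)]; rewrite eqxx.
Qed.

Let prod_extend m T (F G : nat -> R) : (m <= T)%N ->
  (forall t, (t <= m)%N -> G t = F t) -> (forall t, (m < t)%N -> G t = 1) ->
  \prod_(1 <= t < T.+1) G t = \prod_(1 <= t < m.+1) F t.
Proof.
move=> mT GF G1; rewrite (@big_cat_nat _ _ _ m.+1)//= [X in _ * X]big_nat_cond.
rewrite [X in _ * X]big1 ?mulr1; last by move=> t /andP[/andP[mt _] _]; exact: G1.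
by apply: eq_big_nat => t /andP[_]; exact: GF.
Qed.

Lemma probability_cylinder h m n A B : (m <= T1)%N -> (n <= T2)%N ->
  (forall t, measurable (A t)) -> (forall t, measurable (B t)) ->
  P (hyp_set M h `&` cylinder m n A B) =
  (fine (P (hyp_set M h)) * (\prod_(1 <= t < m.+1) fine (law (O1 M) t h (A t)))
   * (\prod_(1 <= t < n.+1) fine (law (O2 M) t h (B t))))%:E.
Proof.
move=> mT nT mA mB.
(* [obs_law] constrains all times up to the horizons; the later ones get [setT], which contributes a
   factor 1. *)
pose A' t := if (t <= m)%N then A t else setT.
pose B' t := if (t <= n)%N then B t else setT.
have LA : \prod_(1 <= t < T1.+1) fine (law (O1 M) t h (A' t)) =
    \prod_(1 <= t < m.+1) fine (law (O1 M) t h (A t)).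
  apply: prod_extend => // t tm; first by rewrite /A' tm.
  by rewrite /A' leqNgt tm probability_setT.
have LB : \prod_(1 <= t < T2.+1) fine (law (O2 M) t h (B' t)) =
    \prod_(1 <= t < n.+1) fine (law (O2 M) t h (B t)).
  apply: prod_extend => // t tn; first by rewrite /B' tn.
  by rewrite /B' leqNgt tn probability_setT.
rewrite -LA -LB !EFinM fineK; last first.
  by apply: fin_num_measure; exact: measurable_hyp_set.
rewrite -(@obs_law _ _ _ _ _ _ _ M h A' B'); last 2 first.
- by move=> t; rewrite /A'; case: ifP.
- by move=> t; rewrite /B'; case: ifP.
congr (P _); apply/seteqP; split => w /=.
  move=> [Hw [Aw Bw]]; split => // t /andP[t1 _].
    by rewrite /A'; case: ifP => // tm; apply: Aw; rewrite t1.
  by rewrite /B'; case: ifP => // tm; apply: Bw; rewrite t1.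
move=> [Hw Aw Bw]; split => //; split => t /andP[t1 tm].
  by have := Aw t; rewrite /A' tm t1 (leq_trans tm mT); exact.
by have := Bw t; rewrite /B' tm t1 (leq_trans tm nT); exact.
Qed.

Let setI_cylinders m n : setI_closed (cylinders m n).
Proof.
move=> _ _ [A [B [mA mB ->]]] [A' [B' [mA' mB' ->]]].
exists (fun t => A t `&` A' t), (fun t => B t `&` B' t); split.
- by move=> t; exact: measurableI.
- by move=> t; exact: measurableI.
apply/seteqP; split => w /=.
  by move=> [[Aw Bw] [Aw' Bw']]; split => t tm; split; auto.
move=> [AA BB]; split; split => t tm;
  [by case: (AA t tm)|by case: (BB t tm)|by case: (AA t tm)|by case: (BB t tm)].
Qed.

Let cylinders_setT m n : cylinders m n setT.
Proof.
exists (fun=> setT), (fun=> setT); split => //.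
by apply/seteqP; split => w //= _; split.
Qed.

(** Cylinders form a pi-system, and finite measures agreeing on it agree on the generated
    sigma-algebra. The scalars [r] and [s] absorb the constant factors of the product formulas
    below. *)
Let restr_scale_unique m n (C D : set Omega) (mC : measurable C)
    (mD : measurable D) (r s : R) : (0 <= r)%R -> (0 <= s)%R ->
  (forall E, cylinders m n E -> (r%:E * P (E `&` C) = s%:E * P (E `&` D))%E) ->
  forall E, measurable (E : set (past m n)) ->
    (r%:E * P (E `&` C) = s%:E * P (E `&` D))%E.
Proof.
move=> r0 s0 H.
apply: (@g_sigma_algebra_measure_unique _ _ _ (cylinders m n)
  (@cylinders_measurable m n) (fun=> setT) (fun=> cylinders_setT m n) _
  (mscale (NngNum r0) (mrestr P mC)) (mscale (NngNum s0) (mrestr P mD))).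
- by apply/seteqP; split => // w _; exists 0%N.
- exact: setI_cylinders.
- exact: H.
- move=> k; rewrite -ge0_fin_numE ?measure_ge0//.
  by apply: (@fin_num_measure _ _ _ (mscale (NngNum r0) (mrestr P mC))).
Qed.

(** For a cylinder [E], the constraint at time [n.+1] adds one factor to the product formula. Both
    sides are finite measures in [E], so the identity extends to the sigma-algebra of the past. *)
Lemma indep_obs2 h m n (E : set Omega) B : (m <= T1)%N -> (n < T2)%N ->
  measurable (E : set (past m n)) -> measurable B ->
  (P (hyp_set M h `&` E `&` obs2 M n.+1 @^-1` B) =
   P (hyp_set M h `&` E) * law (O2 M) n.+1 h B)%E.
Proof.
move=> mT nT mE mB; have mH := measurable_hyp_set M h.
have mC : measurable (hyp_set M h `&` obs2 M n.+1 @^-1` B).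
  by apply: measurableI => //; apply: measurable_preimageT => //; exact: obs2_measurable.
have L0 : 0 <= fine (law (O2 M) n.+1 h B) by apply: fine_ge0.
have := @restr_scale_unique m n _ _ mC mH 1 _ ler01 L0 _ E mE.
rewrite mul1e fineK; last exact: fin_num_measure.
rewrite setICA setIA muleC (setIC E) => -> // _ [A0 [B0 [mA0 mB0 ->]]].
rewrite mul1e [_ `&` hyp_set _ _]setIC probability_cylinder//; last exact: ltnW.
transitivity (P (hyp_set M h `&` cylinder m n.+1 A0
   (fun t => if t == n.+1 then B else B0 t))).
  congr (P _); apply/seteqP; split => w /=.
    move=> [[Aw Bw] [Hw Bnw]]; split => //; split => // t /andP[t1 tn].
    by case: eqP => [->//|/eqP tn']; apply: Bw; rewrite t1 -ltnS ltn_neqAle tn'.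
  move=> [Hw [Aw Bw]]; split; [split|split] => //.
    move=> t /andP[t1 tn]; have := Bw t; rewrite t1 (leqW tn) => /(_ isT).
    by rewrite ltn_eqF.
  by have := Bw n.+1; rewrite /= leqnn eqxx; exact.
rewrite probability_cylinder//; last by move=> t; case: ifP.
rewrite [\prod_(1 <= t < n.+2) _]big_nat_recr//= eqxx.
rewrite -[in RHS](@fineK _ (law (O2 M) n.+1 h B)) ?fin_num_measure// -EFinM.
congr (_%:E); rewrite (_ : \prod_(1 <= t < n.+1) _ =
  \prod_(1 <= t < n.+1) fine (law (O2 M) t h (B0 t))); first by ring.
by apply: eq_big_nat => t /andP[_ tn]; rewrite ltn_eqF.
Qed.

Lemma indep_obs1 h m n (E : set Omega) B : (m < T1)%N -> (n <= T2)%N ->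
  measurable (E : set (past m n)) -> measurable B ->
  (P (hyp_set M h `&` E `&` obs1 M m.+1 @^-1` B) =
   P (hyp_set M h `&` E) * law (O1 M) m.+1 h B)%E.
Proof.
move=> mT nT mE mB; have mH := measurable_hyp_set M h.
have mC : measurable (hyp_set M h `&` obs1 M m.+1 @^-1` B).
  by apply: measurableI => //; apply: measurable_preimageT => //; exact: obs1_measurable.
have L0 : 0 <= fine (law (O1 M) m.+1 h B) by apply: fine_ge0.
have := @restr_scale_unique m n _ _ mC mH 1 _ ler01 L0 _ E mE.
rewrite mul1e fineK; last exact: fin_num_measure.
rewrite setICA setIA muleC (setIC E) => -> // _ [A0 [B0 [mA0 mB0 ->]]].
rewrite mul1e [_ `&` hyp_set _ _]setIC probability_cylinder//; last exact: ltnW.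
transitivity (P (hyp_set M h `&` cylinder m.+1 n
   (fun t => if t == m.+1 then B else A0 t) B0)).
  congr (P _); apply/seteqP; split => w /=.
    move=> [[Aw Bw] [Hw Bnw]]; split => //; split => // t /andP[t1 tn].
    by case: eqP => [->//|/eqP tn']; apply: Aw; rewrite t1 -ltnS ltn_neqAle tn'.
  move=> [Hw [Aw Bw]]; split; [split|split] => //.
    move=> t /andP[t1 tn]; have := Aw t; rewrite t1 (leqW tn) => /(_ isT).
    by rewrite ltn_eqF.
  by have := Aw m.+1; rewrite /= leqnn eqxx; exact.
rewrite probability_cylinder//; last by move=> t; case: ifP.
rewrite [\prod_(1 <= t < m.+2) _]big_nat_recr//= eqxx.
rewrite -[in RHS](@fineK _ (law (O1 M) m.+1 h B)) ?fin_num_measure// -EFinM.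
congr (_%:E); rewrite (_ : \prod_(1 <= t < m.+1) _ =
  \prod_(1 <= t < m.+1) fine (law (O1 M) t h (A0 t))); first by ring.
by apply: eq_big_nat => t /andP[_ tn]; rewrite ltn_eqF.
Qed.

(** Conditional independence of the two observers, multiplied out so that P(H = h) may vanish. The
    identity is extended from cylinders in two rounds: first in [E1] against a fixed cylinder of O2,
    then in [E2] against an arbitrary [E1]. *)
Lemma indep_obs12 h (E1 E2 : set Omega) :
  measurable (E1 : set (past T1 0)) -> measurable (E2 : set (past 0 T2)) ->
  (P (hyp_set M h) * P (hyp_set M h `&` (E1 `&` E2)) =
   P (hyp_set M h `&` E1) * P (hyp_set M h `&` E2))%E.
Proof.
move=> mE1 mE2; have mH := measurable_hyp_set M h.
have fH : P (hyp_set M h) \is a fin_num by exact: fin_num_measure.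
have pH : 0 <= fine (P (hyp_set M h)) by exact: fine_ge0.
have mE1' := measurable_past mE1; have mE2' := measurable_past mE2.
have rect (C1 C2 : set Omega) : cylinders T1 0 C1 -> cylinders 0 T2 C2 ->
    (P (hyp_set M h) * P (hyp_set M h `&` (C1 `&` C2)) =
     P (hyp_set M h `&` C1) * P (hyp_set M h `&` C2))%E.
  move=> [A [B' [mA mB' ->]]] [A' [B [mA' mB ->]]].
  rewrite (_ : cylinder _ _ _ _ `&` _ = cylinder T1 T2 A B); last first.
    apply/seteqP; split => w /=; first by move=> [[? _] [_ ?]].
    by move=> [? ?]; split; split => // t /andP[/leq_trans h1 /h1].
  rewrite !probability_cylinder// -[in LHS](fineK fH) -!EFinM; congr (_%:E).
  rewrite [\prod_(1 <= t < 1) fine (law (O1 M) t h (A' t))]big_geq//.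
  by rewrite [\prod_(1 <= t < 1) fine (law (O2 M) t h (B' t))]big_geq//=; ring.
have half (C1 : set Omega) : measurable (C1 : set (past T1 0)) ->
    forall C2, cylinders 0 T2 C2 ->
    (P (hyp_set M h) * P (hyp_set M h `&` (C1 `&` C2)) =
     P (hyp_set M h `&` C1) * P (hyp_set M h `&` C2))%E.
  move=> mC1 C2 cC2; have mC2 := cylinders_measurable cC2.
  have mHC2 : measurable (hyp_set M h `&` C2) by exact: measurableI.
  have pC2 : 0 <= fine (P (hyp_set M h `&` C2)) by exact: fine_ge0.
  have := @restr_scale_unique T1 0 _ _ mHC2 mH _ _ pH pC2 _ C1 mC1.
  rewrite !fineK//; last exact: fin_num_measure.
  rewrite setICA [in RHS]muleC (setIC C1 (hyp_set _ _)); apply => C1' cC1'.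
  by rewrite setICA [in RHS]muleC (setIC C1' (hyp_set _ _)); exact: rect.
have mHE1 : measurable (hyp_set M h `&` E1) by exact: measurableI.
have pE1 : 0 <= fine (P (hyp_set M h `&` E1)) by exact: fine_ge0.
have := @restr_scale_unique 0 T2 _ _ mHE1 mH _ _ pH pE1 _ E2 mE2.
rewrite !fineK//; last exact: fin_num_measure.
rewrite (setICA E2) (setIC E2 E1) (setIC E2 (hyp_set _ _)); apply => C2 cC2.
by rewrite (setICA C2) (setIC C2 E1) (setIC C2 (hyp_set _ _)); exact: half.
Qed.

End Independence.

(** * Evolution of the beliefs *)

Section TupleExtension.
Context d (U : measurableType d) (t : nat).

Definition tuple_init (T : Type) (s : t.+1.-tuple T) : t.-tuple T :=
  [tuple tnth s (widen_ord (leqnSn t) i) | i < t].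

Lemma tuple_init_rcons (T : Type) (s : t.-tuple T) x :
  tuple_init [tuple of rcons s x] = s.
Proof.
apply: eq_from_tnth => i; rewrite tnth_mktuple (tnth_nth x) [RHS](tnth_nth x) /=.
by rewrite nth_rcons size_tuple ltn_ord.
Qed.

Lemma tnth_rcons_max (T : Type) (s : t.-tuple T) x :
  tnth [tuple of rcons s x] ord_max = x.
Proof. by rewrite (tnth_nth x) /= nth_rcons size_tuple ltnn eqxx. Qed.

Lemma tuple_init_history (Omega T : Type) (X : nat -> Omega -> T) w :
  tuple_init (history X t.+1 w) = history X t w.
Proof. by apply: eq_from_tnth => i; rewrite !tnth_mktuple. Qed.

Lemma tnth_history_max (Omega T : Type) (X : nat -> Omega -> T) w :
  tnth (history X t.+1 w) ord_max = X t.+1 w.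
Proof. by rewrite tnth_mktuple. Qed.

Lemma historyS (Omega T : Type) (X : nat -> Omega -> T) w :
  history X t.+1 w = [tuple of rcons (history X t w) (X t.+1 w)].
Proof.
apply: eq_from_tnth => i; rewrite tnth_mktuple.
have [it|ti] := ltnP i t.
  have := tnth_mktuple (fun i : 'I_t => X i.+1 w) (Ordinal it).
  rewrite -/(history X t w) => <-; rewrite !(tnth_nth (X t.+1 w)) /=.
  by rewrite nth_rcons size_map size_enum_ord it.
have -> : i = ord_max by apply/val_inj/eqP; rewrite eqn_leq ti -ltnS ltn_ord.
by rewrite tnth_rcons_max.
Qed.

Lemma measurable_tuple_rcons d' (T : measurableType d') (f : T -> t.-tuple U) g :
  measurable_fun setT f -> measurable_fun setT g ->
  measurable_fun setT (fun x => [tuple of rcons (f x) (g x)]).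
Proof.
move=> mf mg; apply/measurable_fun_tnthP => i.
have [it|ti] := ltnP i t.
  rewrite (_ : _ \o _ = (@tnth _ U ^~ (Ordinal it)) \o f); last first.
    apply/funext => x /=; rewrite (tnth_nth (g x)) [RHS](tnth_nth (g x)) /=.
    by rewrite nth_rcons size_tuple it.
  by apply: measurableT_comp => //; exact: measurable_tnth.
have -> : i = ord_max by apply/val_inj/eqP; rewrite eqn_leq ti -ltnS ltn_ord.
rewrite (_ : _ \o _ = g)//; apply/funext => x /=; exact: tnth_rcons_max.
Qed.

Lemma measurable_tuple_init :
  measurable_fun setT (@tuple_init U : t.+1.-tuple U -> t.-tuple U).
Proof.
apply/measurable_fun_tnthP => i.
rewrite (_ : _ \o _ = @tnth _ U ^~ (widen_ord (leqnSn t) i)); last first.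
  by apply/funext => x /=; rewrite tnth_mktuple.
exact: measurable_tnth.
Qed.

End TupleExtension.

(** [x] is the prior probability of H = 0; [a] and [b] are the likelihoods under H = 0 and H = 1. *)
Definition bayes (R : realType) (a b x : R) : R := x * a / (x * a + (1 - x) * b).

Section BeliefUpdates.
Context (R : realType) (d d1 d2 : measure_display)
  (Omega : measurableType d) (Y1 : measurableType d1)
  (Y2 : measurableType d2) (M : problem R Omega Y1 Y2).

Local Notation P := (Pr M).
Local Notation T1 := (T1 M).
Local Notation T2 := (T2 M).

Lemma past_history1 m n t : (t <= m)%N ->
  measurable_fun setT (history (obs1 M) t : past M m n -> _).
Proof.
move=> tm; apply: (@measurable_history1 _ _ _ _ _ _ _ M _ (past M m n) id m) => //.
exact: past_obs1.
Qed.

Lemma past_history2 m n t : (t <= n)%N ->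
  measurable_fun setT (history (obs2 M) t : past M m n -> _).
Proof.
move=> tm; apply: (@measurable_history2 _ _ _ _ _ _ _ M _ (past M m n) id n) => //.
exact: past_obs2.
Qed.

Lemma obs_history1 t : measurable_fun setT (history (obs1 M) t).
Proof. exact: (measurable_fun_past (@past_history1 t 0 t (leqnn t))). Qed.

(** O1 receives no message, so this is Bayes' rule with the whole space as both events and [lam]
    equal to 1. *)
Lemma pi1_update t : (t < T1)%N -> {ae P, forall w,
  let a h := dens (O1 M) t.+1 h (obs1 M t.+1 w) in
  pi1 M t.+1 w = bayes (a false) (a true) (pi1 M t w)}.
Proof.
move=> tT.
have := @bayes_rule _ _ _ _ _ _ _ M _ _ _ _ _ _ (history (obs1 M) t)
  (obs1 M t.+1) (history (obs1 M) t.+1) (@obs_history1 t) (@obs1_measurable _ _ _ _ _ _ _ M t.+1)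
  (@obs_history1 t.+1) (fun x : t.-tuple Y1 * Y1 => [tuple of rcons x.1 x.2])
  (@tuple_init t Y1) (fun s => tnth s ord_max) _ (@measurable_tuple_init _ _ t)
  (measurable_tnth _) setT setT measurableT measurableT _ _ _
  _ _ (@belief1P _ _ _ _ _ _ _ M t) (@belief1P _ _ _ _ _ _ _ M t.+1)
  (ref (O1 M) t.+1) (law (O1 M) t.+1) (dens (O1 M) t.+1) (fun=> 1)
  (dens_ge0 (O1 M) t.+1) (@dens_measurable _ _ _ (O1 M) t.+1)
  (law_dens (O1 M) t.+1) _ _.
move=> /(_ (measurable_tuple_rcons measurable_fst measurable_snd)).
have Th w : [set: t.+1.-tuple Y1] (history (obs1 M) t.+1 w) ->
    history (obs1 M) t.+1 w = [tuple of rcons (history (obs1 M) t w, obs1 M t.+1 w).1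
      (history (obs1 M) t w, obs1 M t.+1 w).2] by rewrite historyS.
have rh w : tuple_init (history (obs1 M) t.+1 w) = history (obs1 M) t w.
  by rewrite tuple_init_history.
have sh w : tnth (history (obs1 M) t.+1 w) ord_max = obs1 M t.+1 w.
  by rewrite tnth_history_max.
move=> /(_ Th rh sh (fun=> ler01)) H.
apply: filterS (H _) => [w /(_ I)|h A B mA mB] /=.
  rewrite !mul1r /bayes /pi1 => -[_ ->].
  by [].
rewrite mul1e !preimage_setT !setIT.
by rewrite (@indep_obs1 _ _ _ _ _ _ _ M h t 0)//; exact: (measurable_preimageT (@past_history1 t 0 t (leqnn t)) mA).
Qed.

(** The messages are functions of O1's observations, hence independent of those of O2 given H. So
    the probability [lam h] of the last message given the earlier ones is unchanged by conditioning
    on O2's history, and it multiplies the likelihood of O2's new observation. *)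
Lemma belief2_update p t (z : t.+1.-tuple action) (lam : bool -> R) : (t < T2)%N ->
  (forall h, 0 <= lam h) ->
  (forall h, P (hyp_set M h `&` history (Z1 M (gamma1 M p)) t.+1 @^-1` [set z]) =
    ((lam h)%:E * P (hyp_set M h `&`
       history (Z1 M (gamma1 M p)) t @^-1` [set tuple_init z]))%E) ->
  {ae P, forall w, history (Z1 M (gamma1 M p)) t.+1 w = z ->
    let a h := lam h * dens (O2 M) t.+1 h (obs2 M t.+1 w) in
    let x := belief2 M (gamma1 M p) (info2 M (gamma1 M p) t w) in
    x * a false + (1 - x) * a true != 0 /\
    belief2 M (gamma1 M p) (info2 M (gamma1 M p) t.+1 w) =
      bayes (a false) (a true) x}.
Proof.
move=> tT lam0 lamE.
set g1 := gamma1 M p in lamE *.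
have mZ n s : measurable_fun setT (history (Z1 M g1) s : past M T1 n -> _).
  apply/measurable_fun_tnthP => i.
  rewrite (_ : _ \o _ = Z1 M g1 i.+1); last first.
    by apply/funext => w; rewrite /= tnth_mktuple.
  apply: (@measurable_Z1 _ _ _ _ _ _ _ M _ (past M T1 n) id T1) => //.
  - exact: past_obs1.
  - exact: measurable_gamma1.
  - exact: gamma1_stop.
  - exact: geq_minr.
have mF s (y : s.-tuple action) : measurable ([set x : s.-tuple Y2 * s.-tuple action | x.2 = y]).
  rewrite (_ : mkset _ = snd @^-1` [set y])//; apply: measurable_preimageT.
    exact: measurable_snd.
  exact: measurable_tuple_set1.
have mTheta : measurable_fun setT (fun x : (t.-tuple Y2 * t.-tuple action) * Y2 =>
    ([tuple of rcons x.1.1 x.2], z)).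
  apply: measurable_fun_pair => //.
  by apply: measurable_tuple_rcons => //; exact: measurableT_comp.
have mrho : measurable_fun setT (fun s : t.+1.-tuple Y2 * t.+1.-tuple action =>
    (tuple_init s.1, tuple_init s.2)).
  by apply: measurable_fun_pair;
    apply: measurableT_comp => //; exact: measurable_tuple_init.
have msigma : measurable_fun setT (fun s : t.+1.-tuple Y2 * t.+1.-tuple action =>
    tnth s.1 ord_max).
  by apply: (measurableT_comp (measurable_tnth ord_max)).
have := @bayes_rule _ _ _ _ _ _ _ M _ _ _ _ _ _ (info2 M g1 t)
  (obs2 M t.+1) (info2 M g1 t.+1) (@info2_measurable _ _ _ _ _ _ _ M p t)
  (@obs2_measurable _ _ _ _ _ _ _ M t.+1)
  (@info2_measurable _ _ _ _ _ _ _ M p t.+1) _ _ _ mTheta mrho msigma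
  _ _ (mF t (tuple_init z)) (mF t.+1 z) _ _ _
  _ _ (@belief2P _ _ _ _ _ _ _ M p t) (@belief2P _ _ _ _ _ _ _ M p t.+1)
  (ref (O2 M) t.+1) (law (O2 M) t.+1) (dens (O2 M) t.+1) lam
  (dens_ge0 (O2 M) t.+1) (@dens_measurable _ _ _ (O2 M) t.+1)
  (law_dens (O2 M) t.+1) lam0 _.
have Th w : [set x : t.+1.-tuple Y2 * t.+1.-tuple action | x.2 = z] (info2 M g1 t.+1 w) ->
    info2 M g1 t.+1 w = ([tuple of rcons (info2 M g1 t w, obs2 M t.+1 w).1.1
                          (info2 M g1 t w, obs2 M t.+1 w).2], z).
  by rewrite /info2 /= => ->; rewrite historyS.
have rh w : (tuple_init (info2 M g1 t.+1 w).1, tuple_init (info2 M g1 t.+1 w).2) = info2 M g1 t w.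
  by rewrite /info2 /= !tuple_init_history.
have sh w : tnth (info2 M g1 t.+1 w).1 ord_max = obs2 M t.+1 w.
  by rewrite tnth_history_max.
move=> /(_ Th rh sh) H.
apply: filterS (H _) => [w Hw zw|h A B mA mB] /=.
  have [] := Hw zw; rewrite /bayes /= -/(belief2 M g1 _).
  set x := belief2 M g1 (info2 M g1 t w).
  have E (a b c : R) : a * b * c = b * (a * c) by ring.
  by rewrite !E.
have mH := measurable_hyp_set M h.
pose A' := [set y : t.-tuple Y2 | A (y, tuple_init z)].
have mA' : measurable A'.
  rewrite (_ : A' = (fun y => (y, tuple_init z)) @^-1` A)//.
  by apply: measurable_preimageT mA; exact: measurable_fun_pair.
pose E1 := history (Z1 M g1) t.+1 @^-1` [set z].
pose F1 := history (Z1 M g1) t @^-1` [set tuple_init z].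
pose G := history (obs2 M) t @^-1` A'.
have mE1 n : measurable (E1 : set (past M T1 n)).
  exact: (measurable_preimageT (mZ n t.+1) (@measurable_tuple_set1 _ z)).
have mF1 n : measurable (F1 : set (past M T1 n)).
  exact: (measurable_preimageT (mZ n t) (@measurable_tuple_set1 _ (tuple_init z))).
have mG m n : (t <= n)%N -> measurable (G : set (past M m n)).
  by move=> tn; exact: (measurable_preimageT (@past_history2 m n t tn) mA').
have E1F1 : E1 `<=` F1 by move=> w; rewrite /E1 /F1 /= => <-; rewrite tuple_init_history.
transitivity (P (hyp_set M h `&` (E1 `&` G) `&` obs2 M t.+1 @^-1` B)).
  congr (P _); apply/seteqP; split => w /=.
    move=> [[[Hw zw] Aw] Bw]; split => //; split => //; split => //.
    by move: Aw; rewrite /G /A' /info2 /= -(E1F1 _ zw).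
  move=> [[Hw [zw Aw]] Bw]; split => //; split => //.
  by move: Aw; rewrite /G /A' /info2 /= -(E1F1 _ zw).
rewrite (@indep_obs2 _ _ _ _ _ _ _ M h T1 t)//; last first.
  by apply: measurableI; [exact: mE1|exact: mG].
congr (_ * _)%E.
transitivity ((lam h)%:E * P (hyp_set M h `&` (F1 `&` G)))%E; last first.
  congr (_ * P _)%E; apply/seteqP; split => w /=.
    by move=> [Hw [zw Aw]]; split => //; move: Aw; rewrite /G /A' /info2 /= -zw.
  move=> [[Hw zw] Aw]; split => //; split => //.
  by move: Aw; rewrite /G /A' /info2 /= -zw.
have ind1 := @indep_obs12 _ _ _ _ _ _ _ M h E1 G (mE1 0) (mG 0 T2 (ltnW tT)).
have ind2 := @indep_obs12 _ _ _ _ _ _ _ M h F1 G (mF1 0) (mG 0 T2 (ltnW tT)).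
(* [ind1] and [ind2] carry the factor P(H = h). It is cancelled when positive; when it is zero both
   sides vanish. *)
have [h0|h0] := eqVneq (P (hyp_set M h)) 0%E.
  have H0 D : measurable D -> P (hyp_set M h `&` D) = 0%E.
    move=> mD; apply/eqP; rewrite eq_le measure_ge0 andbT -h0 le_measure ?inE//.
    exact: measurableI.
  have mGO := measurable_past (mG 0 T2 (ltnW tT)).
  rewrite !H0 ?mule0//; apply: measurableI => //; first exact: measurable_past (mF1 0).
  exact: measurable_past (mE1 0).
have fP D : measurable D -> P (hyp_set M h `&` D) \is a fin_num.
  by move=> mD; apply: fin_num_measure; exact: measurableI.
have fh : P (hyp_set M h) \is a fin_num by exact: fin_num_measure.
have : (P (hyp_set M h) * P (hyp_set M h `&` (E1 `&` G)) =
        P (hyp_set M h) * ((lam h)%:E * P (hyp_set M h `&` (F1 `&` G))))%E.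
  by rewrite ind1 muleCA ind2 muleA -lamE.
move=> /(congr1 (fun x => (P (hyp_set M h))^-1 * x)%E).
by rewrite !muleA mulVe ?mul1e.
Qed.

End BeliefUpdates.

(** * Evolution of the state while O1 is silent *)

Section Dynamics.
Context (R : realType) (d d1 d2 : measure_display)
  (Omega : measurableType d) (Y1 : measurableType d1)
  (Y2 : measurableType d2) (M : problem R Omega Y1 Y2).

Local Notation P := (Pr M).
Local Notation T1 := (T1 M).
Local Notation T2 := (T2 M).

Lemma integral_indep h m n (E : set Omega) dZ (U : measurableType dZ)
    (Z : Omega -> U) (L : probability U R) dV (V : measurableType dV)
    (X : Omega -> V) (k : V * U -> \bar R) :
  measurable_fun setT Z ->
  (forall (F : set Omega) B, measurable (F : set (past M m n)) -> measurable B ->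
     P (hyp_set M h `&` F `&` Z @^-1` B) = (P (hyp_set M h `&` F) * L B)%E) ->
  measurable (E : set (past M m n)) ->
  measurable_fun setT (X : past M m n -> V) ->
  measurable_fun setT k -> (forall x, (0 <= k x)%E) ->
  (\int[P]_(w in hyp_set M h `&` E) k (X w, Z w) =
   \int[P]_(w in hyp_set M h `&` E) \int[L]_y k (X w, y))%E.
Proof.
move=> mZ indep mE mX mk k0; have mH := measurable_hyp_set M h.
have mE' := measurable_past mE.
rewrite -[RHS]mul1e; apply: ge0_integral_joint => //.
- exact: measurable_fun_past mX.
- exact: measurableI.
- exact: measurableI.
move=> A B mA mB; rewrite mul1e -setIA -!setIA setIA setIA -setIA.
have mEA : measurable (E `&` X @^-1` A : set (past M m n)).
  by apply: measurableI => //; exact: (measurable_preimageT mX mA).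
by have := indep _ B mEA mB; rewrite !setIA.
Qed.

Lemma joint_obs2 h m n (E : set Omega) dV (V : measurableType dV)
    (X : Omega -> V) (k : V * Y2 -> \bar R) : (m <= T1)%N -> (n < T2)%N ->
  measurable (E : set (past M m n)) ->
  measurable_fun setT (X : past M m n -> V) ->
  measurable_fun setT k -> (forall x, (0 <= k x)%E) ->
  (\int[P]_(w in hyp_set M h `&` E) k (X w, obs2 M n.+1 w) =
   \int[P]_(w in hyp_set M h `&` E) \int[law (O2 M) n.+1 h]_y k (X w, y))%E.
Proof.
move=> mT nT; apply: integral_indep => [|F B mF mB]; first exact: obs2_measurable.
exact: (@indep_obs2 _ _ _ _ _ _ _ M h m n).
Qed.

Lemma joint_obs1 h m n (E : set Omega) dV (V : measurableType dV)
    (X : Omega -> V) (k : V * Y1 -> \bar R) : (m < T1)%N -> (n <= T2)%N ->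
  measurable (E : set (past M m n)) ->
  measurable_fun setT (X : past M m n -> V) ->
  measurable_fun setT k -> (forall x, (0 <= k x)%E) ->
  (\int[P]_(w in hyp_set M h `&` E) k (X w, obs1 M m.+1 w) =
   \int[P]_(w in hyp_set M h `&` E) \int[law (O1 M) m.+1 h]_y k (X w, y))%E.
Proof.
move=> mT nT; apply: integral_indep => [|F B mF mB]; first exact: obs1_measurable.
exact: (@indep_obs1 _ _ _ _ _ _ _ M h m n).
Qed.

Definition state (g1 : strategy1 Y1) (g2 : strategy2 Y2) (t s : nat)
    (w : Omega) : bool * R * R * bool :=
  (hyp M w, pi1 M t w, pi2 M g1 g2 s w, (t <= tau2 M g1 g2 w)%N).

Lemma measurable_hyp_case d' (U : measurableType d')
    (f : bool -> bool * R * R * bool -> U) :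
  (forall h, measurable_fun setT (f h)) ->
  measurable_fun setT (fun s : bool * R * R * bool => f s.1.1.1 s).
Proof.
move=> mf; apply: measurable_fun_case => // h.
apply: measurable_preimageT => //.
by apply: (measurableT_comp measurable_fst); apply: (measurableT_comp measurable_fst).
Qed.

Section Design.
Variables (W : nat -> nat -> thr2 R) (p : design R).
Let g1 := gamma1 M p.
Let g2 := gamma2 M W p.

Let mg1 : forall t, measurable_fun setT (@g1 t).
Proof. exact: measurable_gamma1. Qed.

Let mg2 : forall t, measurable_fun setT (@g2 t).
Proof. exact: measurable_gamma2. Qed.

Lemma past_Z1 m n t : (minn t T1 <= m)%N -> measurable_fun setT (Z1 M g1 t : past M m n -> _).
Proof.
move=> tm; apply: (@measurable_Z1 _ _ _ _ _ _ _ M _ (past M m n) id m) => //.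
  exact: past_obs1.
exact: gamma1_stop.
Qed.

Lemma past_quiet1 m n t : (t <= m)%N -> measurable_fun setT (quiet1 M g1 t : past M m n -> _).
Proof.
move=> tm; apply: (@measurable_quiet1 _ _ _ _ _ _ _ M _ (past M m n) id m) => //.
exact: past_obs1.
Qed.

Lemma past_silent m n t : (t <= m)%N -> (m <= T1)%N ->
  measurable (silent M g1 t : set (past M m n)).
Proof.
move=> tm mT; rewrite silentE ?(leq_trans tm)//.
exact: (measurable_holds (@past_quiet1 m n t tm)).
Qed.

Lemma past_silentZ m n t z : (t < m)%N -> (m <= T1)%N ->
  measurable (silent M g1 t `&` [set w | Z1 M g1 t.+1 w = z] : set (past M m n)).
Proof.
move=> tm mT; apply: measurableI; first by apply: past_silent => //; exact: ltnW.
rewrite (_ : mkset _ = Z1 M g1 t.+1 @^-1` [set z])//.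
apply: (@measurable_preimageT _ (past M m n) _ _ (Z1 M g1 t.+1)) => //.
by apply: past_Z1; rewrite (leq_trans (geq_minl _ _)).
Qed.

Lemma past_leq_tau2 m n t : (t <= T2.+1)%N -> (minn t.-1 T1 <= m)%N -> (t.-1 <= n)%N ->
  measurable_fun setT ((fun w => (t <= tau2 M g1 g2 w)%N) : past M m n -> bool).
Proof.
move=> tT tm tn.
apply: (@measurable_leq_tau2 _ _ _ _ _ _ _ M _ (past M m n) id m n) => //.
- exact: past_obs1.
- exact: past_obs2.
Qed.

Lemma past_pi2 m n t : (t <= T2)%N -> (minn t T1 <= m)%N -> (t <= n)%N ->
  measurable_fun setT (pi2 M g1 g2 t : past M m n -> R).
Proof.
move=> tT tm tn; apply: (@measurable_pi2 _ _ _ _ _ _ _ M _ (past M m n) id m n) => //.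
- exact: past_obs1.
- exact: past_obs2.
Qed.

Lemma past_pi1 m n t : (t <= m)%N -> measurable_fun setT (pi1 M t : past M m n -> R).
Proof.
move=> tm; apply: (@measurable_pi1 _ _ _ _ _ _ _ M _ (past M m n) id m) => //.
exact: past_obs1.
Qed.

Lemma measurable_state t s : (t <= T2.+1)%N -> (s <= T2)%N ->
  measurable_fun setT (state g1 g2 t s).
Proof.
move=> tT sT; repeat apply: measurable_fun_pair.
- exact: hyp_measurable.
- exact: (measurable_fun_past (@past_pi1 t 0 t (leqnn t))).
- apply: (@measurable_fun_past _ _ _ _ _ _ _ M T1 s); apply: past_pi2 => //.
  exact: geq_minr.
- apply: (@measurable_fun_past _ _ _ _ _ _ _ M T1 t.-1).
  apply: past_leq_tau2 => //; exact: geq_minr.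
Qed.

(** At time 0 the information takes a single value, so the version is constant along [info2] and its
    integral over the whole space forces it to be [p0] everywhere, not merely almost everywhere. *)
Lemma belief2_0 w : belief2 M g1 (info2 M g1 0 w) = p0 M.
Proof.
have [_ _ /(_ setT measurableT)] := @belief2P _ _ _ _ _ _ _ M p 0.
rewrite preimage_setT setIT prior.
have -> : (fun w => (belief2 M (gamma1 M p) (info2 M (gamma1 M p) 0 w))%:E) =
    cst (belief2 M g1 (info2 M g1 0 w))%:E.
  apply/funext => w' /=; congr ((belief2 M _ _)%:E).
  by rewrite /info2; congr (_, _); rewrite [LHS]tuple0 [RHS]tuple0.
have -> : (\int[P]_x cst (belief2 M g1 (info2 M g1 0 w))%:E x =
    (belief2 M g1 (info2 M g1 0 w))%:E * P setT)%E by exact: integral_cst.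
by rewrite probability_setT mule1 => -[].
Qed.

Lemma pi2_active t w : (t <= tau2 M g1 g2 w)%N ->
  pi2 M g1 g2 t w = belief2 M g1 (info2 M g1 t w).
Proof.
by case: t => [_|t tt]; [rewrite pi20 belief2_0|rewrite pi2S tt].
Qed.

Lemma not_received t w : (t <= T1)%N -> silent M g1 t w ->
  received (info2 M g1 t w).2 = false.
Proof.
move=> tT sw; apply/negbTE; rewrite -all_predC; apply/allP => a /= /mapP[i _ ->].
by rewrite negbK sw//= (leq_trans (ltn_ord i)).
Qed.

Definition rule_O1 t (x : R) : action :=
  if (t < T1)%N then rule4 (thr_O1 p t) x else rule1 (thr_final p) x.

Lemma measurable_rule_O1 t : measurable_fun setT (rule_O1 t).
Proof.
rewrite /rule_O1; case: (t < T1)%N; [exact: measurable_rule4|exact: measurable_rule1].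
Qed.

Lemma Z1_silent t w : (t < T1)%N -> silent M g1 t w ->
  Z1 M g1 t.+1 w = rule_O1 t.+1 (pi1 M t.+1 w).
Proof.
move=> tT; rewrite silentE//; last exact: ltnW.
by move=> /= q; rewrite Z1E//= q.
Qed.

Lemma silentS t : silent M g1 t.+1 = silent M g1 t `&` [set w | Z1 M g1 t.+1 w = None].
Proof.
apply/seteqP; split => w /=.
  move=> sw; split; last by apply: sw; rewrite leqnn.
  by move=> s /andP[s1 st]; apply: sw; rewrite s1 leqW.
move=> [sw zw] s /andP[s1]; rewrite leq_eqVlt => /predU1P[->//|st].
by apply: sw; rewrite s1.
Qed.

(** [belief2_update] is stated for a fixed tuple of messages; this is the tuple for silence up to
    [t] followed by [z]. *)
Lemma silent_history t z w : (silent M g1 t `&` [set w | Z1 M g1 t.+1 w = z]) w <->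
  history (Z1 M g1) t.+1 w = [tuple of rcons [tuple of nseq t None] z].
Proof.
have hS s : history (Z1 M g1) s w = [tuple of nseq s None] <-> silent M g1 s w.
  split=> [hw u /andP[u1 us]|sw].
    have us' : (u.-1 < s)%N by rewrite prednK.
    have := tnth_mktuple (fun i : 'I_s => Z1 M g1 i.+1 w) (Ordinal us').
    rewrite -/(history (Z1 M g1) s w) hw /= prednK// => <-.
    by rewrite (tnth_nth None) /= nth_nseq; case: ifP.
  apply: eq_from_tnth => i; rewrite tnth_mktuple (tnth_nth None) /= nth_nseq ltn_ord.
  by apply: sw; rewrite /= ltn_ord.
rewrite historyS; split=> [[/hS -> /= -> //]|e]; split.
  by apply/hS; have := congr1 (@tuple_init t _) e; rewrite !tuple_init_rcons.
by have := congr1 (fun s => tnth s ord_max) e; rewrite !tnth_rcons_max.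
Qed.

(** The half step in which O1's message arrives and O2 observes. H is kept because it governs the
    law of the fresh observation; O1's belief does not change, and that of O2 is frozen once it has
    stopped. [lam] is the likelihood of the message under each hypothesis. *)
Definition phi_kernel t (lam : bool -> R) (x : bool * R * R * bool * Y2) :
    bool * R * R * bool :=
  let: (h, x1, x2, D) := x.1 in
  let a b := lam b * dens (O2 M) t b x.2 in
  (h, x1, if D then bayes (a false) (a true) x2 else x2, D).

Definition psi_kernel t (a : thr2 R) (x : bool * R * R * bool * Y1) :
    bool * R * R * bool :=
  let: (h, x1, x2, D) := x.1 in
  let f b := dens (O1 M) t.+1 b x.2 in
  (h, bayes (f false) (f true) x1, x2, D && (rule2 a x2 == None)).

Lemma phi_update t z (lam : bool -> R) : (t < T1)%N -> (forall h, 0 <= lam h) ->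
  (forall h, P (hyp_set M h `&` (silent M g1 t `&` [set w | Z1 M g1 t.+1 w = z])) =
     ((lam h)%:E * P (hyp_set M h `&` silent M g1 t))%E) ->
  {ae P, forall w, (silent M g1 t `&` [set w | Z1 M g1 t.+1 w = z]) w ->
    state g1 g2 t.+1 t.+1 w = phi_kernel t.+1 lam (state g1 g2 t.+1 t w, obs2 M t.+1 w)}.
Proof.
move=> tT lam0 lamE.
have tT2 : (t < T2)%N by exact: leq_trans (T1_le_T2 M).
have := @belief2_update _ _ _ _ _ _ _ M p t [tuple of rcons [tuple of nseq t None] z] lam tT2 lam0.
have E1 : history (Z1 M (gamma1 M p)) t.+1 @^-1` [set [tuple of rcons [tuple of nseq t None] z]] =
    silent M g1 t `&` [set w | Z1 M g1 t.+1 w = z].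
  by apply/seteqP; split => w /= /silent_history.
have E2 : history (Z1 M (gamma1 M p)) t @^-1` [set [tuple of nseq t None]] = silent M g1 t.
  apply/seteqP; split => w /= hw.
    have [] := (silent_history t (Z1 M g1 t.+1 w) w).2 => //.
    by rewrite historyS hw.
  have /silent_history : (silent M g1 t `&` [set w' | Z1 M g1 t.+1 w' = Z1 M g1 t.+1 w]) w by [].
  by move=> /(congr1 (@tuple_init t _)); rewrite tuple_init_history tuple_init_rcons.
rewrite tuple_init_rcons E1 E2 => /(_ lamE).
apply: filterS => w H /silent_history /H /= [_ bE].
rewrite /phi_kernel /state /= pi2S; case: ifPn => // tw.
by rewrite bE pi2_active// ltnW.
Qed.

Lemma psi_update t : (t.+1 < T1)%N ->
  {ae P, forall w, silent M g1 t.+1 w ->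
    state g1 g2 t.+2 t.+1 w =
      psi_kernel t.+1 (thr_O2 p t.+1) (state g1 g2 t.+1 t.+1 w, obs1 M t.+2 w)}.
Proof.
move=> tT; have := @pi1_update _ _ _ _ _ _ _ M t.+1 tT.
apply: filterS => w /= piE sw; rewrite /psi_kernel /state /= piE.
have tT2 : (t.+1 < T2)%N by exact: leq_trans (T1_le_T2 M).
have t2 : (t.+2 <= T2.+1)%N by rewrite ltnS ltnW.
rewrite (leq_tau2 _ _ _ t2) quiet2S -(leq_tau2 g1 g2 w (t := t.+1)); last by rewrite ltnW.
case: (boolP (t < tau2 M g1 g2 w)%N) => tt //=.
congr (_, _); congr (_ == _); rewrite pi2_active// /act2 /g2 /gamma2.
by rewrite not_received// ltnW.
Qed.

End Design.
End Dynamics.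

(** * Transfer of state laws between designs *)

Lemma measurable_bayes (R : realType) d (T : measurableType d) (a b x : T -> R) :
  measurable_fun setT a -> measurable_fun setT b -> measurable_fun setT x ->
  measurable_fun setT (fun w => bayes (a w) (b w) (x w)).
Proof.
move=> ma mb mx; rewrite /bayes.
have mxa : measurable_fun setT (fun w => x w * a w) by exact: measurable_funM.
apply: measurable_funM => //; apply: measurable_funV.
apply: measurable_funD => //; apply: measurable_funM => //.
by apply: measurable_funB.
Qed.

(** The law of [X] on [E] is [r] times that of [Y] on [F]. Stated on test functions, the relation
    passes through a transition by replacing [f] by its pullback. *)
Definition scaled (R : realType) d (T : measurableType d) (P : set T -> \bar R)
    d' (S : measurableType d') (r : R) (E F : set T) (X Y : T -> S) : Prop :=
  forall f : S -> \bar R, measurable_fun setT f -> (forall x, (0 <= f x)%E) ->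
    (\int[P]_(w in E) f (X w) = r%:E * \int[P]_(w in F) f (Y w))%E.

Section StateLaws.
Context (R : realType) (d d1 d2 : measure_display)
  (Omega : measurableType d) (Y1 : measurableType d1)
  (Y2 : measurableType d2) (M : problem R Omega Y1 Y2).
Variable W : nat -> nat -> thr2 R.

Local Notation P := (Pr M).
Local Notation T1 := (T1 M).
Local Notation T2 := (T2 M).
Local Notation st := (bool * R * R * bool)%type.
Local Notation G1 := (gamma1 M).
Local Notation G2 := (gamma2 M W).
Local Notation silent1 p t := (silent M (gamma1 M p) t).
Local Notation silentZ p t z :=
  (silent1 p t `&` [set w | Z1 M (gamma1 M p) t.+1 w = z]).
Local Notation stt p t s := (state M (gamma1 M p) (gamma2 M W p) t s).

Definition average dU (U : measurableType dU) (L : bool -> probability U R)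
    (k : st * U -> \bar R) (s : st) : \bar R := (\int[L s.1.1.1]_y k (s, y))%E.

Lemma measurable_average dU (U : measurableType dU) (L : bool -> probability U R) k :
  measurable_fun setT k -> (forall x, (0 <= k x)%E) -> measurable_fun setT (average L k).
Proof.
move=> mk k0; apply: (@measurable_hyp_case _ _ _ (fun h s => \int[L h]_y k (s, y))%E) => h.
exact: (@measurable_fun_fubini_tonelli_F _ _ _ _ _ (L h) k).
Qed.

Lemma average_ge0 dU (U : measurableType dU) (L : bool -> probability U R) k s :
  (forall x, (0 <= k x)%E) -> (0 <= average L k s)%E.
Proof. by move=> k0; exact: integral_ge0. Qed.

Lemma measurable_silent p t : (t <= T1)%N -> measurable (silent1 p t).
Proof. by move=> tT; apply: (@measurable_past _ _ _ _ _ _ _ M t 0); exact: past_silent. Qed.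

Lemma measurable_silentZ p t z : (t < T1)%N -> measurable (silentZ p t z).
Proof. by move=> tT; apply: (@measurable_past _ _ _ _ _ _ _ M T1 0); exact: past_silentZ. Qed.

(** H is not a function of the observations, so the state is not measurable for [past], where
    independence applies. Each integral is split over the two hypotheses; there H is a constant,
    attached to the [visible] part of the state. *)
Let attach (h : bool) (v : R * R * bool) : st := (h, v.1.1, v.1.2, v.2).

Let measurable_attach h : measurable_fun setT (attach h).
Proof.
repeat apply: measurable_fun_pair => //.
  exact: (measurableT_comp measurable_fst measurable_fst).
exact: (measurableT_comp measurable_snd measurable_fst).
Qed.

Let visible p t s (w : Omega) : R * R * bool :=
  (pi1 M t w, pi2 M (G1 p) (G2 p) s w, (t <= tau2 M (G1 p) (G2 p) w)%N).

Let integral_average p t s (E : set Omega) dU (U : measurableType dU)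
    (L : bool -> probability U R) (Z : Omega -> U) (k : st * U -> \bar R) :
  measurable E -> measurable_fun setT Z -> measurable_fun setT (stt p t s) ->
  measurable_fun setT k -> (forall x, (0 <= k x)%E) ->
  (forall h (f : (R * R * bool) * U -> \bar R), measurable_fun setT f ->
    (forall x, (0 <= f x)%E) ->
    (\int[P]_(w in hyp_set M h `&` E) f (visible p t s w, Z w) =
     \int[P]_(w in hyp_set M h `&` E) \int[L h]_y f (visible p t s w, y))%E) ->
  (\int[P]_(w in E) k (stt p t s w, Z w) =
   \int[P]_(w in E) average L k (stt p t s w))%E.
Proof.
move=> mE mZ mst mk k0 joint.
rewrite integral_hyp_split//; last first.
  by apply: measurableT_comp => //; exact: measurable_fun_pair.
rewrite [RHS]integral_hyp_split//; last 2 first.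
- by apply: measurableT_comp => //; exact: measurable_average.
- by move=> w; exact: average_ge0.
suff H h : (\int[P]_(w in hyp_set M h `&` E) k (stt p t s w, Z w) =
   \int[P]_(w in hyp_set M h `&` E) average L k (stt p t s w))%E by rewrite !H.
have mk' : measurable_fun setT (fun x : (R * R * bool) * U => k (attach h x.1, x.2)).
  apply: measurableT_comp => //; apply: measurable_fun_pair => //.
  exact: (measurableT_comp (@measurable_attach h)).
transitivity (\int[P]_(w in hyp_set M h `&` E) k (attach h (visible p t s w), Z w))%E.
  by apply: eq_integral => w /set_mem[hw _]; rewrite /state hw.
rewrite (joint h _ mk' (fun=> k0 _)); apply: eq_integral => w /set_mem[hw _].
by rewrite /average /state hw.
Qed.

Lemma integral_obs2 p t (k : st * Y2 -> \bar R) : (t < T1)%N ->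
  measurable_fun setT k -> (forall x, (0 <= k x)%E) ->
  (\int[P]_(w in silent1 p t) k (stt p t.+1 t w, obs2 M t.+1 w) =
   \int[P]_(w in silent1 p t) average (law (O2 M) t.+1) k (stt p t.+1 t w))%E.
Proof.
move=> tT mk k0; have tT2 : (t < T2)%N by exact: leq_trans (T1_le_T2 M).
have mV : measurable_fun setT (visible p t.+1 t : past M T1 t -> _).
  repeat apply: measurable_fun_pair.
  - exact: past_pi1.
  - apply: past_pi2 => //; [exact: ltnW|exact: geq_minr].
  - by apply: past_leq_tau2 => //; [rewrite ltnS ltnW|exact: geq_minr].
apply: integral_average => //.
- by apply: measurable_silent; exact: ltnW.
- exact: obs2_measurable.
- by apply: measurable_state; rewrite // ?ltnS ltnW.
move=> h f; apply: (@joint_obs2 _ _ _ _ _ _ _ M h T1 t (silent1 p t) _ _ _ f) => //.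
by apply: past_silent => //; exact: ltnW.
Qed.

Lemma integral_obs1 p t (k : st * Y1 -> \bar R) : (t.+1 < T1)%N ->
  measurable_fun setT k -> (forall x, (0 <= k x)%E) ->
  (\int[P]_(w in silent1 p t.+1) k (stt p t.+1 t.+1 w, obs1 M t.+2 w) =
   \int[P]_(w in silent1 p t.+1) average (law (O1 M) t.+2) k (stt p t.+1 t.+1 w))%E.
Proof.
move=> tT mk k0; have tT2 : (t.+1 < T2)%N by exact: leq_trans (T1_le_T2 M).
have mV : measurable_fun setT (visible p t.+1 t.+1 : past M t.+1 t.+1 -> _).
  repeat apply: measurable_fun_pair.
  - exact: past_pi1.
  - by apply: past_pi2 => //; [exact: ltnW|exact: geq_minl].
  - apply: past_leq_tau2 => //; [by rewrite ltnW// ltnW|].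
    by rewrite (leq_trans (geq_minl _ _))/=.
apply: integral_average => //.
- by apply: measurable_silent; exact: ltnW.
- exact: obs1_measurable.
- by apply: measurable_state; [exact: leqW (ltnW tT2)|exact: ltnW].
move=> h f.
apply: (@joint_obs1 _ _ _ _ _ _ _ M h t.+1 t.+1 (silent1 p t.+1) _ _ _ f) => //.
  exact: ltnW.
by apply: past_silent => //; exact: ltnW.
Qed.

Let measurable_coordinates dU (U : measurableType dU) :
  [/\ measurable_fun setT (fun x : st * U => x.1.1.1.1),
      measurable_fun setT (fun x : st * U => x.1.1.1.2),
      measurable_fun setT (fun x : st * U => x.1.1.2) &
      measurable_fun setT (fun x : st * U => x.1.2)].
Proof.
have m1 : measurable_fun setT (fun x : st * U => x.1.1).
  exact: (measurableT_comp measurable_fst measurable_fst).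
have m11 : measurable_fun setT (fun x : st * U => x.1.1.1).
  exact: (measurableT_comp measurable_fst m1).
split; [exact: (measurableT_comp measurable_fst m11)
  |exact: (measurableT_comp measurable_snd m11)|exact: (measurableT_comp measurable_snd m1)|].
exact: (measurableT_comp measurable_snd measurable_fst).
Qed.

Lemma measurable_phi_kernel t lam : measurable_fun setT (phi_kernel M t lam).
Proof.
have -> : phi_kernel M t lam = fun x => (x.1.1.1.1, x.1.1.1.2,
   if x.1.2 then bayes (lam false * dens (O2 M) t false x.2)
     (lam true * dens (O2 M) t true x.2) x.1.1.2 else x.1.1.2, x.1.2).
  by apply/funext => -[[[[h x1] x2] D] y].
have [mh m1 m2 mD] := measurable_coordinates Y2.
have md h : measurable_fun setT (fun x : st * Y2 => lam h * dens (O2 M) t h x.2).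
  apply: measurable_funM => //; apply: measurableT_comp measurable_snd.
  exact: dens_measurable.
repeat apply: measurable_fun_pair => //.
by apply: measurable_fun_ifT => //; exact: measurable_bayes.
Qed.

Lemma measurable_psi_kernel t a : measurable_fun setT (psi_kernel M t a).
Proof.
have -> : psi_kernel M t a = fun x => (x.1.1.1.1,
   bayes (dens (O1 M) t.+1 false x.2) (dens (O1 M) t.+1 true x.2) x.1.1.1.2,
   x.1.1.2, x.1.2 && (rule2 a x.1.1.2 == None)).
  by apply/funext => -[[[[h x1] x2] D] y].
have [mh m1 m2 mD] := measurable_coordinates Y1.
have md h : measurable_fun setT (fun x : st * Y1 => dens (O1 M) t.+1 h x.2).
  by apply: measurableT_comp measurable_snd; exact: dens_measurable.
repeat apply: measurable_fun_pair => //.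
- exact: measurable_bayes.
- apply: measurable_and => //.
  apply: (@measurableT_comp _ _ _ _ _ _ (fun a : action => a == None)).
    exact: measurable_from_discrete.
  by apply: measurableT_comp m2; exact: measurable_rule2.
Qed.

(** The transition acting on functions: the expectation of [f] at the next state on the event that
    the message is [z], as a function of the present state. The message is a function of O1's
    belief, which makes the event a gate on the state. *)
Definition phi_pullback p t lam z (f : st -> \bar R) : st -> \bar R :=
  average (law (O2 M) t.+1) (fun x => if rule_O1 M p t.+1 x.1.1.1.2 == z
    then f (phi_kernel M t.+1 lam x) else 0%E).

Let measurable_gate p t lam z (f : st -> \bar R) : measurable_fun setT f ->
  measurable_fun setT (fun x : st * Y2 => if rule_O1 M p t.+1 x.1.1.1.2 == z
    then f (phi_kernel M t.+1 lam x) else 0%E).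
Proof.
move=> mf; apply: measurable_fun_ifT => //; last first.
  by apply: measurableT_comp => //; exact: measurable_phi_kernel.
apply: (@measurableT_comp _ _ _ _ _ _ (fun a : action => a == z)).
  exact: measurable_from_discrete.
have [_ m1 _ _] := measurable_coordinates Y2.
by apply: measurableT_comp m1; exact: measurable_rule_O1.
Qed.

Lemma measurable_phi_pullback p t lam z f : measurable_fun setT f ->
  (forall x, (0 <= f x)%E) -> measurable_fun setT (phi_pullback p t lam z f).
Proof.
move=> mf f0; apply: measurable_average; first exact: measurable_gate.
by move=> x; case: ifP.
Qed.

Lemma phi_pullback_ge0 p t lam z f s : (forall x, (0 <= f x)%E) ->
  (0 <= phi_pullback p t lam z f s)%E.
Proof. by move=> f0; apply: average_ge0 => x; case: ifP. Qed.

(* [lam h] is P(Z_{t+1} = z | O1 silent up to t, H = h).  It is a function of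
   the law of the state, so designs with proportional state laws share it. *)
Definition silence_ratio p t z (lam : bool -> R) : Prop :=
  (forall h, 0 <= lam h) /\
  forall h, P (hyp_set M h `&` silentZ p t z) =
     ((lam h)%:E * P (hyp_set M h `&` silent1 p t))%E.

Lemma integral_phi p t z lam f : (t < T1)%N -> silence_ratio p t z lam ->
  measurable_fun setT f -> (forall x, (0 <= f x)%E) ->
  (\int[P]_(w in silentZ p t z) f (stt p t.+1 t.+1 w) =
   \int[P]_(w in silent1 p t) phi_pullback p t lam z f (stt p t.+1 t w))%E.
Proof.
move=> tT [lam0 lamE] mf f0.
have tT2 : (t < T2)%N by exact: leq_trans (T1_le_T2 M).
have mst : measurable_fun setT (stt p t.+1 t).
  by apply: measurable_state; rewrite // ?ltnS ltnW.
have mst' : measurable_fun setT (stt p t.+1 t.+1).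
  by apply: measurable_state; rewrite // ?ltnS ltnW.
have mpair : measurable_fun setT (fun w => (stt p t.+1 t w, obs2 M t.+1 w)).
  by apply: measurable_fun_pair => //; exact: obs2_measurable.
have mphi : measurable_fun setT
    (fun w => f (phi_kernel M t.+1 lam (stt p t.+1 t w, obs2 M t.+1 w))).
  apply: measurableT_comp => //.
  exact: (measurableT_comp (@measurable_phi_kernel t.+1 lam)).
rewrite (@ge0_ae_eq_integral _ _ _ _ _ _
  (fun w => f (phi_kernel M t.+1 lam (stt p t.+1 t w, obs2 M t.+1 w)))).
- rewrite -integral_obs2//; last 2 first.
  + exact: measurable_gate.
  + by move=> x; case: ifP.
  rewrite integral_mkcondr; apply: eq_integral => w /set_mem sw.
  rewrite patchE /= {1}/state /= -Z1_silent//.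
  by case: ifPn => [/set_mem /= ->|/negP zw]; rewrite ?eqxx// ifF//;
     apply/negP => /eqP zw'; apply: zw; apply/mem_set.
- exact: measurable_silentZ.
- by apply/measurable_funTS; exact: measurableT_comp.
- exact: measurable_funTS.
- by [].
- by [].
- have := @phi_update _ _ _ _ _ _ _ M W p t z lam tT lam0 lamE.
  by apply: filterS => w H sw; rewrite H.
Qed.

Definition psi_pullback t a (f : st -> \bar R) : st -> \bar R :=
  average (law (O1 M) t.+1) (fun x => f (psi_kernel M t a x)).

Lemma measurable_psi_pullback t a f : measurable_fun setT f ->
  (forall x, (0 <= f x)%E) -> measurable_fun setT (psi_pullback t a f).
Proof.
move=> mf f0; apply: measurable_average => //.
exact: (measurableT_comp mf (@measurable_psi_kernel t a)).
Qed.

Lemma integral_psi p t f : (t.+1 < T1)%N ->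
  measurable_fun setT f -> (forall x, (0 <= f x)%E) ->
  (\int[P]_(w in silent1 p t.+1) f (stt p t.+2 t.+1 w) =
   \int[P]_(w in silent1 p t.+1)
     psi_pullback t.+1 (thr_O2 p t.+1) f (stt p t.+1 t.+1 w))%E.
Proof.
move=> tT mf f0; have tT2 : (t.+1 < T2)%N by exact: leq_trans (T1_le_T2 M).
have mst : measurable_fun setT (stt p t.+2 t.+1).
  by apply: measurable_state; rewrite ltnW.
have mst' : measurable_fun setT (stt p t.+1 t.+1).
  by apply: measurable_state; [exact: leqW (ltnW tT2)|exact: ltnW].
have mk : measurable_fun setT (fun x => f (psi_kernel M t.+1 (thr_O2 p t.+1) x)).
  exact: (measurableT_comp mf (@measurable_psi_kernel _ _)).
rewrite (@ge0_ae_eq_integral _ _ _ _ _ _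
  (fun w => f (psi_kernel M t.+1 (thr_O2 p t.+1) (stt p t.+1 t.+1 w, obs1 M t.+2 w)))).
- by rewrite (@integral_obs1 p t (fun x => f (psi_kernel M t.+1 (thr_O2 p t.+1) x))).
- by apply: measurable_silent; exact: ltnW.
- by apply/measurable_funTS; exact: measurableT_comp.
- apply/measurable_funTS; apply: (measurableT_comp mk).
  by apply: measurable_fun_pair => //; exact: obs1_measurable.
- by [].
- by [].
- have := @psi_update _ _ _ _ _ _ _ M W p t tT.
  by apply: filterS => w H sw; rewrite H.
Qed.

Section Transfer.
Variables (p q : design R) (r : R).
Hypothesis r_gt0 : 0 < r.

Lemma scaled_measure E F (X Y : Omega -> st) (A : set st) :
  measurable E -> measurable F -> measurable_fun setT X ->
  measurable_fun setT Y -> measurable A -> scaled P r E F X Y ->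
  P (X @^-1` A `&` E) = (r%:E * P (Y @^-1` A `&` F))%E.
Proof.
move=> mE mF mX mY mA /(_ (fun x => (\1_A x)%:E)).
rewrite -(@integral_indic _ _ _ P E _ (X @^-1` A))//; last exact: measurable_preimageT.
rewrite -(@integral_indic _ _ _ P F _ (Y @^-1` A))//; last exact: measurable_preimageT.
apply; first exact/measurable_EFinP/measurable_indic.
by move=> x; rewrite lee_fin.
Qed.

(** Both events defining the ratio, O1 silent and O1 then sending [z], intersected with H = h, are
    conditions on the state. Their probabilities under [p] are thus [r] times those under [q], and
    [r] cancels from the quotient. *)
Lemma ratio_transfer t z : (t < T1)%N ->
  rule_O1 M p t.+1 = rule_O1 M q t.+1 ->
  scaled P r (silent1 p t) (silent1 q t) (stt p t.+1 t) (stt q t.+1 t) ->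
  exists lam, silence_ratio p t z lam /\ silence_ratio q t z lam.
Proof.
move=> tT rpq sc; have tT2 : (t < T2)%N by exact: leq_trans (T1_le_T2 M).
have mst u : measurable_fun setT (stt u t.+1 t).
  by apply: measurable_state; rewrite // ?ltnS ltnW.
have ms u : measurable (silent1 u t) by apply: measurable_silent; exact: ltnW.
have mH h := measurable_hyp_set M h.
pose A h := [set s : st | s.1.1.1 = h].
have m11 : measurable_fun setT (fun x : st => x.1.1).
  exact: (measurableT_comp measurable_fst measurable_fst).
have mA h : measurable (A h).
  rewrite (_ : A h = (fun s : st => s.1.1.1) @^-1` [set h])//.
  by apply: measurable_preimageT => //; exact: (measurableT_comp measurable_fst m11).
pose B := [set s : st | rule_O1 M p t.+1 s.1.1.2 = z].
have mB : measurable B.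
  rewrite (_ : B = (fun s : st => rule_O1 M p t.+1 s.1.1.2) @^-1` [set z])//.
  apply: (@measurable_preimageT _ _ _ _ (fun s : st => rule_O1 M p t.+1 s.1.1.2)) => //.
  apply: measurableT_comp; first exact: measurable_rule_O1.
  exact: (measurableT_comp measurable_snd m11).
have FE u h : stt u t.+1 t @^-1` A h `&` silent1 u t = hyp_set M h `&` silent1 u t by [].
have EE u h : rule_O1 M u t.+1 = rule_O1 M p t.+1 ->
    stt u t.+1 t @^-1` (A h `&` B) `&` silent1 u t = hyp_set M h `&` silentZ u t z.
  move=> ru; apply/seteqP; split => w /=.
    move=> [[Hw Bw] sw]; split => //; split => //=; rewrite Z1_silent// ru.
    exact: Bw.
  by move=> [Hw [sw zw]]; split => //; split => //; rewrite /B/= -ru -Z1_silent.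
have Fpq h : P (hyp_set M h `&` silent1 p t) = (r%:E * P (hyp_set M h `&` silent1 q t))%E.
  by rewrite -!FE; apply: scaled_measure.
have Epq h : P (hyp_set M h `&` silentZ p t z) = (r%:E * P (hyp_set M h `&` silentZ q t z))%E.
  by rewrite -!EE//; apply: scaled_measure => //; exact: measurableI.
pose lam h := fine (P (hyp_set M h `&` silentZ p t z)) / fine (P (hyp_set M h `&` silent1 p t)).
have mE u : measurable (silentZ u t z) by exact: measurable_silentZ.
have fin h E : measurable E -> P (hyp_set M h `&` E) \is a fin_num.
  by move=> mE'; apply: fin_num_measure; exact: measurableI.
have lam0 h : 0 <= lam h by rewrite divr_ge0// fine_ge0.
have lamp h : P (hyp_set M h `&` silentZ p t z) =
    ((lam h)%:E * P (hyp_set M h `&` silent1 p t))%E.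
  rewrite -(fineK (fin h _ (mE p))) -[X in (_ * X)%E](fineK (fin h _ (ms p))) -EFinM.
  (* When silence has probability zero under [h], the quotient is irrelevant: the smaller event has
     probability zero as well. *)
  rewrite /lam; have [F0|F0] := eqVneq (fine (P (hyp_set M h `&` silent1 p t))) 0.
    rewrite F0 mulr0; congr (_%:E); apply/eqP; rewrite eq_le fine_ge0// andbT -F0.
    apply: fine_le; [exact: fin|exact: fin|].
    apply: le_measure; rewrite ?inE//; [exact: measurableI|exact: measurableI|].
    by move=> w [? []].
  by rewrite divfK.
exists lam; split; split => // h.
have r0 : r%:E != 0%E by rewrite eqe gt_eqF.
have : (r%:E * P (hyp_set M h `&` silentZ q t z) =
        r%:E * ((lam h)%:E * P (hyp_set M h `&` silent1 q t)))%E.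
  by rewrite -Epq lamp Fpq muleCA.
move=> /(congr1 (fun x => (r%:E)^-1 * x)%E).
by rewrite !muleA mulVe ?mul1e.
Qed.

(** With the rule at [t.+1] and [lam] in common, both designs have the same pullback, to which the
    assumed proportionality applies. *)
Lemma phi_scaled t z : (t < T1)%N ->
  rule_O1 M p t.+1 = rule_O1 M q t.+1 ->
  scaled P r (silent1 p t) (silent1 q t) (stt p t.+1 t) (stt q t.+1 t) ->
  scaled P r (silentZ p t z) (silentZ q t z) (stt p t.+1 t.+1) (stt q t.+1 t.+1).
Proof.
move=> tT rpq sc; have [lam [lp lq]] := ratio_transfer z tT rpq sc.
move=> f mf f0; rewrite (integral_phi tT lp)// (integral_phi tT lq)//.
rewrite (_ : phi_pullback q t lam z f = phi_pullback p t lam z f); last first.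
  by rewrite /phi_pullback rpq.
by apply: sc; [exact: measurable_phi_pullback|move=> x; exact: phi_pullback_ge0].
Qed.

Lemma psi_scaled t : (t.+1 < T1)%N -> thr_O2 p t.+1 = thr_O2 q t.+1 ->
  scaled P r (silent1 p t.+1) (silent1 q t.+1) (stt p t.+1 t.+1) (stt q t.+1 t.+1) ->
  scaled P r (silent1 p t.+1) (silent1 q t.+1) (stt p t.+2 t.+1) (stt q t.+2 t.+1).
Proof.
move=> tT tpq sc f mf f0; rewrite !integral_psi// tpq.
by apply: sc; [exact: measurable_psi_pullback|move=> x; exact: average_ge0].
Qed.

End Transfer.
End StateLaws.

(** * The Wald phase *)

Section WaldPhase.
Context (R : realType) (d d1 d2 : measure_display)
  (Omega : measurableType d) (Y1 : measurableType d1)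
  (Y2 : measurableType d2) (M : problem R Omega Y1 Y2).

Local Notation P := (Pr M).
Local Notation T1 := (T1 M).
Local Notation T2 := (T2 M).

Definition cost2 (g1 : strategy1 Y1) (g2 : strategy2 Y2) (w : Omega) : R :=
  c2 M * (tau2 M g1 g2 w)%:R + loss M (decision M g1 g2 w) (hyp M w).

Lemma loss_ge0 u h : 0 <= loss M u h.
Proof. by have /andP[] := loss_bounds M u h. Qed.

Lemma cost2_ge0 g1 g2 w : 0 <= cost2 g1 g2 w.
Proof. by rewrite addr_ge0 ?loss_ge0// mulr_ge0// ltW// c2_gt0. Qed.

Lemma tau2_le g1 g2 w : (tau2 M g1 g2 w <= T2.+1)%N.
Proof. by rewrite /tau2 /stop_time ltnS -[X in (_ <= X)%N](size_iota 1) find_size. Qed.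

Lemma tau2_stop g1 g2 t u w : (0 < t)%N -> (t <= T2)%N -> (t <= tau2 M g1 g2 w)%N ->
  act2 M g1 g2 t w = Some u ->
  tau2 M g1 g2 w = t /\ decision M g1 g2 w = u.
Proof.
move=> t0 tT tt au; have tauE : tau2 M g1 g2 w = t.
  apply/eqP; rewrite eqn_leq tt andbT leqNgt leq_tau2 ?ltnS//.
  by rewrite -(prednK t0) /= quiet2S prednK// au andbF.
by split=> //; rewrite /decision tauE au.
Qed.

Lemma tau2_continue g1 g2 t w : (0 < t)%N -> (t <= T2)%N -> (t <= tau2 M g1 g2 w)%N ->
  act2 M g1 g2 t w = None -> (t < tau2 M g1 g2 w)%N.
Proof.
move=> t0 tT tt an; rewrite leq_tau2 ?ltnS//= -(prednK t0) quiet2S.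
by move: tt; rewrite leq_tau2 ?(leqW tT)// => ->; rewrite prednK// an eqxx.
Qed.

Definition later t k (w : Omega) : k.-tuple Y2 :=
  [tuple obs2 M (t + i.+1)%N w | i < k].

Lemma laterS t k w : later t k.+1 w = [tuple of rcons (later t k w) (obs2 M (t + k.+1)%N w)].
Proof. exact: (historyS k (fun i => obs2 M (t + i)%N) w). Qed.

Lemma past_later m n t k : (t + k <= n)%N -> measurable_fun setT (later t k : past M m n -> _).
Proof.
move=> tn; apply/measurable_fun_tnthP => i.
rewrite (_ : _ \o _ = obs2 M (t + i.+1)%N); last first.
  by apply/funext => w; rewrite /= tnth_mktuple.
apply: past_obs2; rewrite addnS /= (leq_trans _ tn)//.
by rewrite -addnS leq_add2l.
Qed.

Lemma later0 t w : later t 0 w = [tuple].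
Proof. by rewrite tuple0. Qed.

Lemma wald_cost_from_ge0 t r h n k y : (0 <= @wald_cost_from _ _ _ _ _ _ _ M t r h n k y)%E.
Proof.
elim: n k y => [|n IH] k y /=; case: (r k y) => [u|//]; rewrite ?lee_fin ?loss_ge0//.
by rewrite adde_ge0 ?lee_fin ?(ltW (c2_gt0 M))//; apply: integral_ge0.
Qed.

Section Family.
Context dS (S : measurableType dS).
Variable rho : S -> wald_policy Y2.
Hypothesis mrho : forall k, measurable_fun setT (fun x : S * k.-tuple Y2 => @rho x.1 k x.2).

Let measurable_rho_pre k a : measurable ((fun x : S * k.-tuple Y2 => @rho x.1 k x.2) @^-1` [set a]).
Proof. exact: (measurable_preimageT (@mrho k)). Qed.

(** Measurability is joint in the index of the policy and the measurements: the policy followed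
    after the arrival depends on O2's information at that time. *)
Lemma measurable_wald_cost_from t h n k :
  measurable_fun setT (fun x : S * k.-tuple Y2 => wald_cost_from M t (rho x.1) h n x.2).
Proof.
elim: n k => [|n IH] k.
  rewrite (_ : (fun _ => _) = fun x => (fun (a : option bool) (_ : S * k.-tuple Y2) =>
      if a is Some u then (loss M u h)%:E else +oo%E) (@rho x.1 k x.2) x).
    apply: (@measurable_fun_case _ _ _ _ (option bool)
      (fun x : S * k.-tuple Y2 => @rho x.1 k x.2)
      (fun a _ => if a is Some u then (loss M u h)%:E else +oo%E)).
      exact: measurable_rho_pre.
    by case=> [u|]; exact: measurable_cst.
  by apply/funext => x /=; case: (rho _ _).
rewrite (_ : (fun _ => _) = fun x => (fun (a : option bool) (x : S * k.-tuple Y2) =>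
    if a is Some u then (loss M u h)%:E else
    ((c2 M)%:E + \int[law (O2 M) (t + k.+1)%N h]_y
        wald_cost_from M t (rho x.1) h n [tuple of rcons x.2 y])%E) (@rho x.1 k x.2) x);
    last by apply/funext => x /=; case: (rho _ _).
apply: (@measurable_fun_case _ _ _ _ (option bool)
  (fun x : S * k.-tuple Y2 => @rho x.1 k x.2)
  (fun a (x : S * k.-tuple Y2) => if a is Some u then (loss M u h)%:E else
    ((c2 M)%:E + \int[law (O2 M) (t + k.+1)%N h]_y
        wald_cost_from M t (rho x.1) h n [tuple of rcons x.2 y])%E)).
  exact: measurable_rho_pre.
case=> [u|//]; first exact: measurable_cst.
apply: emeasurable_funD => //.
apply: (@measurable_fun_fubini_tonelli_F _ _ _ _ _ (law (O2 M) (t + k.+1)%N h)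
  (fun z : (S * k.-tuple Y2) * Y2 =>
    wald_cost_from M t (rho z.1.1) h n [tuple of rcons z.1.2 z.2])).
  have mp : measurable_fun setT
      (fun x : (S * k.-tuple Y2) * Y2 => (x.1.1, [tuple of rcons x.1.2 x.2])).
    apply: measurable_fun_pair; first exact: (measurableT_comp measurable_fst measurable_fst).
    apply: measurable_tuple_rcons => //.
    exact: (measurableT_comp measurable_snd measurable_fst).
  exact: (measurableT_comp (IH k.+1) mp).
by move=> x; exact: wald_cost_from_ge0.
Qed.

Variables (t : nat) (xi : Omega -> S) (E : set Omega).
Variables (g1 : strategy1 Y1) (g2 : strategy2 Y2).
Hypotheses (t_gt0 : (0 < t)%N) (tT : (t <= T2)%N).
Hypothesis mxi : measurable_fun setT (xi : past M T1 t -> S).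
Hypothesis mE : measurable (E : set (past M T1 t)).
Hypothesis rho_stop : forall s y, @rho s (T2 - t)%N y <> None.
Hypothesis E_tau2 : forall w, E w -> (t <= tau2 M g1 g2 w)%N.
Hypothesis act2_rho : {ae P, forall w, E w -> forall k, (k <= T2 - t)%N ->
  (t + k <= tau2 M g1 g2 w)%N -> act2 M g1 g2 (t + k) w = rho (xi w) (later t k w)}.
Hypothesis mcost2 : measurable_fun setT (cost2 g1 g2).

Let pending k w := all (fun j => rho (xi w) (later t j w) == None) (iota 0 k).

Let pendingS k w : pending k.+1 w = pending k w && (rho (xi w) (later t k w) == None).
Proof. by rewrite /pending -(addn1 k) iotaD all_cat /= andbT add0n. Qed.

Let past_weaken n n' (A : set Omega) : (n <= n')%N ->
  measurable (A : set (past M T1 n)) -> measurable (A : set (past M T1 n')).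
Proof.
move=> nn; apply: smallest_sub; first exact: (@sigma_algebra_measurable _ (past M T1 n')).
move=> _ [A' [B' [mA' mB' ->]]]; apply: sub_sigma_algebra.
exists A', (fun t => if (t <= n)%N then B' t else setT); split => //.
  by move=> s; case: ifP.
apply/seteqP; split => w /= [Aw Bw]; split => // s /andP[s1 sn].
  by case: ifP => // sn'; apply: Bw; rewrite s1.
by have := Bw s; rewrite s1 (leq_trans sn nn) sn; exact.
Qed.

Let past_xi k : measurable_fun setT (xi : past M T1 (t + k) -> S).
Proof.
move=> _ B mB; rewrite setTI; apply: (past_weaken (leq_addr k t)).
exact: (measurable_preimageT mxi mB).
Qed.

Let past_rho k n : (k <= n)%N -> measurable_fun setT
  ((fun w => rho (xi w) (later t k w)) : past M T1 (t + n) -> action).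
Proof.
move=> kn; have mp : measurable_fun setT
    ((fun w => (xi w, later t k w)) : past M T1 (t + n) -> S * k.-tuple Y2).
  apply: measurable_fun_pair; first exact: past_xi.
  by apply: past_later; rewrite leq_add2l.
exact: (measurableT_comp (@mrho k) mp).
Qed.

Let past_pending k : measurable (E `&` [set w | pending k w] : set (past M T1 (t + k))).
Proof.
apply: measurableI; first exact: past_weaken (leq_addr k t) _.
apply: (@measurable_holds _ (past M T1 (t + k))).
apply: (@measurable_all nat _ (past M T1 (t + k)) (iota 0 k)
  (fun j w => rho (xi w) (later t j w) == None)) => j; rewrite mem_iota add0n => /ltnW jI.
apply: (@measurableT_comp _ _ _ _ _ _ (fun a : action => a == None)).
  exact: measurable_from_discrete.
exact: past_rho.
Qed.

Let pending_tau2 k w : (k <= T2 - t)%N ->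
  (forall k, (k <= T2 - t)%N -> (t + k <= tau2 M g1 g2 w)%N ->
     act2 M g1 g2 (t + k) w = rho (xi w) (later t k w)) ->
  E w -> pending k w -> (t + k <= tau2 M g1 g2 w)%N.
Proof.
move=> + H Ew; elim: k => [_ _|k IH kT]; first by rewrite addn0 E_tau2.
rewrite pendingS => /andP[/(IH (ltnW kT)) tk /eqP rk].
rewrite addnS; apply: tau2_continue => //.
- by rewrite addn_gt0 t_gt0.
- by rewrite -leq_subRL// ltnW.
- by rewrite H// ltnW.
Qed.

(** Induction on the number [n] of measurements left. Where the policy stops, the two integrands
    agree almost everywhere; where it continues, the induction hypothesis applies after one more
    observation, which is then integrated out by independence. *)
Let cost_pending h n k : (k + n)%N = (T2 - t)%N ->
  (\int[P]_(w in hyp_set M h `&` (E `&` [set w | pending k w])) (cost2 g1 g2 w)%:E =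
   \int[P]_(w in hyp_set M h `&` (E `&` [set w | pending k w]))
     ((c2 M * (t + k)%:R)%:E + wald_cost_from M t (rho (xi w)) h n (later t k w)))%E.
Proof.
have mH := measurable_hyp_set M h.
have mEc k' : d.-measurable (E `&` [set w | pending k' w]).
  by apply: (@measurable_past _ _ _ _ _ _ _ M T1 (t + k')); exact: past_pending.
have mV D : measurable_fun D (fun w => (cost2 g1 g2 w)%:E).
  by apply: measurable_funTS; exact/measurable_EFinP.
have mwald n' k' : measurable_fun setT (fun w =>
    ((c2 M * (t + k')%:R)%:E + wald_cost_from M t (rho (xi w)) h n' (later t k' w))%E).
  apply: emeasurable_funD => //.
  have mp : measurable_fun setT ((fun w => (xi w, later t k' w)) : Omega -> S * k'.-tuple Y2).
    apply: (@measurable_fun_past _ _ _ _ _ _ _ M T1 (t + k')).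
    by apply: measurable_fun_pair; [exact: past_xi|exact: past_later].
  exact: (measurableT_comp (@measurable_wald_cost_from t h n' k') mp).
have c0 k' : (0 <= (c2 M * (t + k')%:R)%:E)%E.
  by rewrite lee_fin mulr_ge0// ltW// c2_gt0.
have wald0 n' k' w : (0 <= (c2 M * (t + k')%:R)%:E +
    wald_cost_from M t (rho (xi w)) h n' (later t k' w))%E.
  by rewrite adde_ge0// wald_cost_from_ge0.
elim: n k => [|n IH] k kn.
  apply: ge0_ae_eq_integral => //.
  - exact: measurableI.
  - exact: measurable_funTS.
  - by move=> w _; rewrite lee_fin cost2_ge0.
  apply: filterS act2_rho => w H [Hw [Ew pw]].
  have kT : (k <= T2 - t)%N by rewrite -kn addn0.
  have tk := @pending_tau2 k w kT (H Ew) Ew pw.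
  have ak := H Ew k kT tk.
  have tkT : (t + k <= T2)%N by rewrite -leq_subRL// kT.
  have kE : k = (T2 - t)%N by rewrite -kn addn0.
  (* With no measurement left, [k] is [T2 - t], where the policy must stop; the value +oo is never
     met. *)
  case E1 : (rho (xi w) (later t k w)) ak => [u|] ak; last first.
    by move: E1; rewrite kE; move/rho_stop.
  have [tE dE] := @tau2_stop g1 g2 _ u w (leq_trans t_gt0 (leq_addr k t)) tkT tk ak.
  by rewrite /= E1 /cost2 tE dE Hw EFinD.
pose A := E `&` [set w | pending k w] `&` [set w | rho (xi w) (later t k w) != None].
have kT : (k < T2 - t)%N by rewrite -kn -addSnnS leq_addr.
have tkT : (t + k < T2)%N by rewrite -addnS -leq_subRL.
have mA : measurable A.
  apply: measurableI => //.
  rewrite (_ : mkset _ = (fun w => rho (xi w) (later t k w)) @^-1` [set a | a != None])//.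
  apply: (@measurable_preimageT _ _ _ _ (fun w => rho (xi w) (later t k w))) => //.
  exact: (measurable_fun_past (past_rho (leqnn k))).
have split_pending : hyp_set M h `&` (E `&` [set w | pending k w]) =
    (hyp_set M h `&` A) `|` (hyp_set M h `&` (E `&` [set w | pending k.+1 w])).
  apply/seteqP; split => w /=.
    move=> [Hw [Ew pw]]; case: (eqVneq (rho (xi w) (later t k w)) None) => e.
      by right; split => //; split => //=; rewrite pendingS pw e.
    by left.
  by move=> [[Hw [[Ew pw] _]]|[Hw [Ew]]] //=; rewrite pendingS => /andP[].
have disj : [disjoint hyp_set M h `&` A & hyp_set M h `&` (E `&` [set w | pending k.+1 w])].
  apply/disj_setPS => w [[_ [_ /= a]] [_ [_ /=]]]; rewrite pendingS => /andP[_ b].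
  by rewrite b in a.
rewrite split_pending !ge0_integral_setU//; first last.
- by move=> w _; rewrite lee_fin cost2_ge0.
- exact: measurableI.
- exact: measurableI.
- exact: measurable_funTS.
- exact: measurableI.
- exact: measurableI.
congr (_ + _)%E.
  apply: ge0_ae_eq_integral => //.
  - exact: measurableI.
  - exact: measurable_funTS.
  - by move=> w _; rewrite lee_fin cost2_ge0.
  apply: filterS act2_rho => w H [Hw [[Ew pw] /= nw]].
  have tk := @pending_tau2 k w (ltnW kT) (H Ew) Ew pw.
  have ak := H Ew k (ltnW kT) tk.
  case E1 : (rho (xi w) (later t k w)) nw ak => [u|//] _ ak.
  have [tE dE] := @tau2_stop g1 g2 _ u w (leq_trans t_gt0 (leq_addr k t)) (ltnW tkT) tk ak.
  by rewrite /cost2 tE dE Hw EFinD.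
rewrite IH; last by rewrite addSnnS.
pose K (x : (S * k.-tuple Y2) * Y2) := ((c2 M * (t + k.+1)%:R)%:E +
  wald_cost_from M t (rho x.1.1) h n [tuple of rcons x.1.2 x.2])%E.
have mwK : measurable_fun setT (fun x : (S * k.-tuple Y2) * Y2 =>
    wald_cost_from M t (rho x.1.1) h n [tuple of rcons x.1.2 x.2]).
  have mp : measurable_fun setT
      (fun x : (S * k.-tuple Y2) * Y2 => (x.1.1, [tuple of rcons x.1.2 x.2])).
    apply: measurable_fun_pair; first exact: (measurableT_comp measurable_fst measurable_fst).
    apply: measurable_tuple_rcons => //.
    exact: (measurableT_comp measurable_snd measurable_fst).
  exact: (measurableT_comp (@measurable_wald_cost_from t h n k.+1) mp).
have mK : measurable_fun setT K by exact: emeasurable_funD.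
have K0 x : (0 <= K x)%E by rewrite adde_ge0// wald_cost_from_ge0.
(* Whether a further measurement is taken is decided from the first [k] ones. This makes the event
   measurable in the past of the observation at [t + k.+1], hence independent of that observation
   given H. *)
have mpend : measurable (E `&` [set w | pending k.+1 w] : set (past M T1 (t + k))).
  rewrite (_ : _ `&` _ = (E `&` [set w | pending k w]) `&`
    ((fun w => rho (xi w) (later t k w)) @^-1` [set None])); last first.
    apply/seteqP; split => w /=; rewrite pendingS.
      by move=> [Ew /andP[pw /eqP e]].
    by move=> [[Ew pw] e]; rewrite pw e.
  apply: measurableI; first exact: past_pending.
  exact: (@measurable_preimageT _ (past M T1 (t + k)) _ _ _ (past_rho (leqnn k))).
have mX : measurable_fun setT ((fun w => (xi w, later t k w)) : past M T1 (t + k) -> _).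
  by apply: measurable_fun_pair; [exact: past_xi|exact: past_later].
have := @joint_obs2 _ _ _ _ _ _ _ M h T1 (t + k) _ _ _ _ K (leqnn _) tkT mpend mX mK K0.
rewrite -addnS => JK.
transitivity (\int[P]_(w in hyp_set M h `&` (E `&` [set w | pending k.+1 w]))
   K ((xi w, later t k w), obs2 M (t + k.+1)%N w))%E.
  by apply: eq_integral => w _; rewrite laterS.
rewrite JK; apply: eq_integral => w /set_mem[_ [_ /=]].
rewrite pendingS => /andP[_ /eqP e]; rewrite e /K /=.
rewrite ge0_integralD//; last 2 first.
- by move=> y _; exact: wald_cost_from_ge0.
- exact: (measurableT_comp mwK (pair1_measurable (xi w, later t k w))).
set c := (c2 M * (t + k.+1)%:R)%R.
have -> : (\int[law (O2 M) (t + k.+1)%N h]_(y in setT) c%:E = c%:E)%E.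
  transitivity (c%:E * law (O2 M) (t + k.+1)%N h setT)%E; first exact: integral_cst.
  by rewrite probability_setT mule1.
have -> : c%:E = ((c2 M * (t + k)%:R)%:E + (c2 M)%:E)%E.
  by rewrite -EFinD /c addnS -natr1 mulrDr mulr1.
by rewrite -addeA.
Qed.

(* On E, from time t on, O2 follows the policy [rho s], where s is the value of
   xi, which is determined by the observations up to time t. *)
Lemma integral_wald_phase h :
  (\int[P]_(w in hyp_set M h `&` E) (cost2 g1 g2 w)%:E =
   \int[P]_(w in hyp_set M h `&` E)
     ((c2 M * t%:R)%:E + wald_cost_from M t (rho (xi w)) h (T2 - t) [tuple]))%E.
Proof.
have := @cost_pending h (T2 - t)%N 0%N (add0n _).
have -> : E `&` [set w | pending 0 w] = E by apply/seteqP; split => w //= [].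
move=> ->; rewrite addn0; apply: eq_integral => w _; by rewrite later0.
Qed.

End Family.
End WaldPhase.

(** * The Wald phase started by O1's message *)

Section Arrival.
Context (R : realType) (d d1 d2 : measure_display)
  (Omega : measurableType d) (Y1 : measurableType d1)
  (Y2 : measurableType d2) (M : problem R Omega Y1 Y2).
Variable W : nat -> nat -> thr2 R.

Local Notation P := (Pr M).
Local Notation T1 := (T1 M).
Local Notation T2 := (T2 M).
Local Notation silent1 p t := (silent M (gamma1 M p) t).
Local Notation silentZ p t z :=
  (silent1 p t `&` [set w | Z1 M (gamma1 M p) t.+1 w = z]).
Local Notation G1 := (gamma1 M).

Lemma measurable_cost2 p (g2 : strategy2 Y2) : (forall t, measurable_fun setT (@g2 t)) ->
  measurable_fun setT (cost2 M (G1 p) g2).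
Proof.
move=> mg2.
have ml i : measurable_fun setT (fun w => (i <= tau2 M (G1 p) g2 w)%N).
  have [iT|Ti] := leqP i T2.+1.
    apply: (@measurable_leq_tau2 _ _ _ _ _ _ _ M _ Omega id T1 i) => //.
    - by move=> s _; exact: obs1_measurable.
    - by move=> s _; exact: obs2_measurable.
    - exact: geq_minr.
    - exact: leq_pred.
  rewrite (_ : (fun _ => _) = cst false)//; apply/funext => w /=; apply/negbTE.
  by rewrite -ltnNge (leq_ltn_trans (tau2_le _ _ _ _) Ti).
apply: (@measurable_fun_case _ _ _ _ nat (tau2 M (G1 p) g2) (fun i w =>
  c2 M * i%:R + loss M (odflt false (act2 M (G1 p) g2 i w)) (hyp M w))) => i.
  exact: measurable_nat_level.
apply: measurable_funD => //.
apply: (@measurable_fun_case _ _ _ _ (option bool) (act2 M (G1 p) g2 i)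
  (fun a w => loss M (odflt false a) (hyp M w))) => a.
  apply: measurable_preimageT => //.
  apply: (@measurable_act2 _ _ _ _ _ _ _ M _ Omega id T1 i) => //.
  - by move=> s _; exact: obs1_measurable.
  - by move=> s _; exact: obs2_measurable.
  - exact: measurable_gamma1.
  - exact: gamma1_stop.
  - exact: geq_minr.
apply: measurableT_comp (hyp_measurable M); exact: measurable_from_bool.
Qed.

Section AfterArrival.
Variables (p : design R) (t0 : nat) (b : bool).
Hypothesis t0T : (t0 < T1)%N.
Let g1 := gamma1 M p.
Let E0 := silentZ p t0 (Some b).

Lemma arrival_tau1 w : E0 w -> tau1 M g1 w = t0.+1.
Proof.
move=> [_ /= zw].
have tt : (t0.+1 <= tau1 M g1 w)%N by move: zw; rewrite /Z1; case: ifP.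
have aw : act1 M g1 t0.+1 w = Some b by move: zw; rewrite /Z1 tt.
apply/eqP; rewrite eqn_leq tt andbT leqNgt leq_tau1 ?ltnS//.
by rewrite /= quiet1S aw andbF.
Qed.

(** The message record left by the arrival of [b] at time [t0.+1]. Index [i] of a history holds time
    [i.+1], hence the test against [t0]. *)
Definition arrival_history n : n.-tuple action :=
  [tuple (if (i : nat) == t0 then Some b else None) | i < n].

Lemma arrival_historyP n w : (t0 < n)%N ->
  (history (Z1 M g1) n w = arrival_history n) <-> E0 w.
Proof.
move=> tn; split => [hw|Ew].
  have H i (lt_in : (i < n)%N) : Z1 M g1 i.+1 w = if i == t0 then Some b else None.
    have := congr1 (fun s => tnth s (Ordinal lt_in)) hw.
    by rewrite !tnth_mktuple.
  split; last by rewrite /= H// eqxx.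
  move=> s /andP[s0 st]; rewrite -(prednK s0) H.
    by rewrite ltn_eqF// prednK.
  by rewrite prednK// (leq_trans st)// ltnW.
apply: eq_from_tnth => i; rewrite !tnth_mktuple.
case: (ltngtP i t0) => it; last by rewrite it; exact: Ew.2.
  by apply: Ew.1; rewrite /= it.
by rewrite /Z1 (arrival_tau1 Ew) ltnS leqNgt it.
Qed.

Lemma tuple_init_arrival n : tuple_init (arrival_history n.+1) = arrival_history n.
Proof. by apply: eq_from_tnth => i; rewrite !tnth_mktuple. Qed.

Lemma received_arrival n : (t0 < n)%N -> received (arrival_history n) /\
  arrival (arrival_history n) = t0.+1.
Proof.
move=> tn.
have F : find (fun m : action => m != None) (arrival_history n) = t0.
  apply/eqP; rewrite eqn_leq; apply/andP; split.
    rewrite leqNgt; apply/negP => /(before_find None).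
    by rewrite -(tnth_nth None (arrival_history n) (Ordinal tn)) tnth_mktuple eqxx.
  rewrite leqNgt; apply/negP => lt0.
  have lt1 := ltn_trans lt0 tn.
  have : has (fun m : action => m != None) (arrival_history n).
    by rewrite has_find size_tuple.
  move=> /(nth_find None).
  rewrite -(tnth_nth None (arrival_history n) (Ordinal lt1)) tnth_mktuple /=.
  by rewrite ltn_eqF.
by rewrite /received /arrival F has_find F size_tuple.
Qed.

Lemma act2_arrival n w : (t0 < n)%N -> E0 w ->
  act2 M g1 (gamma2 M W p) n w =
  wald_rule M (W t0.+1) n (belief2 M g1 (info2 M g1 n w)).
Proof.
move=> tn Ew; rewrite /act2 /gamma2.
have -> : (info2 M g1 n w).2 = arrival_history n by exact: (arrival_historyP w tn).2.
by have [-> ->] := received_arrival tn.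
Qed.

(** After the final message the padding is certain: the record is fixed on [E0] whatever its length.
    The message factor is therefore 1 under both hypotheses, and only O2's own observation
    counts. *)
Lemma belief2_after n : (t0 < n)%N -> (n < T2)%N ->
  {ae P, forall w, E0 w ->
    let a h := dens (O2 M) n.+1 h (obs2 M n.+1 w) in
    let x := belief2 M g1 (info2 M g1 n w) in
    x * a false + (1 - x) * a true != 0 /\
    belief2 M g1 (info2 M g1 n.+1 w) = bayes (a false) (a true) x}.
Proof.
move=> tn nT.
have H := @belief2_update _ _ _ _ _ _ _ M p n (arrival_history n.+1) (fun=> 1) nT
  (fun=> ler01).
have HE m : (t0 < m)%N -> history (Z1 M g1) m @^-1` [set arrival_history m] = E0.
  by move=> tm; apply/seteqP; split => w /=; move/(arrival_historyP w tm).
apply: filterS (H _) => [w Hw Ew|h].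
  have := Hw ((arrival_historyP w (leqW tn)).2 Ew).
  by rewrite /= !mul1r.
by rewrite tuple_init_arrival mul1e !HE// leqW.
Qed.

Let t := t0.+1.
Let lik k h w := \prod_(i < k) dens (O2 M) (t + i.+1)%N h (obs2 M (t + i.+1)%N w).

Let wald_belief_later k x w : wald_belief M t x (later M t k w) =
  x * lik k false w / (x * lik k false w + (1 - x) * lik k true w).
Proof.
rewrite /wald_belief.
have H h : \prod_(i < k) dens (O2 M) (t + i.+1)%N h (tnth (later M t k w) i) = lik k h w.
  by apply: eq_bigr => i _; rewrite tnth_mktuple.
by rewrite !H.
Qed.

Lemma belief2_wald k : (k <= T2 - t)%N -> {ae P, forall w, E0 w ->
  belief2 M g1 (info2 M g1 (t + k) w) =
  wald_belief M t (belief2 M g1 (info2 M g1 t w)) (later M t k w)}.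
Proof.
have tT2 : (t <= T2)%N by exact: leq_trans (T1_le_T2 M).
(* The induction also carries that the denominator is nonzero. The denominator after one more
   observation is the product of the previous one and that of the single update, and [field] has to
   cancel the former. *)
suff H : (k <= T2 - t)%N -> {ae P, forall w, E0 w ->
    let x := belief2 M g1 (info2 M g1 t w) in
    x * lik k false w + (1 - x) * lik k true w != 0 /\
    belief2 M g1 (info2 M g1 (t + k) w) = wald_belief M t x (later M t k w)}.
  by move=> /H; apply: filterS => w Hw /Hw[].
elim: k => [_|k IH kT].
  apply: aeW => w _ /=; rewrite wald_belief_later /lik !big_ord0 !mulr1.
  by rewrite addrC subrK divr1 oner_eq0 addn0.
have tk : (t0 < t + k)%N by rewrite leq_addr.
have tkT : (t + k < T2)%N by rewrite -addnS -leq_subRL.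
have := belief2_after tk tkT; move: (IH (ltnW kT)); apply: filterS2 => w H1 H2 Ew.
have [D1 B1] := H1 Ew; have [D2 B2] := H2 Ew.
move: D1 B1 D2 B2; rewrite /= -!addnS !wald_belief_later /lik !big_ord_recr /=.
set x := belief2 M g1 (info2 M g1 t w).
set L0 := \prod_(i < k) dens (O2 M) (t + i.+1)%N false _.
set L1 := \prod_(i < k) dens (O2 M) (t + i.+1)%N true _.
set a0 := dens (O2 M) _ false _; set a1 := dens (O2 M) _ true _.
move=> D1 -> D2 ->.
have DE : x * (L0 * a0) + (1 - x) * (L1 * a1) = (x * L0 + (1 - x) * L1) *
   (x * L0 / (x * L0 + (1 - x) * L1) * a0 +
    (1 - x * L0 / (x * L0 + (1 - x) * L1)) * a1) by field.
split; first by rewrite DE mulf_neq0.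
rewrite DE /bayes invfM !mulrA; congr (_ / _).
by rewrite -!mulrA; congr (_ * (_ * _)); rewrite mulrC.
Qed.

Definition wald_policy_from (x : R) : wald_policy Y2 :=
  fun k y => wald_rule M (W t) (t + k)%N (wald_belief M t x y).

Lemma measurable_wald_policy_from k : measurable_fun setT
  (fun z : R * k.-tuple Y2 => @wald_policy_from z.1 k z.2).
Proof.
apply: (@measurableT_comp _ _ _ _ _ _ (wald_rule M (W t) (t + k))).
  exact: measurable_wald_rule.
have ml h : measurable_fun setT (fun z : R * k.-tuple Y2 =>
    \prod_(i < k) dens (O2 M) (t + i.+1)%N h (tnth z.2 i)).
  apply: measurable_prod => i _; apply: measurableT_comp; first exact: dens_measurable.
  exact: (measurableT_comp (measurable_tnth i) measurable_snd).
have m1 : measurable_fun setT (fun z : R * k.-tuple Y2 => z.1) by exact: measurable_fst.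
exact: (measurable_bayes (ml false) (ml true) m1).
Qed.

Lemma wald_policy_from_stop x (y : (T2 - t).-tuple Y2) : wald_policy_from x y <> None.
Proof.
have tT2 : (t <= T2)%N by exact: leq_trans (T1_le_T2 M).
by rewrite /wald_policy_from /wald_rule subnKC// ltnn.
Qed.

Lemma past_arrival (g2 : strategy2 Y2) : (forall t, measurable_fun setT (@g2 t)) ->
  measurable (E0 `&` [set w | (t <= tau2 M g1 g2 w)%N] : set (past M T1 t)).
Proof.
move=> mg2; have tT2 : (t <= T2)%N by exact: leq_trans (T1_le_T2 M).
apply: measurableI; first exact: past_silentZ.
apply: (@measurable_holds _ (past M T1 t)).
apply: (@measurable_leq_tau2 _ _ _ _ _ _ _ M _ (past M T1 t) id T1 t) => //.
- exact: past_obs1.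
- exact: past_obs2.
- exact: leqW.
- exact: geq_minr.
Qed.

Lemma past_info2 : measurable_fun setT (info2 M g1 t : past M T1 t -> _).
Proof.
apply: (@measurable_info2 _ _ _ _ _ _ _ M _ (past M T1 t) id T1 t) => //.
- exact: past_obs1.
- exact: past_obs2.
- exact: measurable_gamma1.
- exact: gamma1_stop.
- exact: geq_minr.
Qed.

Lemma integral_wald_gamma2 h :
  let E := E0 `&` [set w | (t <= tau2 M g1 (gamma2 M W p) w)%N] in
  (\int[P]_(w in hyp_set M h `&` E) (cost2 M g1 (gamma2 M W p) w)%:E =
   \int[P]_(w in hyp_set M h `&` E) ((c2 M * t%:R)%:E +
     wald_cost_from M t (wald_policy_from (belief2 M g1 (info2 M g1 t w))) h (T2 - t) [tuple]))%E.
Proof.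
move=> E; have tT2 : (t <= T2)%N by exact: leq_trans (T1_le_T2 M).
apply: (@integral_wald_phase _ _ _ _ _ _ _ M _ _ wald_policy_from
  measurable_wald_policy_from t (fun w => belief2 M g1 (info2 M g1 t w))) => //.
- exact: (measurableT_comp (@measurable_belief2 _ _ _ _ _ _ _ M p t) past_info2).
- by apply: past_arrival; exact: measurable_gamma2.
- exact: wald_policy_from_stop.
- by move=> w [].
(* The Bayes identities hold almost everywhere for each [k] separately; as there are countably many,
   one null set serves all of them. *)
- have := @ae_foralln _ _ _ P (fun k w => (k <= T2 - t)%N -> E0 w ->
    belief2 M g1 (info2 M g1 (t + k) w) =
    wald_belief M t (belief2 M g1 (info2 M g1 t w)) (later M t k w)).
  move=> H; apply: filterS (H _) => [w Hw [Ew _] k kT _|k].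
    by rewrite act2_arrival ?leq_addr// /wald_policy_from -Hw.
  have [kT|Tk] := leqP k (T2 - t); last by apply: aeW => w.
  by apply: filterS (belief2_wald kT) => w Hw _.
- by apply: measurable_cost2; exact: measurable_gamma2.
Qed.

(* The expected cost from a state reached when the message of O1 arrives at
   time t = t0 + 1; O2 is out of the game when the last component is false. *)
Definition arrival_value (s : bool * R * R * bool) : \bar R :=
  ((c1 M * t%:R)%:E + (if s.2 then (c2 M * t%:R)%:E +
     wald_cost_from M t (wald_policy_from s.1.2) s.1.1.1 (T2 - t) [tuple] else 0))%E.

End AfterArrival.
End Arrival.

(** * Decomposition of the cost over time *)

Section CostDecomposition.
Context (R : realType) (d d1 d2 : measure_display)
  (Omega : measurableType d) (Y1 : measurableType d1)
  (Y2 : measurableType d2) (M : problem R Omega Y1 Y2).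
Variable W : nat -> nat -> thr2 R.

Local Notation P := (Pr M).
Local Notation T1 := (T1 M).
Local Notation T2 := (T2 M).
Local Notation st := (bool * R * R * bool)%type.
Local Notation G1 := (gamma1 M).
Local Notation G2 := (gamma2 M W).
Local Notation silent1 p t := (silent M (gamma1 M p) t).
Local Notation silentZ p t z :=
  (silent1 p t `&` [set w | Z1 M (gamma1 M p) t.+1 w = z]).
Local Notation stt p t s := (state M (gamma1 M p) (gamma2 M W p) t s).
Local Notation tau2' p w := (tau2 M (gamma1 M p) (gamma2 M W p) w).
Local Notation cost2' p w := (cost2 M (gamma1 M p) (gamma2 M W p) w).

(** O2's cost is booked in full when it stops, so it is still open at [t] only if [t < tau2]; O1's
    cost is booked in full at its message. There is no accrual per time step. *)
Definition remaining (p : design R) t w : R :=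
  c1 M * (tau1 M (G1 p) w)%:R + (if (t < tau2' p w)%N then cost2' p w else 0).

Lemma measurable_leq_tau1 p i : measurable_fun setT (fun w => (i <= tau1 M (G1 p) w)%N).
Proof.
have [iT|Ti] := leqP i T1.+1; last first.
  rewrite (_ : (fun _ => _) = cst false)//; apply/funext => w /=; apply/negbTE.
  rewrite -ltnNge (leq_ltn_trans (tau1_le _ w) (ltn_trans _ Ti))//.
  exact: gamma1_stop.
under eq_fun do rewrite leq_tau1//.
apply: (@measurable_quiet1 _ _ _ _ _ _ _ M _ Omega id i.-1) => //.
- by move=> s _; exact: obs1_measurable.
- exact: measurable_gamma1.
Qed.

Lemma measurable_tau1 p : measurable_fun setT (fun w => (tau1 M (G1 p) w)%:R : R).
Proof.
apply: (@measurable_fun_case _ _ _ _ nat (tau1 M (G1 p))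
  (fun i (_ : Omega) => i%:R : R)) => //.
exact: measurable_nat_level (measurable_leq_tau1 p).
Qed.

Lemma measurable_tau2_gt p t : measurable_fun setT (fun w => (t < tau2' p w)%N).
Proof.
have [tT|Tt] := leqP t.+1 T2.+1.
  apply: (@measurable_leq_tau2 _ _ _ _ _ _ _ M _ Omega id T1 t) => //.
  - by move=> s _; exact: obs1_measurable.
  - by move=> s _; exact: obs2_measurable.
  - exact: measurable_gamma2.
  - exact: geq_minr.
rewrite (_ : (fun _ => _) = cst false)//; apply/funext => w /=; apply/negbTE.
by rewrite -leqNgt (leq_trans (tau2_le _ _ _ _)).
Qed.

Lemma measurable_remaining p t : measurable_fun setT (fun w => (remaining p t w)%:E).
Proof.
apply/measurable_EFinP; apply: measurable_funD.
  by apply: measurable_funM => //; exact: measurable_tau1.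
apply: measurable_fun_ifT => //; first exact: measurable_tau2_gt.
by apply: measurable_cost2; exact: measurable_gamma2.
Qed.

Lemma remaining_ge0 p t w : 0 <= remaining p t w.
Proof.
apply: addr_ge0; last by case: ifP => // _; exact: cost2_ge0.
by rewrite mulr_ge0// ltW// c1_gt0.
Qed.

(* J is the cost still open when O1 has been silent up to time t, and K the one
   after its blank message at time t + 1, before O2 acts. *)
Definition J p t : \bar R := (\int[P]_(w in silent1 p t) (remaining p t w)%:E)%E.

Definition K p t : \bar R := (\int[P]_(w in silentZ p t None) (remaining p t w)%:E)%E.

Definition arrivals p t : \bar R :=
  (\int[P]_(w in silentZ p t (Some false)) arrival_value M W t (stt p t.+1 t.+1 w) +
   \int[P]_(w in silentZ p t (Some true)) arrival_value M W t (stt p t.+1 t.+1 w))%E.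

Definition stop_value t (a : thr2 R) (s : st) : \bar R :=
  (if s.2 then
     if rule2 a s.1.2 is Some u then c2 M * t%:R + loss M u s.1.1.1 else 0
   else 0)%:E.

Definition stops p t : \bar R :=
  (\int[P]_(w in silentZ p t None)
     stop_value t.+1 (thr_O2 p t.+1) (stt p t.+1 t.+1 w))%E.

Lemma arrival_value_ge0 t s : (0 <= arrival_value M W t s)%E.
Proof.
rewrite /arrival_value adde_ge0//.
  by rewrite lee_fin mulr_ge0// ltW// c1_gt0.
case: ifP => // _; rewrite adde_ge0 ?wald_cost_from_ge0//.
by rewrite lee_fin mulr_ge0// ltW// c2_gt0.
Qed.

Lemma stop_value_ge0 t a s : (0 <= stop_value t a s)%E.
Proof.
rewrite /stop_value lee_fin; case: ifP => // _; case: rule2 => [u|//].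
by rewrite addr_ge0 ?loss_ge0// mulr_ge0// ltW// c2_gt0.
Qed.

Lemma measurable_arrival_value t : measurable_fun setT (arrival_value M W t).
Proof.
apply: emeasurable_funD => //.
pose f h (s : st) : \bar R := (if s.2 then (c2 M * t.+1%:R)%:E +
  wald_cost_from M t.+1 (wald_policy_from M W t s.1.2) h (T2 - t.+1) [tuple] else 0)%E.
apply: (@measurable_hyp_case _ _ _ f) => h; apply: measurable_fun_ifT => //.
apply: emeasurable_funD => //.
have mp : measurable_fun setT (fun s : st => (s.1.2, [tuple]) : R * 0.-tuple Y2).
  apply: measurable_fun_pair => //.
  exact: (measurableT_comp measurable_snd measurable_fst).
exact: (measurableT_comp (@measurable_wald_cost_from _ _ _ _ _ _ _ M _ _ _
  (@measurable_wald_policy_from _ _ _ _ _ _ _ M W t) t.+1 h (T2 - t.+1) 0) mp).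
Qed.

Lemma measurable_stop_value t a : measurable_fun setT (stop_value t a).
Proof.
apply/measurable_EFinP; apply: measurable_fun_ifT => //.
apply: (@measurable_hyp_case _ _ _ (fun h (s : st) =>
  if rule2 a s.1.2 is Some u then c2 M * t%:R + loss M u h else 0)) => h.
apply: (@measurableT_comp _ _ _ _ _ _ (fun a : action =>
  if a is Some u then c2 M * t%:R + loss M u h else 0)).
  exact: measurable_from_discrete.
apply: measurableT_comp; first exact: measurable_rule2.
exact: (measurableT_comp measurable_snd measurable_fst).
Qed.

Let measurable_stt p t : (t < T1)%N -> measurable_fun setT (stt p t.+1 t.+1).
Proof.
move=> tT; have tT2 : (t < T2)%N by exact: leq_trans (T1_le_T2 M).
by apply: measurable_state; [exact: leqW|].
Qed.

(** On the event of an arrival, O1's cost is known and O2, if still active, is in the Wald phase.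
    The equality holds for integrals over each hypothesis and not pointwise, since the observations
    to come are averaged out. *)
Lemma integral_arrival p t b : (t < T1)%N ->
  (\int[P]_(w in silentZ p t (Some b)) (remaining p t w)%:E =
   \int[P]_(w in silentZ p t (Some b)) arrival_value M W t (stt p t.+1 t.+1 w))%E.
Proof.
move=> tT; have mE : measurable (silentZ p t (Some b)) by exact: measurable_silentZ.
have mav : measurable_fun setT (fun w => arrival_value M W t (stt p t.+1 t.+1 w)).
  by apply: (measurableT_comp (@measurable_arrival_value t)); exact: measurable_stt.
rewrite integral_hyp_split//; last 2 first.
- exact: measurable_remaining.
- by move=> w; rewrite lee_fin remaining_ge0.
rewrite [RHS]integral_hyp_split//; last by move=> w; exact: arrival_value_ge0.
suff H h : (\int[P]_(w in hyp_set M h `&` silentZ p t (Some b)) (remaining p t w)%:E =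
   \int[P]_(w in hyp_set M h `&` silentZ p t (Some b))
      arrival_value M W t (stt p t.+1 t.+1 w))%E by rewrite !H.
have mH : measurable (hyp_set M h `&` silentZ p t (Some b)).
  by apply: measurableI => //; exact: measurable_hyp_set.
have c0 : (0 <= (c1 M * t.+1%:R)%:E)%E by rewrite lee_fin mulr_ge0// ltW// c1_gt0.
have mc : measurable_fun setT (fun w => (cost2' p w)%:E).
  by apply/measurable_EFinP/measurable_cost2; exact: measurable_gamma2.
have mD : measurable_fun setT (fun w => (t < tau2' p w)%N) by exact: measurable_tau2_gt.
pose V w : \bar R := ((c2 M * t.+1%:R)%:E + wald_cost_from M t.+1
  (wald_policy_from M W t (belief2 M (G1 p) (info2 M (G1 p) t.+1 w))) h (T2 - t.+1) [tuple])%E.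
have V0 w : (0 <= V w)%E.
  by rewrite adde_ge0 ?wald_cost_from_ge0// lee_fin mulr_ge0// ltW// c2_gt0.
have mV : measurable_fun setT V.
  apply: emeasurable_funD => //.
  have mp : measurable_fun setT (fun w : Omega =>
      (belief2 M (G1 p) (info2 M (G1 p) t.+1 w), [tuple]) : R * 0.-tuple Y2).
    apply: measurable_fun_pair => //.
    apply: (measurableT_comp (@measurable_belief2 _ _ _ _ _ _ _ M p t.+1)).
    exact: info2_measurable.
  exact: (measurableT_comp (@measurable_wald_cost_from _ _ _ _ _ _ _ M _ _ _
    (@measurable_wald_policy_from _ _ _ _ _ _ _ M W t) t.+1 h (T2 - t.+1) 0) mp).
(* [integral_wald_gamma2] lives on the event that O2 is active. This exchanges that restriction for
   a case distinction under the integral, in both directions. *)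
have ifE (f : Omega -> \bar R) :
   (\int[P]_(w in hyp_set M h `&` silentZ p t (Some b))
      (if (t < tau2' p w)%N then f w else 0) =
    \int[P]_(w in hyp_set M h `&` (silentZ p t (Some b) `&`
       [set w | (t < tau2' p w)%N])) f w)%E.
  rewrite [in RHS]setIA [RHS]integral_mkcondr; apply: eq_integral => w _; rewrite patchE.
  case: ifPn => [tw|tw]; first by rewrite mem_set.
  by rewrite memNset//; exact/negP.
transitivity (\int[P]_(w in hyp_set M h `&` silentZ p t (Some b))
   ((c1 M * t.+1%:R)%:E + (if (t < tau2' p w)%N then (cost2' p w)%:E else 0)))%E.
  apply: eq_integral => w /set_mem[_ Ew]; rewrite /remaining EFinD.
  by rewrite (arrival_tau1 tT Ew); case: ifP.
rewrite ge0_integralD//; last 2 first.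
- by move=> w _; case: ifP => // _; rewrite lee_fin cost2_ge0.
- by apply: measurable_funTS; exact: measurable_fun_ifT.
rewrite ifE (integral_wald_gamma2 W p b tT) -/(V _) -ifE.
rewrite -ge0_integralD//; last 2 first.
- by move=> w _; case: ifP => // _; exact: V0.
- by apply: measurable_funTS; exact: (measurable_fun_ifT mD mV).
apply: eq_integral => w /set_mem[Hw Ew]; rewrite /arrival_value /state /=.
congr (_ + _)%E; case: ifP => // tw.
by rewrite pi2_active// Hw.
Qed.

Lemma J_split p t : (t < T1)%N -> J p t = (arrivals p t + K p t)%E.
Proof.
move=> tT; have mE z : measurable (silentZ p t z) by exact: measurable_silentZ.
have mr D : measurable_fun D (fun w => (remaining p t w)%:E).
  by apply: measurable_funTS; exact: measurable_remaining.
have r0 w : (0 <= (remaining p t w)%:E)%E by rewrite lee_fin remaining_ge0.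
rewrite /arrivals -!integral_arrival// /K /J.
have E : silent1 p t = silentZ p t (Some false) `|` silentZ p t (Some true) `|` silentZ p t None.
  apply/seteqP; split => w /=; last by move=> [[[]|[]]|[]].
  move=> sw; case: (Z1 _ _ _ _) => [[]|]; by [left; right|left; left|right].
rewrite {1}E !ge0_integral_setU//.
- by apply/disj_setPS => w /= [[_ ->] [_]].
- exact: measurableU.
- by apply/disj_setPS => w /= [[[_ ->]|[_ ->]] [_]].
Qed.

(** The integrands agree pointwise: O2's cost is booked at [t.+1] if it stops there, and otherwise
    stays in [remaining]. *)
Lemma K_split p t : (t.+1 < T1)%N -> K p t = (stops p t + J p t.+1)%E.
Proof.
move=> tT; have tT' := ltnW tT.
have tT2 : (t.+1 < T2)%N by exact: leq_trans (T1_le_T2 M).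
rewrite /J silentS /stops -ge0_integralD//.
- apply: eq_integral => w /set_mem Ew; rewrite /stop_value /state /remaining /=.
  rewrite -EFinD; congr (_%:E); rewrite addrCA; congr (_ + _).
  have sw : silent1 p t.+1 w by rewrite silentS.
  case: ifPn => tw; last by rewrite ifF ?addr0//; apply/negP => /ltnW; exact/negP.
  have aE : act2 M (G1 p) (G2 p) t.+1 w = rule2 (thr_O2 p t.+1) (pi2 M (G1 p) (G2 p) t.+1 w).
    by rewrite /act2 /gamma2 not_received// pi2_active.
  rewrite -aE; case E : (act2 _ _ _ _ _) => [u|]; last first.
    by rewrite (tau2_continue _ _ tw E) ?add0r// ltnW.
  have [tE dE] := tau2_stop (ltn0Sn t) (ltnW tT2) tw E.
  by rewrite tE ltnn addr0 /cost2 tE dE.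
- exact: measurable_silentZ.
- by move=> w _; exact: stop_value_ge0.
- apply: measurable_funTS; apply: (measurableT_comp (@measurable_stop_value _ _)).
  exact: measurable_stt.
- by move=> w _; rewrite lee_fin remaining_ge0.
- by apply: measurable_funTS; exact: measurable_remaining.
Qed.

Lemma K_last p t : t.+1 = T1 -> K p t = 0%E.
Proof.
move=> tT; rewrite /K (_ : silentZ p t None = set0) ?integral_set0//.
apply/seteqP; split => w //= [sw]; rewrite Z1_silent ?tT//.
by rewrite /rule_O1 ltnn.
Qed.

Fixpoint spent p n : \bar R :=
  if n is t.+1 then (spent p t + (arrivals p t + stops p t))%E else 0%E.

Lemma cost_spent p t : (t < T1)%N -> design_cost M W p = (spent p t + J p t)%E.
Proof.
elim: t => [_|t IH tT].
  rewrite add0e /design_cost /cost /J unlock.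
  have -> : silent1 p 0 = setT by apply/seteqP; split => w // _ s /andP[]; case: s.
  by apply: eq_integral => w _; rewrite /remaining /= /cost2 addrA.
rewrite (IH (ltnW tT)) (J_split _ (ltnW tT)) K_split//= !addeA.
by [].
Qed.

Lemma cost_spentK p t : (t < T1)%N ->
  design_cost M W p = (spent p t + arrivals p t + K p t)%E.
Proof. by move=> tT; rewrite (cost_spent _ tT) J_split// addeA. Qed.

Lemma arrivals_ge0 p t : (0 <= arrivals p t)%E.
Proof. by apply: adde_ge0; apply: integral_ge0 => w _; exact: arrival_value_ge0. Qed.

Lemma stops_ge0 p t : (0 <= stops p t)%E.
Proof. by apply: integral_ge0 => w _; exact: stop_value_ge0. Qed.

Lemma spent_ge0 p t : (0 <= spent p t)%E.
Proof.
elim: t => [|t IH] /=; first by [].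
by apply: adde_ge0 => //; apply: adde_ge0; [exact: arrivals_ge0|exact: stops_ge0].
Qed.

Lemma J_ge0 p t : (0 <= J p t)%E.
Proof. by apply: integral_ge0 => w _; rewrite lee_fin remaining_ge0. Qed.

Lemma K_ge0 p t : (0 <= K p t)%E.
Proof. by apply: integral_ge0 => w _; rewrite lee_fin remaining_ge0. Qed.

Lemma design_cost_fin p : design_cost M W p \is a fin_num.
Proof.
rewrite (cost_spent p (T1_gt0 M)) /= add0e ge0_fin_numE ?J_ge0//.
(* [T2.+1] is the default value of [stop_time], the bound valid for O2 without discussing whether it
   stops. *)
pose B := c1 M * T1%:R + (c2 M * T2.+1%:R + lossB M).
have B0 : 0 <= B.
  have := loss_bounds M true true => /andP[l0 lB].
  by rewrite !addr_ge0 ?mulr_ge0 ?(ltW (c1_gt0 M)) ?(ltW (c2_gt0 M))// (le_trans l0).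
have ms : measurable (silent1 p 0) by exact: measurable_silent.
apply: (@le_lt_trans _ _ (\int[P]_(w in silent1 p 0) B%:E)%E).
  apply: ge0_le_integral => //.
  - by move=> w _; rewrite lee_fin remaining_ge0.
  - by apply: measurable_funTS; exact: measurable_remaining.
  - move=> w _; rewrite lee_fin /remaining /B lerD//.
      rewrite ler_wpM2l ?(ltW (c1_gt0 M))// ler_nat tau1_le//; exact: gamma1_stop.
    have l0 := (andP (loss_bounds M (decision M (G1 p) (G2 p) w) (hyp M w))).2.
    have h : cost2' p w <= c2 M * T2.+1%:R + lossB M.
      by rewrite lerD// ler_wpM2l ?(ltW (c2_gt0 M))// ler_nat tau2_le.
    exact: h.
rewrite integral_cst// lte_mul_pinfty// ?lee_fin//.
by rewrite (le_lt_trans (probability_le1 _ _))// ltry.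
Qed.

Section Scaling.
Variables (p q : design R) (r : R).
Hypothesis r_gt0 : 0 < r.

Lemma arrivals_scaled t : (t < T1)%N -> rule_O1 M p t.+1 = rule_O1 M q t.+1 ->
  scaled P r (silent1 p t) (silent1 q t) (stt p t.+1 t) (stt q t.+1 t) ->
  arrivals p t = (r%:E * arrivals q t)%E.
Proof.
move=> tT rE sc; have H b := phi_scaled r_gt0 (Some b) tT rE sc.
have av := @measurable_arrival_value t.
rewrite /arrivals (H false _ av (@arrival_value_ge0 t)) (H true _ av (@arrival_value_ge0 t)).
by rewrite -ge0_muleDr//; apply: integral_ge0 => w _; exact: arrival_value_ge0.
Qed.

(** One induction on the number of steps left proves both claims, as [J] at [t] reduces to [K] at
    [t] and this to [J] at [t.+1]. In the claim on [K] the designs may differ in O1's choice at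
    [t.+1]: its effect is already contained in the laws assumed proportional. *)
Lemma JK_scaled n t : (t + n.+1)%N = T1 ->
  ((forall s, (t < s < T1)%N -> thr_O1 p s = thr_O1 q s) ->
   (forall s, (t < s < T1)%N -> thr_O2 p s = thr_O2 q s) ->
   thr_final p = thr_final q ->
   scaled P r (silent1 p t) (silent1 q t) (stt p t.+1 t) (stt q t.+1 t) ->
   J p t = (r%:E * J q t)%E) /\
  ((t.+1 < T1)%N -> (forall s, (t.+1 < s < T1)%N -> thr_O1 p s = thr_O1 q s) ->
   (forall s, (t < s < T1)%N -> thr_O2 p s = thr_O2 q s) ->
   thr_final p = thr_final q ->
   scaled P r (silentZ p t None) (silentZ q t None) (stt p t.+1 t.+1) (stt q t.+1 t.+1) ->
   K p t = (r%:E * K q t)%E).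
Proof.
elim: n t => [|n IH] t tn.
  have tT : t.+1 = T1 by rewrite -tn addn1.
  split=> [_ _ fE sc|]; last by rewrite tT ltnn.
  have lt_t : (t < T1)%N by rewrite -tT.
  have J_arrivals u : J u t = arrivals u t.
    by rewrite (J_split u lt_t) (K_last u tT); exact: adde0.
  rewrite (J_arrivals p) (J_arrivals q).
  apply: arrivals_scaled => //.
  by apply/funext => x; rewrite /rule_O1 tT ltnn fE.
have tT : (t.+1 < T1)%N by rewrite -tn !addnS !ltnS leq_addr.
have HK : (forall s, (t.+1 < s < T1)%N -> thr_O1 p s = thr_O1 q s) ->
   (forall s, (t < s < T1)%N -> thr_O2 p s = thr_O2 q s) ->
   thr_final p = thr_final q ->
   scaled P r (silentZ p t None) (silentZ q t None) (stt p t.+1 t.+1) (stt q t.+1 t.+1) ->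
   K p t = (r%:E * K q t)%E.
  move=> e1 e2 ef sc; rewrite !K_split//.
  have eO2 : thr_O2 p t.+1 = thr_O2 q t.+1 by apply: e2; rewrite ltnSn.
  rewrite /stops eO2 (sc _ (@measurable_stop_value _ _) (@stop_value_ge0 _ _)).
  have [HJ _] := IH t.+1 (etrans (addSnnS _ _) tn).
  have {}HJ : J p t.+1 = (r%:E * J q t.+1)%E.
    apply: HJ => //.
    - by move=> s /andP[ts sT]; apply: e2; rewrite sT ltnW.
    - by apply: psi_scaled => //; rewrite !silentS.
  have s0 : (0 <= \int[P]_(w in silentZ q t None)
      stop_value t.+1 (thr_O2 q t.+1) (stt q t.+1 t.+1 w))%E.
    by apply: integral_ge0 => w _; exact: stop_value_ge0.
  rewrite HJ; apply/esym; exact: (ge0_muleDr r%:E s0 (J_ge0 q t.+1)).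
split => // e1 e2 ef sc.
have rE : rule_O1 M p t.+1 = rule_O1 M q t.+1.
  by apply/funext => x; rewrite /rule_O1 tT e1// ltnSn.
have {}HK : K p t = (r%:E * K q t)%E.
  apply: HK => //; last exact: (phi_scaled r_gt0 None (ltnW tT) rE sc).
  by move=> s /andP[ts sT]; apply: e1; rewrite sT ltnW.
rewrite (J_split p (ltnW tT)) (J_split q (ltnW tT)) (arrivals_scaled (ltnW tT) rE sc) HK.
apply/esym; exact: (ge0_muleDr r%:E (arrivals_ge0 q t) (K_ge0 q t)).
Qed.

End Scaling.
End CostDecomposition.

(** * Designs with a common past *)

Section SameActions.
Context (R : realType) (d d1 d2 : measure_display)
  (Omega : measurableType d) (Y1 : measurableType d1)
  (Y2 : measurableType d2) (M : problem R Omega Y1 Y2).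
Variables (g1 h1 : strategy1 Y1) (g2 h2 : strategy2 Y2).

Lemma quiet2_eq s w :
  (forall r, (1 <= r <= s)%N -> act2 M g1 g2 r w = act2 M h1 h2 r w) ->
  quiet2 M g1 g2 s w = quiet2 M h1 h2 s w.
Proof.
move=> H; apply: eq_in_all => r; rewrite mem_iota add1n ltnS => rs.
by congr (_ == _); exact: H.
Qed.

Lemma leq_tau2_eq t w : (t <= (T2 M).+1)%N ->
  (forall r, (1 <= r <= t.-1)%N -> act2 M g1 g2 r w = act2 M h1 h2 r w) ->
  (t <= tau2 M g1 g2 w)%N = (t <= tau2 M h1 h2 w)%N.
Proof. by move=> tT H; rewrite !leq_tau2//; exact: quiet2_eq. Qed.

Lemma pi2_eq s w : (s <= (T2 M).+1)%N ->
  (forall r, (1 <= r <= s.-1)%N -> act2 M g1 g2 r w = act2 M h1 h2 r w) ->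
  (forall r, (1 <= r <= s)%N -> belief2 M g1 (info2 M g1 r w) = belief2 M h1 (info2 M h1 r w)) ->
  pi2 M g1 g2 s w = pi2 M h1 h2 s w.
Proof.
elim: s => [_ _ _|s IH sT H HB]; first by rewrite !pi20.
rewrite !pi2S (leq_tau2_eq sT H) IH.
- by congr (if _ then _ else _); apply: HB; rewrite ltnSn.
- exact: ltnW.
- by case: s sT H {IH HB} => // s sT H r /andP[r1 rs]; apply: H; rewrite r1 ltnW.
- by move=> r /andP[r1 rs]; apply: HB; rewrite r1 leqW.
Qed.

End SameActions.

Section SamePast.
Context (R : realType) (d d1 d2 : measure_display)
  (Omega : measurableType d) (Y1 : measurableType d1)
  (Y2 : measurableType d2) (M : problem R Omega Y1 Y2).
Variable W : nat -> nat -> thr2 R.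

Local Notation P := (Pr M).
Local Notation T1 := (T1 M).
Local Notation T2 := (T2 M).
Local Notation G1 := (gamma1 M).
Local Notation G2 := (gamma2 M W).
Local Notation silent1 p t := (silent M (gamma1 M p) t).
Local Notation silentZ p t z :=
  (silent1 p t `&` [set w | Z1 M (gamma1 M p) t.+1 w = z]).
Local Notation stt p t s := (state M (gamma1 M p) (gamma2 M W p) t s).

(** Two bounds are kept because O1 is one choice ahead of O2 when its message has been sent. O1 is
    compared through [rule_O1], which covers the threshold at [T1] together with the earlier
    ones. *)
Definition agree (n m : nat) (p q : design R) : Prop :=
  (forall s, (1 <= s <= n)%N -> rule_O1 M p s = rule_O1 M q s) /\
  (forall s, (1 <= s <= m)%N -> thr_O2 p s = thr_O2 q s).

Section Agree.
Variables (n m : nat) (p q : design R).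
Hypotheses (nT : (n <= T1)%N) (pq : agree n m p q).

Lemma act1_agree s w : (1 <= s <= n)%N -> act1 M (G1 p) s w = act1 M (G1 q) s w.
Proof. by move=> sn; have := congr1 (fun f => f (pi1 M s w)) (pq.1 s sn). Qed.

Lemma quiet1_agree s w : (s <= n)%N -> quiet1 M (G1 p) s w = quiet1 M (G1 q) s w.
Proof.
by elim: s => // s IH sn; rewrite !quiet1S IH ?(ltnW sn)// act1_agree.
Qed.

Lemma silent_agree s : (s <= n)%N -> silent1 p s = silent1 q s.
Proof.
move=> sn; have sT := leq_trans sn nT; rewrite !silentE//.
by apply/seteqP; split => w /=; rewrite quiet1_agree.
Qed.

Lemma Z1_agree s w : (1 <= s <= n)%N -> Z1 M (G1 p) s w = Z1 M (G1 q) s w.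
Proof.
move=> /andP[s1 sn]; rewrite !Z1E ?(leq_trans sn)//.
by rewrite quiet1_agree ?(leq_trans (leq_pred _))// act1_agree ?s1.
Qed.

Lemma silentZ_agree s z : (s < n)%N -> silentZ p s z = silentZ q s z.
Proof.
move=> sn; rewrite silent_agree ?(ltnW sn)//; congr (_ `&` _).
by apply/seteqP; split => w /=; rewrite Z1_agree.
Qed.

Lemma info2_agree s : (s <= n)%N -> info2 M (G1 p) s = info2 M (G1 q) s.
Proof.
move=> sn; apply/funext => w; congr (_, _); apply: eq_from_tnth => i.
by rewrite !tnth_mktuple Z1_agree//= (leq_trans (ltn_ord i)).
Qed.

Lemma belief2_agree s : (s <= n)%N -> belief2 M (G1 p) (t:=s) = belief2 M (G1 q) (t:=s).
Proof. by move=> sn; rewrite /belief2 info2_agree. Qed.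

Lemma gamma2_agree s i : (s <= n)%N -> (1 <= s <= m)%N -> @G2 p s i = @G2 q s i.
Proof.
move=> sn sm; rewrite /gamma2 -(pq.2 _ sm).
by have -> : belief2 M (G1 p) i = belief2 M (G1 q) i by rewrite (belief2_agree sn).
Qed.

Lemma act2_agree s w : (s <= n)%N -> (1 <= s <= m)%N ->
  act2 M (G1 p) (G2 p) s w = act2 M (G1 q) (G2 q) s w.
Proof.
move=> sn sm; rewrite /act2 (info2_agree sn); exact: (gamma2_agree _ sn sm).
Qed.

Let nT2 : (n <= T2)%N.
Proof. exact: leq_trans (T1_le_T2 M). Qed.

Lemma leq_tau2_agree t w : (t.-1 <= n)%N -> (t.-1 <= m)%N ->
  (t <= tau2 M (G1 p) (G2 p) w)%N = (t <= tau2 M (G1 q) (G2 q) w)%N.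
Proof.
move=> tn tm; apply: leq_tau2_eq.
  by case: t tn {tm} => // t tn; rewrite ltnS (leq_trans tn).
move=> r /andP[r1 rt]; apply: act2_agree; first exact: leq_trans tn.
by rewrite r1 (leq_trans rt).
Qed.

Lemma pi2_agree s w : (s <= n)%N -> (s <= m.+1)%N ->
  pi2 M (G1 p) (G2 p) s w = pi2 M (G1 q) (G2 q) s w.
Proof.
move=> sn sm; apply: pi2_eq; first exact: (leqW (leq_trans sn nT2)).
  move=> r /andP[r1 rs]; have rs' : (r <= s)%N := leq_trans rs (leq_pred s).
  apply: act2_agree; first exact: leq_trans sn.
  by rewrite r1 (leq_trans rs)// -ltnS (leq_trans _ sm)//; case: s r1 rs {sn sm rs'} => //; case: r.
move=> r /andP[r1 rs]; have rn := leq_trans rs sn.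
by rewrite (belief2_agree rn) (info2_agree rn).
Qed.

Lemma state_agree t s : (t.-1 <= n)%N -> (t.-1 <= m)%N -> (s <= n)%N -> (s <= m.+1)%N ->
  stt p t s = stt q t s.
Proof.
move=> tn tm sn sm; apply/funext => w; rewrite /state (pi2_agree w sn sm).
by rewrite (leq_tau2_agree w tn tm).
Qed.

Lemma arrivals_agree t : (t < n)%N -> (t <= m)%N -> arrivals M W p t = arrivals M W q t.
Proof.
move=> tn tm; have e : stt p t.+1 t.+1 = stt q t.+1 t.+1.
  exact: (@state_agree t.+1 t.+1 (ltnW tn) tm tn tm).
by rewrite /arrivals e (silentZ_agree _ tn) (silentZ_agree _ tn).
Qed.

Lemma stops_agree t : (t < n)%N -> (t < m)%N -> stops M W p t = stops M W q t.
Proof.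
move=> tn tm; have e : stt p t.+1 t.+1 = stt q t.+1 t.+1.
  exact: (@state_agree t.+1 t.+1 (ltnW tn) (ltnW tm) tn (ltnW tm)).
by rewrite /stops e (silentZ_agree _ tn) (pq.2 t.+1 tm).
Qed.

Let spentS u t :
  spent M W u t.+1 = (spent M W u t + (arrivals M W u t + stops M W u t))%E.
Proof. by []. Qed.

Lemma spent_agree t : (t <= n)%N -> (t <= m)%N -> spent M W p t = spent M W q t.
Proof.
elim: t => [_ _|t IH tn tm]; first by [].
rewrite !spentS (IH (ltnW tn) (ltnW tm)) (arrivals_agree tn (ltnW tm)).
by rewrite (stops_agree tn tm).
Qed.

End Agree.

Lemma same_past_agree t p q : (t < T1)%N -> same_past t.+1 p q -> agree t t p q.
Proof.
move=> tT pq; split => s st; have [e1 e2] := pq s st; last by [].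
have sT : (s < T1)%N by case/andP: st => _ st; exact: leq_ltn_trans st tT.
by apply/funext => x; rewrite /rule_O1 sT e1.
Qed.

Lemma same_past_agree1 t p q : (t.+1 < T1)%N -> same_past t.+1 p q ->
  thr_O1 p t.+1 = thr_O1 q t.+1 -> agree t.+1 t p q.
Proof.
move=> tT pq e; have [H1 H2] := same_past_agree (ltnW tT) pq; split => // s /andP[s1].
rewrite leq_eqVlt => /predU1P[->|st]; last by apply: H1; rewrite s1.
by apply/funext => x; rewrite /rule_O1 tT e.
Qed.

Lemma same_past_agree_final p q : same_past T1 p q ->
  thr_final p = thr_final q -> agree T1 T1.-1 p q.
Proof.
have T1p := prednK (T1_gt0 M) => pq e.
have tT : (T1.-1 < T1)%N by rewrite -[X in (_ < X)%N]T1p.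
rewrite -T1p in pq; have [H1 H2] := same_past_agree tT pq.
split=> // s /andP[s1]; rewrite leq_eqVlt => /predU1P[->|st].
  by apply/funext => x; rewrite /rule_O1 ltnn e.
by apply: H1; rewrite s1 -ltnS T1p.
Qed.

Lemma psi_same p q t : (t < T1)%N -> agree t t p q ->
  design_psi M W p t.+1 = design_psi M W q t.+1.
Proof.
move=> tT pq.
rewrite /design_psi -[LHS]/(cond_law M (stt p t.+1 t) (silent1 p t)).
rewrite -[RHS]/(cond_law M (stt q t.+1 t) (silent1 q t)).
by rewrite (silent_agree (ltnW tT) pq (leqnn t))
  (@state_agree t t p q (ltnW tT) pq t.+1 t (leqnn t) (leqnn t) (leqnn t) (leqnSn t)).
Qed.

Lemma phi_same p q t z : (t.+1 <= T1)%N -> agree t.+1 t p q ->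
  design_phi M W p t.+1 z = design_phi M W q t.+1 z.
Proof.
move=> tT pq.
rewrite /design_phi -[LHS]/(cond_law M (stt p t.+1 t.+1) (silentZ p t z)).
rewrite -[RHS]/(cond_law M (stt q t.+1 t.+1) (silentZ q t z)).
by rewrite (silentZ_agree tT pq z (ltnSn t))
  (@state_agree t.+1 t p q tT pq t.+1 t.+1 (leqnSn t) (leqnn t) (leqnn _) (leqnn _)).
Qed.

(** Equal conditional laws are proportional before normalization, with the ratio of the two
    probabilities as factor. This is where the histories must have positive probability. *)
Lemma cond_law_scaled (E F : set Omega) (X Y : Omega -> bool * R * R * bool) :
  measurable E -> measurable F -> measurable_fun setT X -> measurable_fun setT Y ->
  P E != 0%E -> P F != 0%E -> cond_law M X E = cond_law M Y F ->
  scaled P (fine (P E) / fine (P F)) E F X Y.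
Proof.
move=> mE mF mX mY E0 F0 EF f mf f0.
have fin A : measurable A -> P A \is a fin_num by exact: fin_num_measure.
have fE : fine (P E) != 0 by rewrite fine_eq0 ?fin.
have fF : fine (P F) != 0 by rewrite fine_eq0 ?fin.
apply: ge0_integral_scaled => //; first by rewrite divr_ge0 ?fine_ge0.
move=> A mA; have mEA : measurable (E `&` X @^-1` A).
  by apply: measurableI => //; exact: measurable_preimageT.
have mFA : measurable (F `&` Y @^-1` A).
  by apply: measurableI => //; exact: measurable_preimageT.
have := congr1 (fun g => g A) EF; rewrite /cond_law.
have -> : `[< measurable A >] by apply/asboolP.
rewrite setIC [in RHS]setIC => H.
rewrite -[LHS](fineK (fin _ mEA)) -[X in (_ * X)%E](fineK (fin _ mFA)) -EFinM; congr (_%:E).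
have /(congr1 ( *%R^~ (fine (P E)))) := H; rewrite divfK// => ->.
by field.
Qed.

(* Play p before time t, then q; in [splice2] O1 also acts as in p at time t. *)
Definition splice1 t (p q : design R) : design R :=
  Design (fun s => if (0 < s < t)%N then thr_O1 p s else thr_O1 q s) (thr_final q)
    (fun s => if (0 < s < t)%N then thr_O2 p s else thr_O2 q s).

Definition splice2 t (p q : design R) : design R :=
  Design (fun s => if (0 < s <= t)%N then thr_O1 p s else thr_O1 q s) (thr_final q)
    (fun s => if (0 < s < t)%N then thr_O2 p s else thr_O2 q s).

Lemma splice1_same t p q : same_past t p (splice1 t p q).
Proof. by move=> s st /=; rewrite st. Qed.

(** The equality is literal, since the guard [0 < s] leaves index 0 to [q] and [same_past] says
    nothing there. The designs with the past of [p] are therefore exactly the splices. *)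
Lemma splice1_id t p q : same_past t p q -> splice1 t p q = q.
Proof.
case: q => a b c pq; rewrite /splice1 /=; congr Design; apply/funext => s;
  by case: ifP => // /pq[].
Qed.

Lemma splice1_ge t p q s : (t <= s)%N ->
  thr_O1 (splice1 t p q) s = thr_O1 q s /\ thr_O2 (splice1 t p q) s = thr_O2 q s.
Proof. by move=> ts; rewrite /= [(s < t)%N]ltnNge ts andbF. Qed.

Lemma splice1_adm t p q : adm_design M p -> adm_design M q -> adm_design M (splice1 t p q).
Proof. by move=> [? ? ?] [? ? ?]; split => //= s sT; case: ifP => _; auto. Qed.

Lemma splice2_same t p q : same_past t p (splice2 t p q).
Proof.
move=> s /= /[dup] st ->; case/andP: st => s0 st.
by rewrite s0 (ltnW st).
Qed.

Lemma splice2_id t p q : same_past t p q -> thr_O1 q t = thr_O1 p t ->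
  splice2 t p q = q.
Proof.
case: q => a b c pq /= e; rewrite /splice2 /=; congr Design; apply/funext => s.
  case: ifP => // /andP[s0]; rewrite leq_eqVlt => /predU1P[->//|st].
  by have [] := pq s; rewrite // s0.
by case: ifP => // /pq[].
Qed.

Lemma splice2_gt t p q s : (t < s)%N -> thr_O1 (splice2 t p q) s = thr_O1 q s.
Proof. by move=> ts; rewrite /= [(s <= t)%N]leqNgt ts andbF. Qed.

Lemma splice2_ge t p q s : (t <= s)%N -> thr_O2 (splice2 t p q) s = thr_O2 q s.
Proof. by move=> ts; rewrite /= [(s < t)%N]ltnNge ts andbF. Qed.

Lemma splice2_adm t p q : adm_design M p -> adm_design M q -> adm_design M (splice2 t p q).
Proof. by move=> [? ? ?] [? ? ?]; split => //= s sT; case: ifP => _; auto. Qed.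

Let fin_spent p t : (t < T1)%N -> spent M W p t \is a fin_num.
Proof.
move=> tT; rewrite ge0_fin_numE ?spent_ge0//.
have := design_cost_fin M W p; rewrite (cost_spent W p tT) ge0_fin_numE; last first.
  by rewrite adde_ge0 ?spent_ge0 ?J_ge0.
by apply: le_lt_trans; rewrite leeDl// J_ge0.
Qed.

Let fin_spentK p t : (t < T1)%N -> (spent M W p t + arrivals M W p t)%E \is a fin_num.
Proof.
move=> tT; have s0 := adde_ge0 (spent_ge0 M W p t) (arrivals_ge0 M W p t).
have := design_cost_fin M W p; rewrite (cost_spentK W p tT).
rewrite (ge0_fin_numE (adde_ge0 s0 (K_ge0 M W p t))) (ge0_fin_numE s0).
by apply: le_lt_trans; exact: (leeDl _ (K_ge0 M W p t)).
Qed.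

Let affine_cost (S S' X X' : \bar R) (k : R) : S \is a fin_num -> S' \is a fin_num ->
  X = (k%:E * X')%E -> (0 <= X')%E ->
  (S + X = (fine S - k * fine S')%:E + k%:E * (S' + X'))%E.
Proof.
move=> fS fS' -> X0; rewrite -{1}(fineK fS) -{2}(fineK fS').
rewrite muleDr// ?fin_num_adde_defr// addeA -EFinM -EFinD.
by rewrite subrK.
Qed.

(** [A] and [k] are chosen before the continuation [q]: they depend on the two pasts only, so one
    affine map relates the costs of all continuations. *)
Lemma cost_affine1 t p r : (t < T1)%N -> reaches M p t -> reaches M r t ->
  design_psi M W p t.+1 = design_psi M W r t.+1 ->
  exists A k : R, 0 < k /\ forall q,
    design_cost M W (splice1 t.+1 p q) =
    (A%:E + k%:E * design_cost M W (splice1 t.+1 r q))%E.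
Proof.
move=> tT rp rr psiE; have tT2 : (t < T2)%N by exact: leq_trans (T1_le_T2 M).
have ms u : measurable (silent1 u t) by apply: measurable_silent; exact: ltnW.
have mst u : measurable_fun setT (stt u t.+1 t).
  by apply: measurable_state; [exact: leqW|exact: ltnW].
have sc : scaled P (fine (P (silent1 p t)) / fine (P (silent1 r t))) (silent1 p t)
    (silent1 r t) (stt p t.+1 t) (stt r t.+1 t).
  exact: cond_law_scaled.
set k := _ / _ in sc; have k0 : 0 < k.
  by rewrite divr_gt0// fine_gt0// lt0e measure_ge0 ?rp ?rr /= -ge0_fin_numE ?fin_num_measure.
(* Each cost is the spent part plus [J], and the two values of [J] are in the ratio [k]; eliminating
   them leaves this constant. *)
exists (fine (spent M W p t) - k * fine (spent M W r t)), k; split => // q.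
have ag u : agree t t u (splice1 t.+1 u q).
  by apply: same_past_agree => //; exact: splice1_same.
have e u : spent M W u t = spent M W (splice1 t.+1 u q) t.
  exact: (spent_agree (ltnW tT) (ag u) (leqnn t) (leqnn t)).
rewrite !(cost_spent W _ tT) -!e; apply: affine_cost.
- exact: fin_spent.
- exact: fin_spent.
- have tn : (t + (T1 - t.+1).+1)%N = T1 by rewrite -subSn// subSS subnKC// ltnW.
  have [H _] := @JK_scaled _ _ _ _ _ _ _ M W (splice1 t.+1 p q) (splice1 t.+1 r q) k k0 _ t tn.
  apply: H.
  + move=> s /andP[ts sT].
    by rewrite (splice1_ge p q ts).1 (splice1_ge r q ts).1.
  + move=> s /andP[ts sT].
    by rewrite (splice1_ge p q ts).2 (splice1_ge r q ts).2.
  + exact: erefl.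
  + have eS u : stt u t.+1 t = stt (splice1 t.+1 u q) t.+1 t.
      exact: (@state_agree t t _ _ (ltnW tT) (ag u) t.+1 t (leqnn t) (leqnn t) (leqnn t) (leqnSn t)).
    by rewrite -(silent_agree (ltnW tT) (ag p) (leqnn t)) -(silent_agree (ltnW tT) (ag r) (leqnn t))
      -!eS.
- exact: J_ge0.
Qed.

Lemma cost_affine2 t p r : (t.+1 < T1)%N -> reaches M p t.+1 -> reaches M r t.+1 ->
  design_phi M W p t.+1 None = design_phi M W r t.+1 None ->
  exists A k : R, 0 < k /\ forall q,
    design_cost M W (splice2 t.+1 p q) =
    (A%:E + k%:E * design_cost M W (splice2 t.+1 r q))%E.
Proof.
move=> tT; rewrite /reaches !silentS => rp rr phiE.
have tT' := ltnW tT; have tT2 : (t < T2)%N by exact: leq_trans (T1_le_T2 M).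
have ms u : measurable (silentZ u t None) by exact: measurable_silentZ.
have mst u : measurable_fun setT (stt u t.+1 t.+1).
  by apply: measurable_state; [exact: leqW|].
have sc : scaled P (fine (P (silentZ p t None)) / fine (P (silentZ r t None)))
    (silentZ p t None) (silentZ r t None) (stt p t.+1 t.+1) (stt r t.+1 t.+1).
  exact: cond_law_scaled.
set k := _ / _ in sc; have k0 : 0 < k.
  by rewrite divr_gt0// fine_gt0// lt0e measure_ge0 ?rp ?rr /= -ge0_fin_numE ?fin_num_measure.
exists (fine (spent M W p t + arrivals M W p t) - k * fine (spent M W r t + arrivals M W r t)), k.
split => // q.
have ag u : agree t.+1 t u (splice2 t.+1 u q).
  apply: same_past_agree1 => //; first exact: splice2_same.
  by rewrite /= leqnn.
have e u : (spent M W u t + arrivals M W u t =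
    spent M W (splice2 t.+1 u q) t + arrivals M W (splice2 t.+1 u q) t)%E.
  by rewrite (spent_agree tT' (ag u) (leqnSn t) (leqnn t))
    (arrivals_agree tT' (ag u) (ltnSn t) (leqnn t)).
rewrite !(cost_spentK W _ tT') -!e; apply: affine_cost.
- exact: fin_spentK.
- exact: fin_spentK.
- have tn : (t + (T1 - t.+1).+1)%N = T1 by rewrite -subSn// subSS subnKC// ltnW.
  have [_ H] := @JK_scaled _ _ _ _ _ _ _ M W (splice2 t.+1 p q) (splice2 t.+1 r q) k k0 _ t tn.
  apply: (H tT).
  + by move=> s /andP[ts sT]; rewrite (splice2_gt p q ts) (splice2_gt r q ts).
  + by move=> s /andP[ts sT]; rewrite (splice2_ge p q ts) (splice2_ge r q ts).
  + exact: erefl.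
  + have eS u : stt u t.+1 t.+1 = stt (splice2 t.+1 u q) t.+1 t.+1.
      exact: (@state_agree t.+1 t _ _ tT' (ag u) t.+1 t.+1 (leqnSn t) (leqnn t) (leqnn _) (leqnn _)).
    by rewrite -(silentZ_agree tT' (ag p) _ (ltnSn t)) -(silentZ_agree tT' (ag r) _ (ltnSn t))
      -!eS.
- exact: K_ge0.
Qed.

(** The remaining cost is an integral over a null event, so all continuations cost the same. This
    settles the steps that [reaches] excludes. *)
Lemma cost_unreached1 t p q : (t < T1)%N -> ~ reaches M p t -> agree t t p q ->
  design_cost M W q = design_cost M W p.
Proof.
move=> tT np pq; have J0 u : P (silent1 u t) = 0%E -> J M W u t = 0%E.
  move=> u0; rewrite /J; apply: null_set_integral => //.
  - by apply: measurable_silent; exact: ltnW.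
  - by apply: measurable_funTS; exact: measurable_remaining.
rewrite !(cost_spent W _ tT) (spent_agree (ltnW tT) pq (leqnn t) (leqnn t)).
move/negP/negPn/eqP: np => np; rewrite (J0 p np) (J0 q)//.
by rewrite -(silent_agree (ltnW tT) pq (leqnn t)).
Qed.

Lemma cost_unreached2 t p q : (t.+1 < T1)%N -> ~ reaches M p t.+1 -> agree t.+1 t p q ->
  design_cost M W q = design_cost M W p.
Proof.
move=> tT np pq; have tT' := ltnW tT.
have K0 u : P (silent1 u t.+1) = 0%E -> K M W u t = 0%E.
  move=> u0; rewrite /K -silentS; apply: null_set_integral => //.
  - exact: measurable_silent.
  - by apply: measurable_funTS; exact: measurable_remaining.
rewrite !(cost_spentK W _ tT') (spent_agree tT' pq (leqnSn t) (leqnn t))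
  (arrivals_agree tT' pq (ltnSn t) (leqnn t)).
move/negP/negPn/eqP: np => np; rewrite (K0 p np) (K0 q)//.
by rewrite -(silent_agree tT' pq (leqnn _)).
Qed.

(** O1 must speak at [T1], after which O2 uses the Wald thresholds; so agreement of O2's thresholds
    up to [T1.-1] determines the whole cost. *)
Lemma cost_agree_final p q : agree T1 T1.-1 p q -> design_cost M W q = design_cost M W p.
Proof.
move=> pq; have T1p := prednK (T1_gt0 M).
have tT : (T1.-1 < T1)%N by rewrite -[X in (_ < X)%N]T1p.
rewrite !(cost_spentK W _ tT) (K_last W p T1p) (K_last W q T1p).
by rewrite (spent_agree (leqnn _) pq (leq_pred _) (leqnn _)) (arrivals_agree (leqnn _) pq tT (leqnn _)).
Qed.

End SamePast.

(** * Dynamic programming *)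

(** The map [f] and its inverse [g] are both monotone on the extended reals, infinite values
    included, so [f] carries greatest lower bounds to greatest lower bounds. *)
Lemma ereal_inf_affine (R : realType) (A k : R) (S S' : set (\bar R)) : 0 < k ->
  (forall x, S x -> exists2 y, S' y & x = (A%:E + k%:E * y)%E) ->
  (forall y, S' y -> S (A%:E + k%:E * y)%E) ->
  ereal_inf S = (A%:E + k%:E * ereal_inf S')%E.
Proof.
move=> k0 SS' S'S; pose f (x : \bar R) := (A%:E + k%:E * x)%E.
pose g (x : \bar R) := ((k^-1)%:E * (x - A%:E))%E.
have kV : 0 < k^-1 by rewrite invr_gt0.
have fg x : f (g x) = x.
  case: x => [x| |]; rewrite /f /g.
  - rewrite -EFinB -!EFinM -EFinD; congr (_%:E).
    by field; rewrite gt_eqF.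
  - by rewrite addye// gt0_muley ?lte_fin// gt0_muley ?lte_fin.
  - by rewrite addNye gt0_muleNy ?lte_fin// gt0_muleNy ?lte_fin// addeNy.
have gf x : g (f x) = x.
  case: x => [x| |]; rewrite /f /g.
  - rewrite -[LHS]/((k^-1 * (A + k * x - A))%:E); congr (_%:E).
    by field; rewrite gt_eqF.
  - by rewrite gt0_muley ?lte_fin// addey// addye// gt0_muley ?lte_fin.
  - by rewrite gt0_muleNy ?lte_fin// addeNy addNye gt0_muleNy ?lte_fin.
have f_le : {homo f : x y / (x <= y)%E}.
  by move=> x y xy; rewrite leeD2l// lee_wpmul2l// lee_fin ltW.
have g_le : {homo g : x y / (x <= y)%E}.
  by move=> x y xy; rewrite lee_wpmul2l ?leeD2r// lee_fin ltW.
apply/eqP; rewrite eq_le; apply/andP; split.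
  rewrite -[X in (X <= _)%E]fg; apply: f_le; apply: le_ereal_inf_tmp => y S'y.
  by rewrite -[y]gf; apply: g_le; apply: ereal_inf_lbound; exact: S'S.
apply: le_ereal_inf_tmp => x /SS'[y S'y ->]; apply: f_le.
exact: ereal_inf_lbound.
Qed.

Lemma affine_inj (R : realType) (A k : R) : 0 < k ->
  injective (fun x : \bar R => (A%:E + k%:E * x)%E).
Proof.
move=> k0 x y; have kN0 : k != 0 by rewrite gt_eqF.
case: x y => [x| |] [y| |]; rewrite ?gt0_muley ?gt0_muleNy ?lte_fin// ?addey ?addeNy//.
by rewrite -!EFinM -!EFinD => -[/addrI/(mulfI kN0) ->].
Qed.

Section DynamicProgramming.
Context (R : realType) (d d1 d2 : measure_display)
  (Omega : measurableType d) (Y1 : measurableType d1)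
  (Y2 : measurableType d2) (M : problem R Omega Y1 Y2).
Variable W : nat -> nat -> thr2 R.

Local Notation T1 := (T1 M).
Local Notation adm := (adm_design M).
Local Notation best := (best_cost M W).
Local Notation dcost := (design_cost M W).

Lemma best_cost_ext C D : (forall q, adm q -> C q <-> D q) -> best C = best D.
Proof.
move=> CD; rewrite /best_cost; congr (ereal_inf (_ @` _)).
by apply/seteqP; split => q [aq /(CD q aq)].
Qed.

Lemma best_cost_const p C : adm p -> C p ->
  (forall q, adm q -> C q -> dcost q = dcost p) -> best C = dcost p.
Proof.
move=> ap Cp H; apply/eqP; rewrite eq_le; apply/andP; split.
  by apply: ereal_inf_lbound; exists p.
by apply: le_ereal_inf_tmp => _ [q [aq Cq] <-]; rewrite (H q).
Qed.

Lemma best_cost_optimal p C : adm p -> C p -> design_optimal M W p -> best C = dcost p.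
Proof.
move=> ap Cp op; apply/eqP; rewrite eq_le; apply/andP; split.
  by apply: ereal_inf_lbound; exists p.
by apply: le_ereal_inf_tmp => _ [q [aq Cq] <-]; exact: op.
Qed.

(** The infimum is taken in two stages, grouping the designs by the value of one choice. An
    admissible value taken by no design contributes +oo. *)
Lemma best_cost_choice (V : Type) (admV : V -> Prop) (v : design R -> V) C :
  (forall q, adm q -> admV (v q)) ->
  best C = ereal_inf [set best (fun q => C q /\ v q = a) | a in [set a | admV a]].
Proof.
move=> Hv; apply/eqP; rewrite eq_le; apply/andP; split.
  apply: le_ereal_inf_tmp => _ [a _ <-]; apply: le_ereal_inf_tmp => _ [q [aq [Cq _]] <-].
  by apply: ereal_inf_lbound; exists q.
apply: le_ereal_inf_tmp => _ [q [aq Cq] <-].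
apply: (@le_trans _ _ (best (fun q' => C q' /\ v q' = v q))).
  by apply: ereal_inf_lbound; exists (v q) => //; exact: Hv.
by apply: ereal_inf_lbound; exists q.
Qed.

Lemma best_cost_affine A k (f g : design R -> design R) (C D : design R -> Prop) : 0 < k ->
  (forall q, adm q -> C q -> adm (f q) /\ D (f q)) ->
  (forall q, adm q -> D q -> adm (g q) /\ C (g q)) ->
  (forall q, adm q -> C q -> dcost q = (A%:E + k%:E * dcost (f q))%E) ->
  (forall q, adm q -> D q -> dcost (g q) = (A%:E + k%:E * dcost q)%E) ->
  best C = (A%:E + k%:E * best D)%E.
Proof.
move=> k0 fP gP fE gE; apply: ereal_inf_affine => //.
  move=> _ [q [aq Cq] <-]; exists (dcost (f q)); last exact: fE.
  by exists (f q) => //; exact: fP.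
by move=> _ [q [aq Dq] <-]; exists (g q); [exact: gP|exact: gE].
Qed.

Section Transfer.
Variables (V : Type) (admV : V -> Prop) (v : design R -> V).
Hypothesis vP : forall q, adm q -> admV (v q).
Variables (C D : design R -> Prop) (f g : design R -> design R) (A k : R).
Hypotheses (k_gt0 : 0 < k)
  (fP : forall q, adm q -> C q -> [/\ adm (f q), D (f q) & v (f q) = v q])
  (gP : forall q, adm q -> D q -> [/\ adm (g q), C (g q) & v (g q) = v q])
  (fE : forall q, adm q -> C q -> dcost q = (A%:E + k%:E * dcost (f q))%E)
  (gE : forall q, adm q -> D q -> dcost (g q) = (A%:E + k%:E * dcost q)%E).

(** The maps [f] and [g] exchange the pasts and keep the choice [v]. The infima with and without the
    choice fixed are thus transported by the same affine map; as it is injective, they coincide for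
    one past exactly when they do for the other. *)
Lemma choice_optimal a :
  best (fun q => C q /\ v q = a) = best C <->
  best (fun q => D q /\ v q = a) =
    ereal_inf [set best (fun q => D q /\ v q = b) | b in [set b | admV b]].
Proof.
rewrite -(best_cost_choice D vP).
have -> : best C = (A%:E + k%:E * best D)%E.
  by apply: (best_cost_affine k_gt0 _ _ fE gE) => q aq Hq;
    [have [] := fP aq Hq|have [] := gP aq Hq].
have -> : best (fun q => C q /\ v q = a) =
    (A%:E + k%:E * best (fun q => (D q /\ v q = a)))%E.
  apply: (best_cost_affine (f := f) (g := g) k_gt0).
  - by move=> q aq [Cq <-]; have [] := fP aq Cq.
  - by move=> q aq [Dq <-]; have [] := gP aq Dq.
  - by move=> q aq [Cq _]; exact: fE.
  - by move=> q aq [Dq _]; exact: gE.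
by split=> [/(affine_inj k_gt0)|->].
Qed.

End Transfer.

(* An arbitrary design when no design satisfies Q. *)
Definition representative (Q : design R -> Prop) : design R :=
  if pselect (exists r, Q r) is left e then sval (cid e)
  else Design (fun=> Thr4 0 0 0 0) 0 (fun=> Thr2 0 0).

Lemma representativeP Q p : Q p -> Q (representative Q).
Proof.
move=> Qp; rewrite /representative; case: pselect => [e|[]]; last by exists p.
exact: (svalP (cid e)).
Qed.

Definition rep_psi t (s : info_state R) : design R :=
  representative (fun r => [/\ adm r, reaches M r t.-1 & design_psi M W r t = s]).

Definition rep_phi t (s : info_state R) : design R :=
  representative (fun r => [/\ adm r, reaches M r t & design_phi M W r t None = s]).

Lemma rep_psiP p t : adm p -> reaches M p t.-1 ->
  let r := rep_psi t (design_psi M W p t) in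
  [/\ adm r, reaches M r t.-1 & design_psi M W r t = design_psi M W p t].
Proof.
move=> ap rp; exact: (@representativeP (fun r => [/\ adm r, reaches M r t.-1 &
  design_psi M W r t = design_psi M W p t]) p).
Qed.

Lemma rep_phiP p t : adm p -> reaches M p t ->
  let r := rep_phi t (design_phi M W p t None) in
  [/\ adm r, reaches M r t & design_phi M W r t None = design_phi M W p t None].
Proof.
move=> ap rp; exact: (@representativeP (fun r => [/\ adm r, reaches M r t &
  design_phi M W r t None = design_phi M W p t None]) p).
Qed.

(** The choice [v] is abstract so that the statement serves both O1's four thresholds at [t] and its
    single threshold at [T1]. Neither is altered by splicing a past before [t]. *)
Lemma optimal_psi (V : Type) (admV : V -> Prop) (v : design R -> V) p t a :
  (forall q, adm q -> admV (v q)) ->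
  (forall p q, v (splice1 t p q) = v q) ->
  adm p -> (0 < t <= T1)%N -> reaches M p t.-1 ->
  let r := rep_psi t (design_psi M W p t) in
  best (fun q => same_past t p q /\ v q = a) = best (same_past t p) <->
  best (fun q => same_past t r q /\ v q = a) =
    ereal_inf [set best (fun q => same_past t r q /\ v q = b) | b in [set b | admV b]].
Proof.
move=> vP vE ap /andP[t0 tT] rp r; have [ar rr rE] := rep_psiP ap rp.
rewrite -/r in ar rr rE; move: r ar rr rE => r ar rr rE.
case: t t0 tT rp rr rE vE => // t _ tT rp rr rE vE.
have [A [k [k0 H]]] := cost_affine1 tT rp rr (esym rE).
apply: (@choice_optimal _ _ v vP _ _ (splice1 t.+1 r) (splice1 t.+1 p) A k k0).
- by move=> q aq _; split; [exact: splice1_adm|exact: splice1_same|exact: vE].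
- by move=> q aq _; split; [exact: splice1_adm|exact: splice1_same|exact: vE].
- by move=> q aq pq; rewrite -H (splice1_id pq).
- by move=> q aq pq; rewrite H (splice1_id pq).
Qed.

(** The analogue of [optimal_psi] half a step later: O1's choice at [t] now belongs to the past,
    which is why [splice2] is used. *)
Lemma optimal_phi p t a : adm p -> (0 < t < T1)%N -> reaches M p t ->
  let r := rep_phi t (design_phi M W p t None) in
  best (fun q => [/\ same_past t p q, thr_O1 q t = thr_O1 p t & thr_O2 q t = a]) =
    best (fun q => same_past t p q /\ thr_O1 q t = thr_O1 p t) <->
  best (fun q => [/\ same_past t r q, thr_O1 q t = thr_O1 r t & thr_O2 q t = a]) =
    ereal_inf [set best (fun q =>
      [/\ same_past t r q, thr_O1 q t = thr_O1 r t & thr_O2 q t = b]) | b in [set b | adm_thr2 b]].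
Proof.
move=> ap tT rp r; have [ar rr rE] := rep_phiP ap rp.
rewrite -/r in ar rr rE; move: r ar rr rE => r ar rr rE.
have and3E q0 b : (fun q : design R =>
    [/\ same_past t q0 q, thr_O1 q t = thr_O1 q0 t & thr_O2 q t = b]) =
    (fun q => (same_past t q0 q /\ thr_O1 q t = thr_O1 q0 t) /\ thr_O2 q t = b).
  by apply/funext => q; apply/propext; split => [[]|[[]]].
rewrite !and3E.
rewrite (_ : [set _ | b in _] = [set best (fun q => (same_past t r q /\
    thr_O1 q t = thr_O1 r t) /\ thr_O2 q t = b) | b in [set b | adm_thr2 b]]); last first.
  by congr image; apply/funext => b; rewrite and3E.
have vP q : adm q -> adm_thr2 (thr_O2 q t) by move=> [_ _]; exact.
case: t tT rp {and3E} rr rE vP => // t tT rp rr rE vP.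
have [A [k [k0 H]]] := cost_affine2 tT rp rr (esym rE).
have O1E u q : thr_O1 (splice2 t.+1 u q) t.+1 = thr_O1 u t.+1 by rewrite /= leqnn.
apply: (@choice_optimal _ _ (fun q => thr_O2 q t.+1) vP _ _
  (splice2 t.+1 r) (splice2 t.+1 p) A k k0).
- move=> q aq _; split; [exact: splice2_adm| |exact: splice2_ge].
  by split; [exact: splice2_same|exact: O1E].
- move=> q aq _; split; [exact: splice2_adm| |exact: splice2_ge].
  by split; [exact: splice2_same|exact: O1E].
- by move=> q aq [pq e]; rewrite -H (splice2_id pq e).
- by move=> q aq [pq e]; rewrite H (splice2_id pq e).
Qed.

Lemma same_pastS t (p q : design R) : (0 < t)%N ->
  same_past t.+1 p q <-> [/\ same_past t p q, thr_O1 q t = thr_O1 p t & thr_O2 q t = thr_O2 p t].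
Proof.
move=> t0; split=> [pq|[pq e1 e2] s /andP[s0]].
  have [|-> ->] := pq t; first by rewrite t0 ltnSn.
  by split => // s /andP[s0 st]; apply: pq; rewrite s0 ltnW.
rewrite ltnS leq_eqVlt => /predU1P[->|st]; first by [].
by apply: pq; rewrite s0.
Qed.

Lemma same_past_refl t (p : design R) : same_past t p p.
Proof. by []. Qed.

(** An optimal design attains the least cost of every class containing it, so each of its choices is
    optimal. Conversely, the choices fix the design one at a time; if none raises the least
    achievable cost, that cost is the same at the start, where nothing is fixed, and at the end,
    where it is the cost of [p]. *)
Lemma design_optimal_steps p : adm p ->
  design_optimal M W p <->
  [/\ forall t, (1 <= t < T1)%N -> reaches M p t.-1 -> O1_optimal M W p t,
      forall t, (1 <= t < T1)%N -> reaches M p t -> O2_optimal M W p t &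
      reaches M p T1.-1 -> final_optimal M W p].
Proof.
move=> ap; split => [op|[op1 op2 opf]].
  by split => *; rewrite /O1_optimal /O2_optimal /final_optimal !(best_cost_optimal ap).
have T1p := prednK (T1_gt0 M).
have lastE : best (same_past T1 p) = dcost p.
  have H : best (fun q => same_past T1 p q /\ thr_final q = thr_final p) = dcost p.
    apply: (best_cost_const ap); first by split.
    move=> q aq [pq e]; apply: cost_agree_final.
    exact: same_past_agree_final.
  have [/opf <- //|nr] := pselect (reaches M p T1.-1).
  have tT : (T1.-1 < T1)%N by rewrite -[X in (_ < X)%N]T1p.
  apply: (best_cost_const ap); [exact: same_past_refl|move=> q aq pq].
  apply: (cost_unreached1 W tT nr).
  by apply: (same_past_agree tT); rewrite T1p.
have step t : (1 <= t < T1)%N -> best (same_past t p) = best (same_past t.+1 p).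
  move=> tT; have t0 : (0 < t)%N by case/andP: tT.
  have E1 : best (same_past t p) = best (fun q => same_past t p q /\ thr_O1 q t = thr_O1 p t).
    have [/(op1 t tT)//|nr] := pselect (reaches M p t.-1).
    have H q : same_past t p q -> dcost q = dcost p.
      move=> pq; have tT' : (t.-1 < T1)%N by rewrite prednK//; case/andP: tT => _ /ltnW.
      apply: (cost_unreached1 W tT' nr); apply: (same_past_agree tT').
      by rewrite prednK.
    transitivity (dcost p); [|apply/esym]; apply: (best_cost_const ap); [by []| |by split|].
      by move=> q _; exact: H.
    by move=> q _ [pq _]; exact: H.
  have E2 : best (fun q => same_past t p q /\ thr_O1 q t = thr_O1 p t) =
      best (fun q => [/\ same_past t p q, thr_O1 q t = thr_O1 p t & thr_O2 q t = thr_O2 p t]).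
    have [/(op2 t tT)//|nr] := pselect (reaches M p t).
    have H q : same_past t p q -> thr_O1 q t = thr_O1 p t -> dcost q = dcost p.
      move: nr tT; rewrite -(prednK t0) => nr /andP[_ tT] pq e.
      apply: (cost_unreached2 W tT nr); exact: (same_past_agree1 tT pq (esym e)).
    transitivity (dcost p); [|apply/esym]; apply: (best_cost_const ap); [by split| |by split|].
      by move=> q _ []; exact: H.
    by move=> q _ [pq e _]; exact: H.
  rewrite E1 E2; apply: best_cost_ext => q _.
  by split=> /(same_pastS p q t0).
(* [same_past 1] imposes nothing, so its best cost is the least cost of all admissible designs. *)
have best1 t : (0 < t <= T1)%N -> best (same_past 1 p) = best (same_past t p).
  elim: t => [/andP[]//|t IH tT]; case: t IH tT => [_ _|t IH tT]; first exact: erefl.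
  have tT' : (0 < t.+1 < T1)%N by case/andP: tT.
  by rewrite IH 1?(step _ tT')// /= ltnW.
move=> q aq; have T1_le : (0 < T1 <= T1)%N by rewrite T1_gt0 leqnn.
rewrite -lastE -(best1 _ T1_le).
by apply: ereal_inf_lbound; exists q; [split=> // -[]|exact: erefl].
Qed.

End DynamicProgramming.

(** * Optimality of the Wald thresholds *)

(** Turns costs computed separately under each hypothesis into a single cost weighted by the belief,
    the form in which [wald_cost] is defined. *)
Lemma integral_posterior_preimage (R : realType) (d d1 d2 : measure_display)
    (Omega : measurableType d) (Y1 : measurableType d1) (Y2 : measurableType d2)
    (M : problem R Omega Y1 Y2) dS (S : measurableType dS) (X : Omega -> S) (g : S -> R)
    (B : set S) (k : bool -> S -> \bar R) :
  measurable_fun setT X -> is_cond_H0 M X g -> measurable B ->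
  (forall h, measurable_fun setT (k h)) -> (forall h x, (0 <= k h x)%E) ->
  (\int[Pr M]_(w in hyp_set M false `&` X @^-1` B) k false (X w) +
   \int[Pr M]_(w in hyp_set M true `&` X @^-1` B) k true (X w) =
   \int[Pr M]_(w in X @^-1` B)
     (k false (X w) * (g (X w))%:E + k true (X w) * (1 - g (X w))%:E))%E.
Proof.
move=> mX gP mB mk k0; have mXB := measurable_preimageT mX mB.
pose kB h x : \bar R := if x \in B then k h x else 0%E.
have mkB h : measurable_fun setT (kB h).
  apply: measurable_fun_ifT => //.
  by apply: (measurable_fun_bool true); rewrite setTI preimage_mem_true.
have kB0 h x : (0 <= kB h x)%E by rewrite /kB; case: ifP.
have H h : (\int[Pr M]_(w in hyp_set M h `&` X @^-1` B) k h (X w) =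
    \int[Pr M]_(w in X @^-1` B) (k h (X w) * (posterior g h (X w))%:E))%E.
  rewrite integral_mkcondr [RHS]integral_mkcond.
  transitivity (\int[Pr M]_(w in hyp_set M h) kB h (X w))%E.
    apply: eq_integral => w _; rewrite patchE /kB.
    by have -> : (w \in X @^-1` B) = (X w \in B) by apply/idP/idP; rewrite !inE.
  rewrite (integral_posterior mX gP h (mkB h) (kB0 h)).
  apply: eq_integral => w _; rewrite patchE /kB.
  have -> : (w \in X @^-1` B) = (X w \in B) by apply/idP/idP; rewrite !inE.
  by case: ifP => // _; rewrite mul0e.
have mkp h : measurable_fun setT (fun w => (k h (X w) * (posterior g h (X w))%:E)%E).
  apply: emeasurable_funM; first exact: (measurableT_comp (mk h) mX).
  apply/measurable_EFinP; exact: (measurableT_comp (measurable_posterior gP h) mX).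
have kp0 h w : (0 <= k h (X w) * (posterior g h (X w))%:E)%E.
  by rewrite mule_ge0// lee_fin (posterior_ge0 gP).
rewrite !H -ge0_integralD//.
- exact: measurable_funTS.
- exact: measurable_funTS.
Qed.

Lemma measurable_cat_tuple d (U : measurableType d) m n :
  measurable_fun setT (fun x : m.-tuple U * n.-tuple U => [tuple of x.1 ++ x.2]).
Proof.
apply/measurable_fun_tnthP => i; rewrite -(fintype.splitK i); case: (fintype.split i) => j.
  rewrite (_ : _ \o _ = fun x => tnth x.1 j); last first.
    by apply/funext => x; rewrite /= tnth_lshift.
  exact: (measurableT_comp (measurable_tnth j) measurable_fst).
rewrite (_ : _ \o _ = fun x => tnth x.2 j); last first.
  by apply/funext => x; rewrite /= tnth_rshift.
exact: (measurableT_comp (measurable_tnth j) measurable_snd).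
Qed.

Section InformationTree.
Context (R : realType) (d d1 d2 : measure_display)
  (Omega : measurableType d) (Y1 : measurableType d1)
  (Y2 : measurableType d2) (M : problem R Omega Y1 Y2).

Definition info_init n (i : n.+1.-tuple Y2 * n.+1.-tuple action) :
    n.-tuple Y2 * n.-tuple action := (tuple_init i.1, tuple_init i.2).

(** O2's information at time [n] contains that at earlier times, so whether it has stopped can be
    read off the present information. This makes the event of the comparison a preimage under
    [info2]. *)
Fixpoint info_quiet (g : strategy2 Y2) n : n.-tuple Y2 * n.-tuple action -> bool :=
  if n is m.+1 then fun i => info_quiet g (info_init i) && (g m.+1 i == None)
  else fun=> true.

Lemma info_init_info2 (g1 : strategy1 Y1) n w :
  info_init (info2 M g1 n.+1 w) = info2 M g1 n w.
Proof. by rewrite /info_init /= !tuple_init_history. Qed.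

Lemma quiet2_info (g1 : strategy1 Y1) g n w :
  quiet2 M g1 g n w = info_quiet g (info2 M g1 n w).
Proof.
by elim: n => // n IH; rewrite quiet2S IH -info_init_info2.
Qed.

Lemma measurable_info_init n : measurable_fun setT (@info_init n).
Proof.
apply: measurable_fun_pair.
  exact: (measurableT_comp (@measurable_tuple_init _ _ _) measurable_fst).
exact: (measurableT_comp (@measurable_tuple_init _ _ _) measurable_snd).
Qed.

Lemma measurable_info_quiet (g : strategy2 Y2) n : (forall t, measurable_fun setT (@g t)) ->
  measurable_fun setT (@info_quiet g n).
Proof.
move=> mg; elim: n => [|n IH]; first exact: measurable_cst.
apply: measurable_and; first exact: (measurableT_comp IH (@measurable_info_init n)).
apply: (@measurableT_comp _ _ _ _ _ _ (fun a : action => a == None)) (mg n.+1).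
exact: measurable_from_discrete.
Qed.

End InformationTree.

Section WaldOptimality.
Context (R : realType) (d d1 d2 : measure_display)
  (Omega : measurableType d) (Y1 : measurableType d1)
  (Y2 : measurableType d2) (M : problem R Omega Y1 Y2).
Variable W : nat -> nat -> thr2 R.

Local Notation P := (Pr M).
Local Notation T1 := (T1 M).
Local Notation T2 := (T2 M).
Local Notation silent1 p t := (silent M (gamma1 M p) t).
Local Notation silentZ p t z :=
  (silent1 p t `&` [set w | Z1 M (gamma1 M p) t.+1 w = z]).

Lemma act2_stop g1 g2 w : (tau2 M g1 g2 w <= T2)%N -> (T2 <= tau2 M g1 g2 w)%N ->
  act2 M g1 g2 T2 w <> None.
Proof.
move=> le1 le2 an; have T20 : (0 < T2)%N by exact: leq_trans (T1_gt0 M) (T1_le_T2 M).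
by have := tau2_continue T20 (leqnn _) le2 an; rewrite ltnNge le1.
Qed.

Section Comparison.
Variables (p : design R) (g : strategy2 Y2).
Hypotheses (mg : forall t, measurable_fun setT (@g t))
  (g_stop : forall w, (tau2 M (gamma1 M p) g w <= T2)%N)
  (gE : forall t (i : t.-tuple Y2 * t.-tuple action),
    ~~ received i.2 -> @g t i = gamma2 M W p i).
Let g1 := gamma1 M p.
Let g2 := gamma2 M W p.

Lemma act2_before n w : (n <= T1)%N -> silent1 p n w -> act2 M g1 g n w = act2 M g1 g2 n w.
Proof. by move=> nT sw; rewrite /act2 gE// not_received. Qed.

Lemma tau2_before t n w : (n <= T1)%N -> silent1 p n w -> (t <= n.+1)%N ->
  (t <= tau2 M g1 g w)%N = (t <= tau2 M g1 g2 w)%N.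
Proof.
move=> nT sw tn; apply: leq_tau2_eq.
  by rewrite (leq_trans tn)// ltnS (leq_trans nT)// T1_le_T2.
move=> r /andP[r1 rt]; have rn : (r <= n)%N.
  by rewrite (leq_trans rt)//; case: t tn {rt}.
apply: act2_before; first exact: leq_trans nT.
by move=> s /andP[s1 sr]; apply: sw; rewrite s1 (leq_trans sr).
Qed.

Lemma cost2_before n w : (n <= T1)%N -> silent1 p n w -> (tau2 M g1 g2 w <= n)%N ->
  cost2 M g1 g w = cost2 M g1 g2 w.
Proof.
move=> nT sw; set s := tau2 M g1 g2 w => sn.
have sE : tau2 M g1 g w = s.
  apply/eqP; rewrite eqn_leq; apply/andP; split.
    by rewrite leqNgt (tau2_before nT sw) ?ltnS// -leqNgt.
  by rewrite (tau2_before nT sw)// leqW.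
rewrite /cost2 /decision sE -/s; congr (_ + loss M (odflt _ _) _).
apply: act2_before; first exact: leq_trans nT.
by move=> r /andP[r1 rs]; apply: sw; rewrite r1 (leq_trans rs).
Qed.

Section AfterArrival.
Variables (t0 : nat) (b : bool).
Hypothesis t0T : (t0 < T1)%N.
Let t := t0.+1.
Let E0 := silentZ p t0 (Some b).
Let info := (t.-tuple Y2 * t.-tuple action)%type.

Let tT2 : (t <= T2)%N.
Proof. exact: leq_trans (T1_le_T2 M). Qed.

(* The strategy g after the arrival, as a policy for the Wald problem.  Wald
   policies must stop at time T2 on all inputs, g only along actual
   trajectories, so a decision is forced there. *)
Definition continuation (i : info) : wald_policy Y2 := fun k y =>
  let a := g (([tuple of i.1 ++ y], [tuple of i.2 ++ [tuple of nseq k None]]) :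
    (t + k).-tuple Y2 * (t + k).-tuple action) in
  if k == (T2 - t)%N then Some (odflt false a) else a.

Lemma measurable_continuation k : measurable_fun setT
  (fun x : info * k.-tuple Y2 => @continuation x.1 k x.2).
Proof.
have ma : measurable_fun setT (fun x : info * k.-tuple Y2 =>
    g (([tuple of x.1.1 ++ x.2], [tuple of x.1.2 ++ [tuple of nseq k None]]) :
      (t + k).-tuple Y2 * (t + k).-tuple action)).
  have mi : measurable_fun setT (fun x : info * k.-tuple Y2 =>
     ([tuple of x.1.1 ++ x.2], [tuple of x.1.2 ++ [tuple of nseq k None]]) :
      (t + k).-tuple Y2 * (t + k).-tuple action).
    have m1 : measurable_fun setT (fun x : info * k.-tuple Y2 => (x.1.1, x.2)).
      apply: measurable_fun_pair; last exact: measurable_snd.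
      exact: (measurableT_comp measurable_fst measurable_fst).
    have m2 : measurable_fun setT (fun x : info * k.-tuple Y2 =>
        (x.1.2, [tuple of nseq k None]) : t.-tuple action * k.-tuple action).
      apply: measurable_fun_pair; last exact: measurable_cst.
      exact: (measurableT_comp measurable_snd measurable_fst).
    apply: measurable_fun_pair.
      exact: (measurableT_comp (@measurable_cat_tuple _ Y2 t k) m1).
    exact: (measurableT_comp (@measurable_cat_tuple _ action t k) m2).
  exact: (measurableT_comp (@mg (t + k)) mi).
rewrite /continuation; case: (k == _) => //.
apply: (@measurableT_comp _ _ _ _ _ _ (fun a : action => Some (odflt false a) : action)) ma.
exact: measurable_from_discrete.
Qed.

Lemma continuation_stop i (y : (T2 - t).-tuple Y2) : continuation i y <> None.
Proof. by rewrite /continuation eqxx. Qed.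

Lemma info2_arrival k w : E0 w -> info2 M g1 (t + k) w =
  ([tuple of (info2 M g1 t w).1 ++ later M t k w],
   [tuple of (info2 M g1 t w).2 ++ [tuple of nseq k None]]).
Proof.
move=> Ew; congr (_, _); apply: eq_from_tnth => i; rewrite tnth_mktuple -(fintype.splitK i);
    case: (fintype.split i) => j; rewrite ?tnth_lshift ?tnth_rshift ?tnth_mktuple//.
  by rewrite /= addnS.
rewrite (tnth_nth None) nth_nseq ltn_ord.
by rewrite /Z1 (arrival_tau1 t0T Ew) /= ltnS leqNgt ltnS leq_addr.
Qed.

Lemma act2_continuation w k : E0 w -> (k <= T2 - t)%N -> (t + k <= tau2 M g1 g w)%N ->
  act2 M g1 g (t + k) w = continuation (info2 M g1 t w) (later M t k w).
Proof.
move=> Ew kT tk; rewrite /continuation -(info2_arrival k Ew) -/(act2 M g1 g (t + k) w).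
case: eqP => // kE; move: tk; rewrite kE subnKC// => tk.
by case E : act2 (act2_stop (g_stop w) tk).
Qed.

Let E := E0 `&` [set w | (t <= tau2 M g1 g w)%N].
(** The event [E] as a set of values of O2's information at the arrival, as conditioning on that
    information requires. *)
Let B : set info := [set i | i.2 = arrival_history t0 b t] `&`
  [set i | info_quiet g (info_init i)].

Let EE : E = info2 M g1 t @^-1` B.
Proof.
have tE w : (t <= tau2 M g1 g w)%N = info_quiet g (info_init (info2 M g1 t w)).
  by rewrite leq_tau2 ?leqW// quiet2_info info_init_info2.
apply/seteqP; split => w [hw qw]; split.
- by apply/(arrival_historyP p b t0T w (ltnSn t0)).
- by rewrite /= -tE.
- by apply/(arrival_historyP p b t0T w (ltnSn t0)).
- by rewrite /= tE.
Qed.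

Let mB : measurable B.
Proof.
apply: measurableI.
  exact: (measurable_preimageT measurable_snd (measurable_tuple_set1 _)).
apply: (@measurable_holds _ _ (fun i : info => info_quiet g (info_init i))).
exact: (measurableT_comp (@measurable_info_quiet _ _ _ t0 mg) (@measurable_info_init _ _ t0)).
Qed.

Let E2 : E = E0 `&` [set w | (t <= tau2 M g1 g2 w)%N].
Proof.
by apply/seteqP; split => w [Ew tw]; split=> //; move: tw;
  rewrite /= (tau2_before (ltnW t0T) Ew.1).
Qed.

Let phase_cost (rho : info -> wald_policy Y2) h i : \bar R :=
  ((c2 M * t%:R)%:E + wald_cost_from M t (rho i) h (T2 - t) [tuple])%E.

Let phase_cost_ge0 rho h i : (0 <= phase_cost rho h i)%E.
Proof.
by rewrite /phase_cost adde_ge0 ?wald_cost_from_ge0// lee_fin mulr_ge0// ltW// c2_gt0.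
Qed.

(** Averaging the costs under the two hypotheses by O2's belief gives the Wald cost at that belief;
    the cost of the [t] measurements already taken factors out because the weights add up to 1. *)
Let integral_phase (rho : info -> wald_policy Y2) (g' : strategy2 Y2) :
  (forall k, measurable_fun setT (fun x : info * k.-tuple Y2 => @rho x.1 k x.2)) ->
  measurable_fun setT (cost2 M g1 g') ->
  (forall h, (\int[P]_(w in hyp_set M h `&` E) (cost2 M g1 g' w)%:E =
     \int[P]_(w in hyp_set M h `&` E) phase_cost rho h (info2 M g1 t w))%E) ->
  (\int[P]_(w in E) (cost2 M g1 g' w)%:E =
   \int[P]_(w in E) ((c2 M * t%:R)%:E +
     wald_cost M t (rho (info2 M g1 t w)) (belief2 M g1 (info2 M g1 t w))))%E.
Proof.
move=> mrho mc H; have mX := @info2_measurable _ _ _ _ _ _ _ M p t.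
have mE : measurable E by rewrite EE; exact: measurable_preimageT.
rewrite integral_hyp_split//; last 2 first.
- exact/measurable_EFinP.
- by move=> w; rewrite lee_fin cost2_ge0.
have mk h : measurable_fun setT (phase_cost rho h).
  apply: emeasurable_funD => //.
  have mp : measurable_fun setT (fun i : info => (i, [tuple]) : info * 0.-tuple Y2).
    exact: measurable_fun_pair.
  exact: (measurableT_comp (@measurable_wald_cost_from _ _ _ _ _ _ _ M _ _ _ mrho t h (T2 - t) 0) mp).
rewrite !H EE (integral_posterior_preimage mX (@belief2P _ _ _ _ _ _ _ M p t) mB mk)//.
apply: eq_integral => w _; rewrite /phase_cost /wald_cost.
set x := belief2 _ _ _.
have /andP[x0 x1] : 0 <= x <= 1 by have [_ + _] := @belief2P _ _ _ _ _ _ _ M p t; exact.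
set a0 := wald_cost_from _ _ _ _ _ _; set a1 := wald_cost_from _ _ _ _ _ _.
have a00 : (0 <= a0)%E by exact: wald_cost_from_ge0.
have a10 : (0 <= a1)%E by exact: wald_cost_from_ge0.
have c0 : (0 <= (c2 M * t%:R)%:E)%E by rewrite lee_fin mulr_ge0// ltW// c2_gt0.
rewrite (ge0_muleDl _ c0 a00) (ge0_muleDl _ c0 a10) addeACA; congr (_ + _)%E.
  by rewrite -!EFinM -EFinD -mulrDr addrC subrK mulr1.
by rewrite (muleC a0) (muleC a1).
Qed.

Hypothesis W_wald : wald_thresholds M t (W t).

(** For fixed information at the arrival, [g] continues as an admissible Wald policy. The thresholds
    are optimal for every initial belief, so the comparison holds under the integral at each
    point. *)
Lemma wald_phase_le :
  (\int[P]_(w in E) (cost2 M g1 g2 w)%:E <= \int[P]_(w in E) (cost2 M g1 g w)%:E)%E.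
Proof.
have mX := @info2_measurable _ _ _ _ _ _ _ M p t.
have mE : measurable E by rewrite EE; exact: measurable_preimageT.
have mb := @measurable_belief2 _ _ _ _ _ _ _ M p t.
pose rho (i : info) := wald_policy_from M W t0 (belief2 M g1 i).
have mrho k : measurable_fun setT (fun x : info * k.-tuple Y2 => @rho x.1 k x.2).
  have mp : measurable_fun setT (fun x : info * k.-tuple Y2 => (belief2 M g1 x.1, x.2)).
    apply: measurable_fun_pair; last exact: measurable_snd.
    exact: (measurableT_comp mb measurable_fst).
  exact: (measurableT_comp (@measurable_wald_policy_from _ _ _ _ _ _ _ M W t0 k) mp).
have mc2 : measurable_fun setT (cost2 M g1 g2).
  by apply: measurable_cost2; exact: measurable_gamma2.
have mc : measurable_fun setT (cost2 M g1 g) by exact: measurable_cost2.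
rewrite (integral_phase mrho mc2); last first.
  by move=> h; rewrite E2; exact: integral_wald_gamma2.
rewrite (integral_phase measurable_continuation mc); last first.
  move=> h; apply: (@integral_wald_phase _ _ _ _ _ _ _ M _ _ continuation
    measurable_continuation t (info2 M g1 t)) => //.
  - exact: past_info2.
  - exact: past_arrival.
  - exact: continuation_stop.
  - by move=> w [].
  - by apply: aeW => w [Ew _] k kT tk; exact: act2_continuation.
have c0 : (0 <= (c2 M * t%:R)%:E)%E by rewrite lee_fin mulr_ge0// ltW// c2_gt0.
have wc0 (r : wald_policy Y2) (i : info) : (0 <= (c2 M * t%:R)%:E + wald_cost M t r (belief2 M g1 i))%E.
  have /andP[x0 x1] : 0 <= belief2 M g1 i <= 1.
    by have [_ + _] := @belief2P _ _ _ _ _ _ _ M p t; exact.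
  by rewrite adde_ge0// /wald_cost adde_ge0// mule_ge0 ?wald_cost_from_ge0// lee_fin// subr_ge0.
have mwc (r : info -> wald_policy Y2) :
    (forall k, measurable_fun setT (fun x : info * k.-tuple Y2 => @r x.1 k x.2)) ->
    measurable_fun E (fun w => ((c2 M * t%:R)%:E +
      wald_cost M t (r (info2 M g1 t w)) (belief2 M g1 (info2 M g1 t w)))%E).
  move=> mr; apply: measurable_funTS; apply: emeasurable_funD => //.
  have mp : measurable_fun setT (fun w : Omega => (info2 M g1 t w, [tuple]) : info * 0.-tuple Y2).
    exact: measurable_fun_pair.
  have mw h := measurableT_comp (@measurable_wald_cost_from _ _ _ _ _ _ _ M _ _ _ mr t h (T2 - t) 0) mp.
  have mx : measurable_fun setT (fun w => belief2 M g1 (info2 M g1 t w)).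
    exact: (measurableT_comp mb mX).
  apply: emeasurable_funD; apply: emeasurable_funM; [|exact: mw| |exact: mw].
    exact/measurable_EFinP.
  by apply/measurable_EFinP; apply: measurable_funB.
apply: ge0_le_integral => //.
- exact: mwc mrho.
- exact: mwc measurable_continuation.
move=> w _; apply: leeD2l; apply: W_wald.2.
  by have [_ + _] := @belief2P _ _ _ _ _ _ _ M p t; exact.
split=> [k|y]; last exact: continuation_stop.
have mp : measurable_fun setT (fun y : k.-tuple Y2 => (info2 M g1 t w : info, y) : info * k.-tuple Y2).
  exact: measurable_fun_pair.
exact: (measurableT_comp (@measurable_continuation k) mp).
Qed.

(** Outside [E] O2 stopped before the arrival, when [g] and [gamma2] act alike; only the Wald phase
    makes a difference. *)
Lemma arrival_le : (\int[P]_(w in E0) (cost2 M g1 g2 w)%:E <=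
  \int[P]_(w in E0) (cost2 M g1 g w)%:E)%E.
Proof.
have mE0 : measurable E0 by exact: measurable_silentZ.
have mE : measurable E.
  by rewrite EE; apply: measurable_preimageT mB; exact: info2_measurable.
have mC (g' : strategy2 Y2) D : (forall s, measurable_fun setT (@g' s)) ->
    measurable_fun D (fun w => (cost2 M g1 g' w)%:E).
  by move=> mg'; apply/measurable_funTS/measurable_EFinP; exact: measurable_cost2.
have mg2 s : measurable_fun setT (@g2 s) by exact: measurable_gamma2.
have E0E : E0 = E `|` (E0 `\` E) by rewrite setDUK// => w [].
have split_E g' : (forall s, measurable_fun setT (@g' s)) ->
  (\int[P]_(w in E0) (cost2 M g1 g' w)%:E = \int[P]_(w in E) (cost2 M g1 g' w)%:E +
    \int[P]_(w in E0 `\` E) (cost2 M g1 g' w)%:E)%E.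
  move=> mg'; rewrite {1}E0E ge0_integral_setU//.
  - exact: measurableD.
  - exact: mC.
  - by move=> w _; rewrite lee_fin cost2_ge0.
  - by apply/disj_setPS => w [Ew []].
rewrite !split_E// leeD ?wald_phase_le//.
rewrite le_eqVlt; apply/orP; left; apply/eqP; apply: eq_integral => w /set_mem[Ew nE].
congr (_%:E); apply/esym/(cost2_before (ltnW t0T) Ew.1).
rewrite leqNgt; apply/negP => tw; apply: nE; rewrite E2; by split.
Qed.

End AfterArrival.

Hypothesis W_wald : forall t, (1 <= t <= T1)%N -> wald_thresholds M t (W t).

(** Induction backwards from [T1], where silence is impossible. One step earlier, O1 either sends a
    final message, which [arrival_le] covers, or stays silent, which is the induction hypothesis. *)
Lemma silent_le n : (n <= T1)%N -> (\int[P]_(w in silent1 p n) (cost2 M g1 g2 w)%:E <=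
  \int[P]_(w in silent1 p n) (cost2 M g1 g w)%:E)%E.
Proof.
move=> nT; rewrite -(subKn nT); elim: (T1 - n)%N => {n nT} [|n IH].
  have T1p := prednK (T1_gt0 M); have tT : (T1.-1 < T1)%N by rewrite -[X in (_ < X)%N]T1p.
  rewrite subn0 (_ : silent1 p T1 = set0) ?integral_set0//.
  apply/seteqP; split => w //= sw; move: (sw); rewrite -T1p silentS => -[sw' /=].
  by rewrite Z1_silent// /rule_O1 T1p ltnn.
(* Once [n] reaches [T1], truncated subtraction gives 0 for both indices and the claim is the
   induction hypothesis itself. *)
have [Tn|nT] := leqP T1 n.
  by move: IH; rewrite (eqP (leqW Tn)) (eqP Tn).
have mC (g' : strategy2 Y2) D : (forall s, measurable_fun setT (@g' s)) ->
    measurable_fun D (fun w => (cost2 M g1 g' w)%:E).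
  by move=> mg'; apply/measurable_funTS/measurable_EFinP; exact: measurable_cost2.
have mg2 s : measurable_fun setT (@g2 s) by exact: measurable_gamma2.
set t := (T1 - n.+1)%N; have tT : (t < T1)%N by rewrite /t ltn_subrL T1_gt0.
have tS : (T1 - n)%N = t.+1 by rewrite /t subnSK.
rewrite tS in IH.
have mE z : measurable (silentZ p t z) by exact: measurable_silentZ.
have Et : silent1 p t =
    silentZ p t (Some false) `|` silentZ p t (Some true) `|` silent1 p t.+1.
  rewrite silentS; apply/seteqP; split => w /=; last by move=> [[[]|[]]|[]].
  move=> sw; case: (Z1 _ _ _ _) => [[]|]; by [left; right|left; left|right].
have split_t g' : (forall s, measurable_fun setT (@g' s)) ->
   (\int[P]_(w in silent1 p t) (cost2 M g1 g' w)%:E =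
    \int[P]_(w in silentZ p t (Some false)) (cost2 M g1 g' w)%:E +
    \int[P]_(w in silentZ p t (Some true)) (cost2 M g1 g' w)%:E +
    \int[P]_(w in silent1 p t.+1) (cost2 M g1 g' w)%:E)%E.
  move=> mg'; have mD D : measurable_fun D (fun w => (cost2 M g1 g' w)%:E) by exact: mC.
  have c0 w : (0 <= (cost2 M g1 g' w)%:E)%E by rewrite lee_fin cost2_ge0.
  rewrite {1}Et [in LHS]silentS !ge0_integral_setU -?silentS//.
  - by apply/disj_setPS => w /= [[_ ->] [_]].
  - exact: measurableU.
  - by rewrite silentS.
  - by rewrite silentS; apply/disj_setPS => w /= [[[_ ->]|[_ ->]] [_]].
rewrite !split_t//; apply: leeD IH; apply: leeD; apply: arrival_le => //;
  by apply: W_wald; rewrite ltnS.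
Qed.

Lemma wald_optimal : (design_cost M W p <= cost M g1 g)%E.
Proof.
have costE g' : (forall s, measurable_fun setT (@g' s)) -> (cost M g1 g' =
    \int[P]_w (c1 M * (tau1 M g1 w)%:R)%:E + \int[P]_(w in silent1 p 0) (cost2 M g1 g' w)%:E)%E.
  move=> mg'; have -> : silent1 p 0 = setT.
    by apply/seteqP; split => w // _ s /andP[]; case: s.
  rewrite -ge0_integralD//.
  - by rewrite /cost unlock; apply: eq_integral => w _; rewrite /cost2 -EFinD addrA.
  - by move=> w _; rewrite lee_fin mulr_ge0// ltW// c1_gt0.
  - by apply/measurable_EFinP; apply: measurable_funM => //; exact: measurable_tau1.
  - by move=> w _; rewrite lee_fin cost2_ge0.
  - by apply/measurable_EFinP; exact: measurable_cost2.
rewrite /design_cost !costE//; first exact: leeD2l (silent_le (leq0n _)).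
exact: measurable_gamma2.
Qed.

End Comparison.
End WaldOptimality.

Theorem theorem6 (R : realType) (d d1 d2 : measure_display)
    (Omega : measurableType d) (Y1 : measurableType d1)
    (Y2 : measurableType d2) (M : problem R Omega Y1 Y2)
    (W : nat -> nat -> thr2 R)
    (W_wald : forall t, (1 <= t <= T1 M)%N -> wald_thresholds M t (W t)) :
  exists (F : nat -> info_state R -> thr4 R -> \bar R)
         (Fstar : nat -> info_state R -> \bar R)
         (G : nat -> info_state R -> thr2 R -> \bar R)
         (Gstar : nat -> info_state R -> \bar R)
         (Ffinal : info_state R -> R -> \bar R)
         (Ffinalstar : info_state R -> \bar R),
  (* the infima *)
  [/\ forall t s, (1 <= t < T1 M)%N ->
        Fstar t s = ereal_inf [set F t s a | a in [set a | adm_thr4 a]],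
      forall t s, (1 <= t < T1 M)%N ->
        Gstar t s = ereal_inf [set G t s a | a in [set a | adm_thr2 a]] &
      forall s,
        Ffinalstar s = ereal_inf [set Ffinal s a | a in [set a | adm_thr1 a]]]
  /\
  (* the information states are fixed by the past choices *)
  [/\ forall p q, adm_design M p -> adm_design M q ->
        design_psi M W p 1 = design_psi M W q 1,
      forall p q t, adm_design M p -> adm_design M q ->
        (1 <= t <= T1 M)%N -> same_past t p q ->
        design_psi M W p t = design_psi M W q t &
      forall p q t, adm_design M p -> adm_design M q ->
        (1 <= t < T1 M)%N -> same_past t p q -> thr_O1 p t = thr_O1 q t ->
        design_phi M W p t None = design_phi M W q t None]
  /\
  (* the optimal choices at each step are the optimizing parameters *)
  [/\ forall p t, adm_design M p -> (1 <= t < T1 M)%N -> reaches M p t.-1 ->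
        O1_optimal M W p t <->
        F t (design_psi M W p t) (thr_O1 p t) = Fstar t (design_psi M W p t),
      forall p t, adm_design M p -> (1 <= t < T1 M)%N -> reaches M p t ->
        O2_optimal M W p t <->
        G t (design_phi M W p t None) (thr_O2 p t)
          = Gstar t (design_phi M W p t None) &
      forall p, adm_design M p -> reaches M p (T1 M).-1 ->
        final_optimal M W p <->
        Ffinal (design_psi M W p (T1 M)) (thr_final p)
          = Ffinalstar (design_psi M W p (T1 M))]
  /\
  (* the designs obtained in this way are the optimal ones *)
  (forall p, adm_design M p ->
     design_optimal M W p <->
     [/\ forall t, (1 <= t < T1 M)%N -> reaches M p t.-1 ->
           F t (design_psi M W p t) (thr_O1 p t)
             = Fstar t (design_psi M W p t),
         forall t, (1 <= t < T1 M)%N -> reaches M p t ->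
           G t (design_phi M W p t None) (thr_O2 p t)
             = Gstar t (design_phi M W p t None) &
         reaches M p (T1 M).-1 ->
           Ffinal (design_psi M W p (T1 M)) (thr_final p)
             = Ffinalstar (design_psi M W p (T1 M))])
  /\
  (* after a final message, the Wald thresholds are optimal for O2 *)
  (forall p (g : strategy2 Y2), adm_design M p ->
     admissible2 M (gamma1 M p) g ->
     (forall t i, ~~ received i.2 -> g t i = gamma2 M W p i) ->
     (design_cost M W p <= cost M (gamma1 M p) g)%E).
Proof.
pose best := best_cost M W.
(* Each function is evaluated on a representative past for the state [s], which makes it depend on
   [s] alone. If no design reaches [s] the representative is arbitrary; the equivalences are only
   claimed at states that a design reaches with positive probability. *)
pose F t s a := best (fun q => same_past t (rep_psi M W t s) q /\ thr_O1 q t = a).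
pose G t s a := best (fun q => [/\ same_past t (rep_phi M W t s) q,
  thr_O1 q t = thr_O1 (rep_phi M W t s) t & thr_O2 q t = a]).
pose Ff s a := best (fun q => same_past (T1 M) (rep_psi M W (T1 M) s) q /\ thr_final q = a).
exists F, (fun t s => ereal_inf [set F t s a | a in [set a | adm_thr4 a]]),
  G, (fun t s => ereal_inf [set G t s a | a in [set a | adm_thr2 a]]),
  Ff, (fun s => ereal_inf [set Ff s a | a in [set a | adm_thr1 a]]).
have O1P p t : adm_design M p -> (1 <= t < T1 M)%N -> reaches M p t.-1 ->
    O1_optimal M W p t <-> F t (design_psi M W p t) (thr_O1 p t) =
      ereal_inf [set F t (design_psi M W p t) a | a in [set a | adm_thr4 a]].
  move=> ap tT rp; have tT' : (0 < t <= T1 M)%N by case/andP: tT => t1 /ltnW ->; rewrite t1.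
  have vP q : adm_design M q -> adm_thr4 (thr_O1 q t) by move=> [aq _ _]; exact: aq.
  have vE (q r : design R) : thr_O1 (splice1 t q r) t = thr_O1 r t.
    exact: (splice1_ge _ _ (leqnn t)).1.
  exact: (@optimal_psi _ _ _ _ _ _ _ M W _ _ (fun q => thr_O1 q t) p t (thr_O1 p t) vP vE ap tT' rp).
have O2P p t : adm_design M p -> (1 <= t < T1 M)%N -> reaches M p t ->
    O2_optimal M W p t <-> G t (design_phi M W p t None) (thr_O2 p t) =
      ereal_inf [set G t (design_phi M W p t None) a | a in [set a | adm_thr2 a]].
  by move=> ap tT rp; exact: optimal_phi.
have finP p : adm_design M p -> reaches M p (T1 M).-1 ->
    final_optimal M W p <-> Ff (design_psi M W p (T1 M)) (thr_final p) =
      ereal_inf [set Ff (design_psi M W p (T1 M)) a | a in [set a | adm_thr1 a]].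
  move=> ap rp; have T1_le : (0 < T1 M <= T1 M)%N by rewrite T1_gt0 leqnn.
  have vP q : adm_design M q -> adm_thr1 (thr_final q) by case.
  exact: (@optimal_psi _ _ _ _ _ _ _ M W _ _ (@thr_final R) p (T1 M) (thr_final p) vP
    (fun _ _ => erefl) ap T1_le rp).
have psiP p q t : (1 <= t <= T1 M)%N -> same_past t p q ->
    design_psi M W p t = design_psi M W q t.
  by case: t => // t tT pq; apply: psi_same => //; exact: same_past_agree.
split; [|split; [|split; [|split]]].
- by [].
- split=> [p q ap aq|p q t _ _|p q t _ _].
  + by apply: psiP; [rewrite T1_gt0|move=> [|[]]].
  + exact: psiP.
  + case: t => // t /andP[_ tT] pq e; apply: phi_same; first exact: ltnW.
    exact: same_past_agree1.
- by [].
- move=> p ap; apply: (iff_trans (design_optimal_steps W ap)).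
  split=> -[H1 H2 H3]; split=> [t tT rp|t tT rp|rp].
  + by apply/O1P => //; exact: H1.
  + by apply/O2P => //; exact: H2.
  + by apply/finP => //; exact: H3.
  + by apply/O1P => //; exact: H1.
  + by apply/O2P => //; exact: H2.
  + by apply/finP => //; exact: H3.
- move=> p g _ [mg g_stop] gE; exact: wald_optimal.
Qed.
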